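(* Let $\mathcal{J}(\rho)=J(\rho,u_\rho)$ be the objective functional of the density method (defined in the context) on nonnegative functions in $L^\infty(\mathbb{R}^d)$, and let $\widetilde{\mathcal{J}}(\rho\,dx):=\mathcal{J}(\rho)$ for $\rho\,dx\in\mathcal{P}_{ac}^\infty(\mathbb{R}^d)$. Let $\rho\,dx\in\mathcal{P}_{ac}^\infty(\mathbb{R}^d)$. Assume that $\mathcal{J}$ is Fréchet differentiable at $\rho$ in $L^\infty(\mathbb{R}^d)$ and that the differential is represented by some $F\in C^\infty(\mathbb{R}^d)$, i.e. $$\mathcal{J}(\rho+\bar\rho)=\mathcal{J}(\rho)+\int_{\mathbb{R}^d}F(x)\bar\rho(x)\,dx+h(\bar\rho)$$ for all $\bar\rho\in L^\infty(\mathbb{R}^d)$ with $\rho+\bar\rho\ge0$ (the integral being absolutely convergent), where $h\colon L^\infty(\mathbb{R}^d)\to\mathbb{R}$ satisfies $h(\bar\rho)/\|\bar\rho\|_{L^\infty}\to0$ as $\bar\rho\to0$ in $L^\infty(\mathbb{R}^d)$. Let $\phi\in C_0^\infty(\mathbb{R}^d)$ and let $\mu_t=\rho_t\,dx$, $t\in[0,T]$, be an absolutely continuous curve in $(\mathcal{P}_2(\mathbb{R}^d),\mathcal{W}_2)$ with $\rho_0=\rho$ satisfying the continuity equation with respect to the vector field $\nabla\phi$. Then $t\mapsto\widetilde{\mathcal{J}}(\mu_t)$ is differentiable at $t=0$ and $$\left(\frac{d}{dt}\right)_{t=0}\widetilde{\mathcal{J}}(\mu_t)=\langle\nabla F,\nabla\phi\rangle_{L^2(\rho)}=\int_{\mathbb{R}^d}\nabla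 F(x)\cdot\nabla\phi(x)\,\rho(x)\,dx .$$
   Context: Density-method setting. Let $n\in\mathbb{N}$. For each nonnegative $\rho\in L^\infty(\mathbb{R}^d)$ let $a_\rho$ be a bounded coercive bilinear form on $H^1(\mathbb{R}^d;\mathbb{R}^n)$ and $l_\rho$ a bounded linear functional on $H^1(\mathbb{R}^d;\mathbb{R}^n)$. Let $u_\rho\in H^1(\mathbb{R}^d;\mathbb{R}^n)$ be the unique element with $a_\rho(u_\rho,v)=\langle l_\rho,v\rangle$ for all $v\in H^1(\mathbb{R}^d;\mathbb{R}^n)$. Let $J$ be a real-valued function of $(\rho,u)$, with $\rho\in L^\infty(\mathbb{R}^d)$ nonnegative and $u\in H^1(\mathbb{R}^d;\mathbb{R}^n)$, which is $C^2$ in $u$ in the Fréchet sense. Put $\mathcal{J}(\rho):=J(\rho,u_\rho)$. $\mathcal{P}_2(\mathbb{R}^d)$ is the set of Borel probability measures on $\mathbb{R}^d$ with finite second moment, with distance $\mathcal{W}_2(\mu,\nu)=\big(\inf_\pi\int\tfrac{|x-y|^2}{2}\,\pi(dx\,dy)\big)^{1/2}$, the infimum being over couplings $\pi$ of $\mu$ and $\nu$. Put $\mathcal{P}_{ac}^\infty(\mathbb{R}^d):=\{\rho\,dx\in\mathcal{P}_2(\mathbb{R}^d)\mid\rho\in C^\infty(\mathbb{R}^d)\cap L^\infty(\mathbb{R}^d)\}$. Densities are identified when equal almost everywhere. A curve $\{\mu_t\}_{t\in[0,T]}$ in $(\mathcal{P}_2(\mathbb{R}^d),\mathcal{W}_2)$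 is absolutely continuous if there is $f\in L^1([0,T])$ with $\mathcal{W}_2(\mu_s,\mu_t)\le\int_s^t f(r)\,dr$ for all $0\le s\le t\le T$. It satisfies the continuity equation with respect to a vector field $\theta$ if for all $\psi\in C_0^\infty((0,T)\times\mathbb{R}^d)$, $$\int_0^T\int_{\mathbb{R}^d}\big(\partial_t\psi(t,x)+\nabla_x\psi(t,x)\cdot\theta(x)\big)\,d\mu_t(x)\,dt=0 .$$ $C_0^\infty$ denotes smooth compactly supported functions. Since the curve is defined on $[0,T]$, differentiability at $t=0$ is one-sided. *)

(* Defs.v *)
(* MathComp-Analysis. R^d is 'rV[R]_d for an arbitrary R : realType. *)
From HB Require Import structures.
From mathcomp Require Import all_boot all_order all_algebra.
From mathcomp Require Import all_classical all_reals all_analysis.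
From mathcomp Require Import measurable_realfun.
Set Implicit Arguments.
Unset Strict Implicit.
Unset Printing Implicit Defensive.
Import Order.TTheory GRing.Theory Num.Theory.
Import numFieldNormedType.Exports.
Local Open Scope classical_set_scope.
Local Open Scope ring_scope.

Fact rv_display : measure_display.
Proof. exact: default_measure_display. Qed.

(* 'rV[R]_d carries its Borel sigma-algebra, generated by the open sets. *)
Section Borel.
Context (R : realType) (d : nat).
Let B : set (set 'rV[R]_d) := <<s [set A : set 'rV[R]_d | open A] >>.
Let B0 : B set0. Proof. exact: sigma_algebra0. Qed.
Let BC A : B A -> B (~` A). Proof. exact: sigma_algebraC. Qed.
Let BU (F : (set 'rV[R]_d)^nat) : (forall i, B (F i)) -> B (\bigcup_i F i).
Proof. exact: sigma_algebra_bigcup. Qed.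
HB.instance Definition _ := @isMeasurable.Build rv_display 'rV[R]_d B B0 BC BU.
End Borel.

Section BorelTheory.
Context (R : realType).

Lemma open_measurable_rv d (A : set 'rV[R]_d) : open A -> measurable A.
Proof. by move=> oA; exact: sub_sigma_algebra. Qed.

Lemma measurable_coord d (i : 'I_d) :
  measurable_fun setT (fun v : 'rV[R]_d => v 0 i).
Proof.
apply: (measurability _ (RGenOpens.measurableE R)) => _ [_ [a [b ->]] <-].
rewrite setTI; apply: open_measurable_rv.
apply: open_comp; last exact: interval_open.
by move=> v _; exact: coord_continuous.
Qed.

Lemma measurable_fun_rv d' (T : measurableType d') d (f : T -> 'rV[R]_d) :
  (forall i, measurable_fun setT (fun x => f x 0 i)) -> measurable_fun setT f.
Proof.
move=> mf; apply: (@measurability _ _ _ _ _ _ [set A : set 'rV[R]_d | open A]) => //.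
move=> _ [A oA <-]; rewrite setTI.
pose box (p : 'rV[rat]_d * nat) : set 'rV[R]_d :=
  [set v | forall i, ball (ratr (p.1 0 i) : R) p.2.+1%:R^-1 (v 0 i)].
have -> : A = \bigcup_(p in [set p | box p `<=` A]) box p.
  apply/seteqP; split=> [v Av|v [p pA pv]]; last exact: pA.
  have /nbhs_ballP[e /= e0 eA] : nbhs v A by exact: open_nbhs_nbhs.
  have [k ke] : exists k : nat, k.+1%:R^-1 < e / 2.
    have [|k] := @ltr_add_invr R 0 (e / 2); first by rewrite divr_gt0.
    by rewrite add0r; exists k.

  have /choice[q hq] : forall i, exists q : rat, ball (v 0 i) k.+1%:R^-1 (ratr q).
    move=> i; have B0 : ball (v 0 i) k.+1%:R^-1 !=set0.
      by exists (v 0 i); exact: ballxx.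
    have [r [h [q _ qr]]] := @dense_rat R _ B0 (ball_open _ _).
    by exists q; rewrite qr.
  have bv : box (\row_i q i, k) v by move=> i; rewrite /= mxE; exact: ball_sym.
  exists (\row_i q i, k) => //= w hw; apply: eA; split => // i j; rewrite ord1.
  apply: (@le_ball _ _ _ (k.+1%:R^-1 + k.+1%:R^-1)).
    by rewrite (splitr e) lerD// ltW.
  by apply: ball_triangle (hq j) _; have := hw j; rewrite /= mxE.
rewrite bigcup_mkcond preimage_bigcup.
apply: countable_bigcupT_measurable => // p.
case: ifPn => _; last by rewrite preimage_set0.
rewrite [X in measurable X](_ : _ =
    \bigcap_i ((fun x => f x 0 i) @^-1` ball (ratr (p.1 0 i) : R) p.2.+1%:R^-1)).
  apply: fin_bigcap_measurable => // i _; rewrite -[X in measurable X]setTI.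
  by apply: mf => //; exact: measurable_ball.
by apply/seteqP; split=> [x h i _|x h i]; exact: h.
Qed.

Definition cons_rv d (p : R * 'rV[R]_d) : 'rV[R]_d.+1 :=
  \row_i (if unlift ord0 i is Some j then p.2 0 j else p.1).
Definition uncons_rv d (v : 'rV[R]_d.+1) : R * 'rV[R]_d :=
  (v 0 ord0, \row_j v 0 (lift ord0 j)).

Lemma cons_rvK d : cancel (@cons_rv d) (@uncons_rv d).
Proof.
move=> [x v]; congr pair; first by rewrite mxE unlift_none.
by apply/rowP => j; rewrite !mxE liftK.
Qed.

Lemma measurable_cons_rv d : measurable_fun setT (@cons_rv d).
Proof.
apply: measurable_fun_rv => i; under eq_fun do rewrite mxE.
case: (unlift ord0 i) => [j|]; last exact: measurable_fst.
exact: (measurableT_comp (measurable_coord j) measurable_snd).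
Qed.

Lemma measurable_uncons_rv d : measurable_fun setT (@uncons_rv d).
Proof.
apply: measurable_fun_pair; first exact: measurable_coord.
apply: measurable_fun_rv => i; under eq_fun do rewrite mxE.
exact: measurable_coord.
Qed.
End BorelTheory.

Section LebesgueStep.
Context (R : realType) (d : nat)
  (m : {sigma_finite_measure set 'rV[R]_d -> \bar R}).

Definition lebesgue_step : set 'rV[R]_d.+1 -> \bar R :=
  pushforward (@lebesgue_measure R \x m)%E (@cons_rv R d).

HB.instance Definition _ := Measure.copy lebesgue_step
  (measure_function_pushforward__canonical__measure_function_Measure
     (@lebesgue_measure R \x m)%E (@measurable_cons_rv R d)).

Let sigma_finite_step : sigma_finite setT lebesgue_step.
Proof.
have /sigma_finiteP[F [TF ndF mF]] := sigma_finiteT (@lebesgue_measure R).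
have /sigma_finiteP[G [TG ndG mG]] := sigma_finiteT m.
exists (fun i => @uncons_rv R d @^-1` (F i `*` G i)).
  rewrite -preimage_bigcup (_ : \bigcup_i _ = setT) ?preimage_setT//.
  apply/seteqP; split => // -[x v] _.
  have [i _ Fx] : (\bigcup_i F i) x by rewrite -TF.
  have [j _ Gv] : (\bigcup_i G i) v by rewrite -TG.
  exists (maxn i j) => //; split => /=.
    by move: x Fx; exact/subsetPset/ndF/leq_maxl.
  by move: v Gv; exact/subsetPset/ndG/leq_maxr.
move=> i; have [mFi Foo] := mF i; have [mGi Goo] := mG i; split.
  rewrite -[X in measurable X]setTI; apply: measurable_uncons_rv => //.
  exact: measurableX.
rewrite /lebesgue_step /pushforward -comp_preimage.
rewrite (_ : _ \o _ = id) ?preimage_id; last first.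
  by apply/funext => p /=; rewrite cons_rvK.
by rewrite product_measure1E// lte_mul_pinfty// ge0_fin_numE.
Qed.
HB.instance Definition _ :=
  Measure_isSigmaFinite.Build _ _ _ lebesgue_step sigma_finite_step.
End LebesgueStep.

(* Lebesgue measure on Borel sets of R^d: the iterated product of the
   one-dimensional one, transported along R * R^d ~ R^(d+1); see
   lebesgue_rv_box. *)
Fixpoint lebesgue_rv (R : realType) (d : nat) :
    {sigma_finite_measure set 'rV[R]_d -> \bar R} :=
  if d is d'.+1 then lebesgue_step (lebesgue_rv R d')
  else @dirac _ 'rV[R]_0 0 R.

Lemma lebesgue_rv_box (R : realType) (d : nat) (A : 'I_d -> set R) :
  (forall i, measurable (A i)) ->
  lebesgue_rv R d [set v | forall i, A i (v 0 i)] =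
  (\prod_(i < d) lebesgue_measure (A i))%E.
Proof.
elim: d A => [|d IH] A mA.
  by rewrite big_ord0 /= diracE mem_set// => -[].
rewrite big_ord_recl -IH//=.
rewrite /lebesgue_step /pushforward.
rewrite -[RHS](@product_measure1E _ _ _ _ _ _ (lebesgue_rv R d))//; last first.
  rewrite [X in measurable X](_ : _ =
    \bigcap_i ((fun v : 'rV[R]_d => v 0 i) @^-1` (A (lift ord0 i)))).
    apply: fin_bigcap_measurable => // i _; rewrite -[X in measurable X]setTI.
    exact: measurable_coord.
  by apply/seteqP; split=> [x h i _|x h i]; exact: h.
  exact: mA.
congr ((lebesgue_measure \x lebesgue_rv R d)%E _).
apply/seteqP; split=> [[x v] /= h|[x v] /= [h1 h2] i].
  split; first by have := h ord0; rewrite mxE unlift_none.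
  by move=> i; have := h (lift ord0 i); rewrite mxE liftK.
by rewrite mxE; case: unliftP => [j ->|->].
Qed.

Section Smooth.
Context (R : realType).

Fixpoint iter_derive (V : normedModType R) (s : seq V) (f : V -> R) : V -> R :=
  if s is v :: s' then 'D_v (iter_derive s' f) else f.

(* All iterated directional derivatives, of every order and in arbitrary
   directions, exist and are continuous. In finite dimension this is C^oo; the
   space V is R^d, or R * R^d for space-time test functions. *)
Definition smooth (V : normedModType R) (f : V -> R) : Prop :=
  forall s : seq V, continuous (iter_derive s f) /\
    forall x v, derivable (iter_derive s f) x v.

Definition supp (V : normedModType R) (f : V -> R) : set V :=
  closure [set x | f x != 0].

(* C_0^oo(U) for an open U, each element being extended by 0 outside U. *)
Definition test_function (V : normedModType R) (U : set V) (f : V -> R) : Prop :=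
  [/\ smooth f, compact (supp f) & supp f `<=` U].

Definition partial d (i : 'I_d) (f : 'rV[R]_d -> R) : 'rV[R]_d -> R :=
  'D_(delta_mx 0 i) f.

Definition grad d (f : 'rV[R]_d -> R) (x : 'rV[R]_d) : 'rV[R]_d :=
  \row_i partial i f x.

(* The library norm on 'rV[R]_d is the sup norm, so Euclidean quantities are
   written with dotp. *)
Definition dotp d (x y : 'rV[R]_d) : R := \sum_(i < d) x 0 i * y 0 i.
End Smooth.

(* Elements of L^2, L^oo and H^1 are represented by functions: sets of functions
   below are to be read modulo equality almost everywhere, and norms are
   seminorms on representatives. *)
Section Sobolev.
Context (R : realType) (d : nat).
Local Notation leb := (lebesgue_rv R d).

Definition weak_partial (i : 'I_d) (f g : 'rV[R]_d -> R) : Prop :=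
  forall psi, test_function setT psi ->
    (\int[leb]_x (f x * partial i psi x) = - \int[leb]_x (g x * psi x))%R.

Definition has_weak_partial (i : 'I_d) (f g : 'rV[R]_d -> R) : Prop :=
  g \in Lfun leb 2%:E /\ weak_partial i f g.

(* The weak partial derivative is unique up to a null set; any representative in
   L^2 will do. *)
Definition wpartial (i : 'I_d) (f : 'rV[R]_d -> R) : 'rV[R]_d -> R :=
  get (has_weak_partial i f).

Definition L2norm (f : 'rV[R]_d -> R) : R := fine 'N[leb]_2%:E[EFin \o f].
Definition Linfty_norm (f : 'rV[R]_d -> R) : R := fine 'N[leb]_+oo[EFin \o f].

Definition sobolevH1 (n : nat) : set ('rV[R]_d -> 'rV[R]_n) :=
  [set u | forall k : 'I_n, (fun x => u x 0 k) \in Lfun leb 2%:E /\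
     forall i : 'I_d, exists g, has_weak_partial i (fun x => u x 0 k) g].

Definition sobolevH1_norm (n : nat) (u : 'rV[R]_d -> 'rV[R]_n) : R :=
  Num.sqrt (\sum_(k < n) (L2norm (fun x => u x 0 k) ^+ 2 +
     \sum_(i < d) L2norm (wpartial i (fun x => u x 0 k)) ^+ 2)).

Definition Linfty_ge0 : set ('rV[R]_d -> R) :=
  [set r | r \in Lfun leb +oo%E /\ {ae leb, forall x, 0 <= r x}].
End Sobolev.

(* Functionals on a subspace D of a space of functions seminormed by N. A
   functional is total on representatives, but only its values on D matter. *)
Section Frechet.
Context (R : realType) (V : lmodType R) (D : set V) (N : V -> R).

Definition bounded_linear (L : V -> R) : Prop :=
  (forall (c : R) u v, D u -> D v -> L (c *: u + v) = c * L u + L v) /\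
  exists C : R, forall u, D u -> `|L u| <= C * N u.

Definition bounded_bilinear (a : V -> V -> R) : Prop :=
  [/\ forall (c : R) u v w, D u -> D v -> D w ->
        a (c *: u + v) w = c * a u w + a v w,
      forall (c : R) u v w, D u -> D v -> D w ->
        a w (c *: u + v) = c * a w u + a w v
    & exists C : R, forall u v, D u -> D v -> `|a u v| <= C * N u * N v].

Definition coercive (a : V -> V -> R) : Prop :=
  exists2 c : R, 0 < c & forall u, D u -> c * N u ^+ 2 <= a u u.

(* f1 u and f2 u are the first and second Frechet derivatives of f at u along D.
   Convergence of f1 and f2 is in the dual norm and in the norm of bounded bilinear
   forms. Being controlled by N, f is constant on almost everywhere classes. *)
Definition frechet_C2 (f : V -> R) : Prop :=
  exists (f1 : V -> V -> R) (f2 : V -> V -> V -> R),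
  forall u, D u ->
  [/\ bounded_linear (f1 u) /\ bounded_bilinear (f2 u),
      forall e : R, 0 < e -> exists2 del : R, 0 < del &
        forall v, D v -> N v < del ->
          `|f (u + v) - f u - f1 u v| <= e * N v,
      forall e : R, 0 < e -> exists2 del : R, 0 < del &
        forall v, D v -> N v < del -> forall w, D w ->
          `|f1 (u + v) w - f1 u w - f2 u v w| <= e * N v * N w
    & forall e : R, 0 < e -> exists2 del : R, 0 < del &
        forall v, D v -> N v < del -> forall w z, D w -> D z ->
          `|f2 (u + v) w z - f2 u w z| <= e * N w * N z].
End Frechet.

Section DensityMethod.
Context (R : realType) (d n : nat).
Local Notation leb := (lebesgue_rv R d).
Local Notation vfield := ('rV[R]_d -> 'rV[R]_n).
Local Notation dens := ('rV[R]_d -> R).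

(* u r is the solution u_r of the state equation, which is unique modulo
   almost everywhere equality by coercivity. dm_ae says that the data depend only
   on the class of r in L^oo. *)
Record density_method (a : dens -> vfield -> vfield -> R) (l : dens -> vfield -> R)
    (u : dens -> vfield) (J : dens -> vfield -> R) : Prop := DensityMethod {
  dm_bilinear : forall r, Linfty_ge0 r ->
    bounded_bilinear (@sobolevH1 R d n) (@sobolevH1_norm R d n) (a r) ;
  dm_coercive : forall r, Linfty_ge0 r ->
    coercive (@sobolevH1 R d n) (@sobolevH1_norm R d n) (a r) ;
  dm_linear : forall r, Linfty_ge0 r ->
    bounded_linear (@sobolevH1 R d n) (@sobolevH1_norm R d n) (l r) ;
  dm_state : forall r, Linfty_ge0 r ->
    sobolevH1 (u r) /\ forall v, sobolevH1 v -> a r (u r) v = l r v ;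
  dm_C2 : forall r, Linfty_ge0 r ->
    frechet_C2 (@sobolevH1 R d n) (@sobolevH1_norm R d n) (J r) ;
  dm_ae : forall r r', Linfty_ge0 r -> Linfty_ge0 r' -> r = r' %[ae leb] ->
    [/\ forall v w, sobolevH1 v -> sobolevH1 w -> a r v w = a r' v w,
        forall v, sobolevH1 v -> l r v = l r' v
      & forall v, sobolevH1 v -> J r v = J r' v] }.

Definition objective (u : dens -> vfield) (J : dens -> vfield -> R) (r : dens) : R :=
  J r (u r).

End DensityMethod.

Section Wasserstein.
Context (R : realType) (d : nat).
Local Notation leb := (lebesgue_rv R d).
Local Notation proba := (probability 'rV[R]_d R).
Local Open Scope ereal_scope.

Definition P2 (mu : proba) : Prop := \int[mu]_x (dotp x x)%:E < +oo.

Definition coupling (mu nu : proba)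
    (pi : probability ('rV[R]_d * 'rV[R]_d)%type R) : Prop :=
  forall A : set 'rV[R]_d, measurable A ->
    pi (A `*` setT) = mu A /\ pi (setT `*` A) = nu A.

(* Valued in \bar R; it is finite on measures with finite second moments. *)
Definition W2 (mu nu : proba) : \bar R :=
  ereal_inf [set \int[pi]_z (dotp (z.1 - z.2) (z.1 - z.2) / 2)%:E
            | pi in coupling mu nu] `^ 2^-1.

Definition has_density (mu : proba) (r : 'rV[R]_d -> R) : Prop :=
  [/\ measurable_fun setT r, {ae leb, forall x, (0 <= r x)%R}
    & forall A, measurable A -> mu A = \int[leb]_(x in A) (r x)%:E].

(* mu = r dx belongs to P_ac^oo. *)
Definition Pac_density (mu : proba) (r : 'rV[R]_d -> R) : Prop :=
  [/\ P2 mu, has_density mu r, smooth r & r \in Lfun leb +oo].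

Definition Pac (mu : proba) : Prop := exists r, Pac_density mu r.

(* The functional r dx |-> JJ r on Pac. The smooth density of a measure in Pac is
   unique, as continuous functions equal almost everywhere coincide. Outside Pac
   the value is meaningless. *)
Definition lift_Pac (JJ : ('rV[R]_d -> R) -> R) (mu : proba) : R :=
  JJ (get (Pac_density mu)).

Definition abs_continuous_curve (T : R) (mu : R -> proba) : Prop :=
  (forall t, (0 <= t <= T)%R -> P2 (mu t)) /\
  exists2 f : R -> R,
    (@lebesgue_measure R).-integrable `[0%R, T] (EFin \o f) &
    forall s t, (0 <= s)%R -> (s <= t)%R -> (t <= T)%R ->
      W2 (mu s) (mu t) <= \int[lebesgue_measure]_(r in `[s, t]) (f r)%:E.

Definition continuity_equation (T : R) (mu : R -> proba)
    (theta : 'rV[R]_d -> 'rV[R]_d) : Prop :=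
  forall psi : R * 'rV[R]_d -> R,
    test_function [set p | (0 < p.1 < T)%R] psi ->
    (\int[lebesgue_measure]_(t in `[0, T])
       \int[mu t]_x ('D_(1, 0) psi (t, x) +
                     dotp (grad (fun y => psi (t, y)) x) (theta x)) = 0)%R.

End Wasserstein.

Section FrechetLinfty.
Context (R : realType) (d : nat).
Local Notation leb := (lebesgue_rv R d).

(* JJ is Frechet differentiable at r along L^oo perturbations preserving
   nonnegativity, with differential b |-> \int F b. *)
Definition represents_differential (JJ : ('rV[R]_d -> R) -> R)
    (r F : 'rV[R]_d -> R) : Prop :=
  exists2 h : ('rV[R]_d -> R) -> R,
    forall b, b \in Lfun leb +oo%E -> Linfty_ge0 (r \+ b) ->
      leb.-integrable setT (fun x => (F x * b x)%:E) /\
      JJ (r \+ b) = JJ r + (\int[leb]_x (F x * b x))%R + h b &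
    forall e : R, 0 < e -> exists2 del : R, 0 < del &
      forall b, b \in Lfun leb +oo%E -> 0 < Linfty_norm b < del ->
        `|h b / Linfty_norm b| < e.
End FrechetLinfty.

(* Main.v *)
(* The flow X of grad phi is the identity outside the support of phi, and with
   Z t x = \int_0^t laplacian phi (X s x) ds the functions
   p_t x = rho (X (-t) x) exp (Z (-t) x) solve d/dt p_t = - div (p_t grad phi), p_0 = rho.
   Testing the continuity equation with S t * g (X (a - t) x), where S is a smooth
   step in time, and using that t |-> \int f d(mu t) is continuous for bounded Lipschitz
   f, one gets \int g (X t x) d(mu 0) = \int g d(mu t); integration by parts gives the
   same identity for p_t dx, so mu t = p_t dx. Hence p_t is the smooth density of mu t,
   ||p_t - rho||_oo = O(t), and by the Frechet expansion the derivative at 0 is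
   - \int F div (rho grad phi), which is the claim after integration by parts. *)
Require Import Defs.
From HB Require Import structures.
From mathcomp Require Import all_boot all_order all_algebra.
From mathcomp Require Import all_classical all_reals all_analysis.
From mathcomp Require Import measurable_realfun ess_sup_inf ring lra.
Import Order.TTheory GRing.Theory Num.Theory.
Import numFieldNormedType.Exports.
Set Implicit Arguments.
Unset Strict Implicit.
Unset Printing Implicit Defensive.
Local Open Scope classical_set_scope.
Local Open Scope ring_scope.

(** * Iterated derivatives *)

(** Weak convergence of [mu t] to [mu 0] would not suffice: the expansion of the functional controls
    only perturbations that are small in L^oo, and [abs_continuous_curve] gives no such control of
    the densities. Hence the curve is identified explicitly, with a density that differs from [rho]
    by a function supported in a fixed ball. The factor [expR (Z s x)] is the Jacobian determinant
    of [X s] (Liouville's formula), but neither determinants nor a change of variables occur: [Z] is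
    carried as one more coordinate of the flow, and the pairing of [g (X (t - s) x)] with the
    density at time [s] is shown to be constant in [s], its derivative being the integral of a
    divergence. Since [g (X (t - s) x)] solves the adjoint transport equation, testing the
    continuity equation with it leaves only the derivative of the time factor. This yields weak
    constancy on the open time interval; continuity of the curve is what carries it to the endpoint
    0, where the density is prescribed. Regularity of the flow rests on Gronwall bounds that are
    uniform on balls. *)

Section RowNorm.
Context (R : realType).

Lemma rVB n (u v : 'rV[R]_n) i : (u - v) 0 i = u 0 i - v 0 i.
Proof. by rewrite !mxE. Qed.

Lemma coord_le_norm n (v : 'rV[R]_n) i : `|v 0 i| <= `|v|.
Proof. by rewrite [leRHS]mx_normrE; exact: (le_bigmax _ _ (0, i)). Qed.

Lemma norm_rV_le n (v : 'rV[R]_n) r :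
  0 <= r -> (forall i, `|v 0 i| <= r) -> `|v| <= r.
Proof.
by move=> r0 h; rewrite [leLHS]mx_normrE (bigmax_le _ r0)//= => -[i j] _; rewrite ord1.
Qed.

End RowNorm.

Section DeriveLine.
Context (R : realType) (V W : normedModType R).

Lemma is_derive_line (f : V -> W) x v h df :
  is_derive (x + h *: v) v f df -> is_derive h 1 (fun s : R => f (x + s *: v)) df.
Proof.
have E : (fun s : R => s^-1 *: (((fun s : R => f (x + s *: v)) \o shift h) (s *: 1) -
   f (x + h *: v))) = (fun s => s^-1 *: ((f \o shift (x + h *: v)) (s *: v) - f (x + h *: v))).
  apply/funext => s /=; congr (_ *: (f _ - _)).
  by rewrite [s%:A]mulr1 scalerDl addrCA.
by move=> [d <-]; split; rewrite /derivable /derive E.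
Qed.

(** The two difference quotients are the same function of the increment. Serves for translations,
    dilations, time reversal and insertion into R * R^d. *)
Lemma is_derive_affine (U : normedModType R) (A : U -> V) (f : V -> W) x v w df :
  (forall h : R, A (x + h *: v) = A x + h *: w) ->
  is_derive (A x) w f df -> is_derive x v (f \o A) df.
Proof.
move=> hA.
have E : (fun s : R => s^-1 *: (((f \o A) \o shift x) (s *: v) - (f \o A) x))
   = (fun s => s^-1 *: ((f \o shift (A x)) (s *: w) - f (A x))).
  by apply/funext => s /=; rewrite (addrC (s *: v)) hA (addrC (s *: w)).
by move=> [d <-]; split; rewrite /derivable /derive E.
Qed.
End DeriveLine.

Section MeanValue.
Context (R : realType).

Lemma is_derive_continuous (W : normedModType R) (f : R -> W) (x : R) df :
  is_derive x 1 f df -> {for x, continuous f}.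
Proof. by move=> [d _]; apply/differentiable_continuous/derivable1_diffP. Qed.

Lemma mvt_R (f df : R -> R) (a b : R) : a <= b ->
  (forall x, a <= x <= b -> is_derive x 1 f (df x)) ->
  exists2 c, a <= c <= b & f b - f a = df c * (b - a).
Proof.
move=> ab H; have [||c] := @MVT_segment R f df a b ab.
- by move=> x xab; apply: H; move: xab; rewrite in_itv/= => /andP[/ltW-> /ltW->].
- apply: derivable_within_continuous => x; rewrite in_itv/= => /H[].
  by [].
by rewrite in_itv/= => cab E; exists c.
Qed.

Lemma mvt_line (V : normedModType R) (f : V -> R) x v (a : R) :
  (forall h, derivable f (x + h *: v) v) ->
  exists2 c, `|c| <= `|a| & f (x + a *: v) - f x = a * 'D_v f (x + c *: v).
Proof.
move=> H; have D (h : R) : is_derive h 1 (fun s : R => f (x + s *: v)) ('D_v f (x + h *: v)).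
  by apply: is_derive_line; exact/derivableP.
have [a0|a0] := leP 0 a.
- have [c /andP[c0 ca]] := mvt_R a0 (fun h _ => D h).
  rewrite scale0r addr0 subr0 mulrC => E; exists c => //.
  by rewrite !ger0_norm.
- have [c /andP[c0 ca]] := mvt_R (ltW a0) (fun h _ => D h).
  rewrite scale0r addr0 sub0r => E; exists c => //.
    by rewrite !ler0_norm// ?(ltW a0)// lerN2.
  by rewrite -opprB E mulrN opprK mulrC.
Qed.

(** Corners of a path from [x] to [y] along the coordinate axes, so that [mvt_line] applies edge by
    edge. *)
Definition mixed n (x y : 'rV[R]_n) (k : nat) : 'rV[R]_n :=
  \row_j (if (j < k)%N then y 0 j else x 0 j).

(** Only partial derivatives are at hand, so the increment is telescoped over the corners
    [mixed x y k]. In the sup norm none of the intermediate points is farther from [x] than [y]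
    is. *)
Lemma mvt_rV n (f : 'rV[R]_n -> R) (x y : 'rV[R]_n) :
  (forall z i, derivable f z (delta_mx 0 i)) ->
  exists2 xi : 'I_n -> 'rV[R]_n, (forall i, `|xi i - x| <= `|y - x|) &
    f y - f x = \sum_i (y 0 i - x 0 i) * partial i f (xi i).
Proof.
move=> H.
have /choice[c hc] : forall i : 'I_n, exists c : R, `|c| <= `|y 0 i - x 0 i| /\
    f (mixed x y i.+1) - f (mixed x y i) =
    (y 0 i - x 0 i) * partial i f (mixed x y i + c *: delta_mx 0 i).
  move=> i; have [|c c1 c2] := @mvt_line _ f (mixed x y i) (delta_mx 0 i) (y 0 i - x 0 i).
    by move=> h; exact: H.
  exists c; split => //; rewrite -c2; congr (f _ - _).
  apply/rowP => j; rewrite !mxE eqxx /=; have [->|ji] := eqVneq j i.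
    by rewrite ltnn ltnSn mulr1 addrC subrK.
  by rewrite mulr0 addr0 ltnS leq_eqVlt (negbTE (ji : (j != i :> nat))).
exists (fun i : 'I_n => mixed x y i + c i *: delta_mx 0 i).
  move=> i; apply: norm_rV_le => // j; rewrite !mxE eqxx /=.
  have [->|ji] := eqVneq j i.
    rewrite ltnn mulr1 addrAC subrr add0r (le_trans (hc i).1)//.
    by have := coord_le_norm (y - x) i; rewrite !mxE.
  rewrite mulr0 addr0; case: ifPn => _; last by rewrite subrr normr0.
  by have := coord_le_norm (y - x) j; rewrite !mxE.
transitivity (\sum_(0 <= i < n) (f (mixed x y i.+1) - f (mixed x y i))); last first.
  by rewrite big_mkord; apply: eq_bigr => i _; exact: (hc i).2.
rewrite telescope_sumr//; congr (f _ - f _); apply/rowP => j; rewrite !mxE//.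
by rewrite ltn_ord.
Qed.

End MeanValue.

Section ChainRule.
Context (R : realType) (V : normedModType R).

(** Chain rule through continuity of the partial derivatives at [g x]: [mvt_rV] writes the increment
    of [f] with partial derivatives at points [xi h i], and these tend to [g x] with [h]. *)
Lemma is_derive_comp_rV n (f : 'rV[R]_n -> R) (g : V -> 'rV[R]_n) x v (dg : 'I_n -> R) :
  (forall z i, derivable f z (delta_mx 0 i)) ->
  (forall i, {for g x, continuous (partial i f)}) ->
  (forall i, is_derive x v (fun y => g y 0 i) (dg i)) ->
  is_derive x v (f \o g) (\sum_i dg i * partial i f (g x)).
Proof.
move=> Hf Hc Hg.
have /choice[xi hxi] : forall h : R, exists xi : 'I_n -> 'rV[R]_n,
    (forall i, `|xi i - g x| <= `|g (h *: v + x) - g x|) /\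
    f (g (h *: v + x)) - f (g x) =
      \sum_i (g (h *: v + x) 0 i - g x 0 i) * partial i f (xi i).
  by move=> h; have [xi h1 h2] := mvt_rV (g x) (g (h *: v + x)) Hf; exists xi.
have gcv : g (h *: v + x) @[h --> 0^'] --> g x.
  have : derivable g x v by apply/derivable_mxP => i j; rewrite ord1; case: (Hg j).
  move=> /derivable1P/derivable1_diffP/differentiable_continuous; rewrite /prop_for /continuous_at.
  rewrite scale0r add0r => gc; exact: cvg_within_filter gc.
have xicv i : xi h i @[h --> 0^'] --> g x.
  apply/cvgrPdist_le => e e0; move/cvgrPdist_le : gcv => /(_ _ e0).
  apply: filterS => h; apply: le_trans; rewrite distrC [leRHS]distrC.
  exact: (hxi h).1.
suff : h^-1 *: (((f \o g) \o shift x) (h *: v) - (f \o g) x) @[h --> 0^'] -->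
    \sum_i dg i * partial i f (g x).
  by move=> H; split; [apply/cvg_ex; eexists; exact: H|exact: cvg_lim H].
rewrite [X in X @ _](_ : _ = fun h : R => \sum_i
   (h^-1 *: (g (h *: v + x) 0 i - g x 0 i)) * partial i f (xi h i)); last first.
  apply/funext => h /=; rewrite (hxi h).2 scaler_sumr.
  by apply: eq_bigr => i _; rewrite /GRing.scale/= mulrA.
apply: cvg_big => [|i _]; first exact: add_continuous.
apply: cvgM.
  by have [/cvg_ex[l hl] <-] := Hg i; rewrite [X in _ --> X](cvg_lim _ hl).
exact: continuous_cvg (xicv i).
Qed.

End ChainRule.

Section Directions.
Context (R : realType).

Lemma is_derive1_dir (W : normedModType R) (f : R -> W) (x c : R) df :
  is_derive x 1 f df -> is_derive x c f (c *: df).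
Proof.
move=> [d <-]; have dd := (derivable1_diffP f x).1 d.
split; first exact: diff_derivable.
by rewrite !deriveE// -linearZ/= [c%:A]mulr1.
Qed.

End Directions.

Section Ck.
Context (R : realType).

(* The order of differentiation is opposite to that of iter_derive: the first
   derivative is taken first, so that chain and product rules go through by
   induction. *)
Fixpoint Ck (V : normedModType R) (k : nat) (f : V -> R) : Prop :=
  if k is k'.+1 then
    [/\ continuous f, (forall x v, derivable f x v) & forall v, Ck k' ('D_v f)]
  else continuous f.

Section Generic.
Context (V : normedModType R).
Implicit Types (f g : V -> R).

Lemma Ck_continuous k f : Ck k f -> continuous f.
Proof. by case: k => [//|k []]. Qed.
Arguments Ck_continuous [k f] _ _.

Lemma CkW k f : Ck k.+1 f -> Ck k f.
Proof.
elim: k f => [|k IH] f [cf df ddf]//; split => // v.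
by apply: IH; exact: ddf.
Qed.

Lemma Ck_iter k f : (forall s : seq V, (size s <= k)%N ->
    continuous (iter_derive s f) /\
    forall x v, derivable (iter_derive s f) x v) -> Ck k f.
Proof.
elim: k f => [|k IH] f H; first exact: (H [::] isT).1.
have [cf df] := H [::] isT; split => // v; apply: IH => s sk.
have := H (rcons s v); rewrite size_rcons => /(_ sk).
have -> // : iter_derive (rcons s v) f = iter_derive s ('D_v f).
by elim: s {sk} => //= w s ->.
Qed.

Lemma smoothP f : smooth f <-> forall k, Ck k f.
Proof.
split=> [H k|H s]; first by apply: Ck_iter => s _; exact: H.
have : Ck (size s).+1 f by [].
elim/last_ind: s f {H} => [|s v IH] f; first by case.
rewrite size_rcons => -[cf df ddf].
have -> : iter_derive (rcons s v) f = iter_derive s ('D_v f).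
  by elim: s {IH ddf} => //= w s ->.
exact: IH.
Qed.

Lemma Ck_succ k f (df : V -> V -> R) :
  continuous f -> (forall x v, is_derive x v f (df v x)) ->
  (forall v, Ck k (df v)) -> Ck k.+1 f.
Proof.
move=> cf Df H; split => // v.
suff -> : 'D_v f = df v by [].
by apply/funext => x; have [_ ->] := Df x v.
Qed.

Lemma Ck_derive k f x v : Ck k.+1 f -> is_derive x v f ('D_v f x).
Proof. by case=> _ + _; move=> /(_ x v)/derivableP. Qed.

Lemma Ck_cst k (c : R) : Ck k (fun _ : V => c).
Proof.
elim: k c => [|k IH] c; first exact: cst_continuous.
by apply: (Ck_succ (df := fun _ _ => 0)) => //; exact: cst_continuous.
Qed.

Lemma CkD k f g : Ck k f -> Ck k g -> Ck k (fun x => f x + g x).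
Proof.
elim: k f g => [|k IH] f g.
  move=> cf cg x; by apply: cvgD; [exact: (cf x)|exact: (cg x)].
move=> Cf Cg; apply: (Ck_succ (df := fun v x => 'D_v f x + 'D_v g x)).
- move=> x; by apply: cvgD; [exact: (Ck_continuous Cf x)|exact: (Ck_continuous Cg x)].
- by move=> x v; apply: is_deriveD; [exact: Ck_derive Cf|exact: Ck_derive Cg].
- by move=> v; apply: IH; [case: Cf => _ _; exact|case: Cg => _ _; exact].
Qed.

Lemma CkM k f g : Ck k f -> Ck k g -> Ck k (fun x => f x * g x).
Proof.
elim: k f g => [|k IH] f g.
  move=> cf cg x; by apply: cvgM; [exact: (cf x)|exact: (cg x)].
move=> Cf Cg.
apply: (Ck_succ (df := fun v x => f x * 'D_v g x + g x * 'D_v f x)).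
- move=> x; by apply: cvgM; [exact: (Ck_continuous Cf x)|exact: (Ck_continuous Cg x)].
- by move=> x v; apply: is_deriveM; [exact: Ck_derive Cf|exact: Ck_derive Cg].
- move=> v; apply: CkD; apply: IH; [exact: CkW| |exact: CkW|].
    by case: Cg => _ _; exact.
  by case: Cf => _ _; exact.
Qed.

Lemma CkN k f : Ck k f -> Ck k (fun x => - f x).
Proof.
move=> Cf; rewrite (_ : (fun _ => _) = fun x => -1 * f x).
  by apply: CkM => //; exact: Ck_cst.
by apply/funext => x; rewrite mulN1r.
Qed.

Lemma CkB k f g : Ck k f -> Ck k g -> Ck k (fun x => f x - g x).
Proof. by move=> Cf Cg; apply: CkD => //; exact: CkN. Qed.

Lemma Ck_sum k n (F : 'I_n -> V -> R) :
  (forall i, Ck k (F i)) -> Ck k (fun x => \sum_i F i x).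
Proof.
elim: n F => [|n IH] F H.
  rewrite (_ : (fun _ => _) = fun _ => 0); first exact: Ck_cst.
  by apply/funext => x; rewrite big_ord0.
rewrite (_ : (fun _ => _) = fun x => F ord0 x + \sum_i F (lift ord0 i) x).
  by apply: CkD => //; exact: IH.
by apply/funext => x; rewrite big_ord_recl.
Qed.

Lemma Ck_prod k n (F : 'I_n -> V -> R) :
  (forall i, Ck k (F i)) -> Ck k (fun x => \prod_i F i x).
Proof.
elim: n F => [|n IH] F H.
  rewrite (_ : (fun _ => _) = fun _ => 1); first exact: Ck_cst.
  by apply/funext => x; rewrite big_ord0.
rewrite (_ : (fun _ => _) = fun x => F ord0 x * \prod_i F (lift ord0 i) x).
  by apply: CkM => //; exact: IH.
by apply/funext => x; rewrite big_ord_recl.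
Qed.

End Generic.
Arguments Ck_continuous [V k f] _ _.

Lemma Ck_affine (U V : normedModType R) (A : U -> V) (L : U -> V) k (f : V -> R) :
  continuous A -> (forall x v (h : R), A (x + h *: v) = A x + h *: L v) ->
  Ck k f -> Ck k (f \o A).
Proof.
move=> cA hA; elim: k f => [|k IH] f.
  by move=> cf x; apply: continuous_comp; [exact: cA|exact: cf].
move=> Cf; apply: (Ck_succ (df := fun v => 'D_(L v) f \o A)).
- by move=> x; apply: continuous_comp; [exact: cA|exact: Ck_continuous Cf _].
- move=> x v; apply: (is_derive_affine (w := L v)); first by move=> h; exact: hA.
  exact: Ck_derive Cf.
- by move=> v; apply: IH; case: Cf => _ _; exact.
Qed.

Lemma Ck_coord n (i : 'I_n) k : Ck k (fun v : 'rV[R]_n => v 0 i).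
Proof.
case: k => [|k]; first by move=> v; exact: coord_continuous.
apply: (Ck_succ (df := fun v _ : 'rV[R]_n => v 0 i)).
- by move=> v; exact: coord_continuous.
- move=> x v; have lin h : (x + h *: v) 0 i = x 0 i + h *: (v 0 i).
    by rewrite !mxE.
  have := @is_derive_affine _ _ _ _ (fun v : 'rV[R]_n => v 0 i) id x v (v 0 i) (v 0 i) lin.
  by apply; exact: is_derive_id.
- by move=> v; exact: Ck_cst.
Qed.

Lemma Ck_id k : Ck k (@id R).
Proof.
case: k => [|k]; first by move=> x; exact: cvg_id.
apply: (Ck_succ (df := fun v _ : R => v)).
- by move=> x; exact: cvg_id.
- by move=> v; exact: Ck_cst.
Qed.

Lemma continuous_rV (T : topologicalType) n (g : T -> 'rV[R]_n) :
  (forall i, continuous (fun x => g x 0 i)) -> continuous g.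
Proof.
move=> H x; apply/cvgrPdist_le => e e0.
have : \forall y \near x, forall i, `|g x 0 i - g y 0 i| <= e.
  apply: filter_forall => i; exact: (cvgrPdist_le _ _).1 (H i x) e e0.
apply: filterS => y hy; apply: norm_rV_le; first exact: ltW.
by move=> i; rewrite !mxE.
Qed.

Lemma Ck_comp (V : normedModType R) n k (f : 'rV[R]_n -> R) (g : V -> 'rV[R]_n) :
  Ck k f -> (forall i, Ck k (fun x => g x 0 i)) -> Ck k (f \o g).
Proof.
have cc k' (f' : 'rV[R]_n -> R) : Ck k' f' -> (forall i, Ck k' (fun x => g x 0 i)) ->
    continuous (f' \o g).
  move=> cf cg x; apply: continuous_comp; last exact: Ck_continuous cf _.
  by apply: continuous_rV => i; exact: Ck_continuous (cg i).
elim: k f => [|k IH] f; first exact: (cc 0%N).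
move=> Cf Cg.
apply: (Ck_succ (df := fun v x => \sum_i 'D_v (fun y => g y 0 i) x * partial i f (g x))).
- exact: cc Cf Cg.
- move=> x v; apply: is_derive_comp_rV.
  + by case: Cf => _ + _; move=> df z i; exact: df.
  + by move=> i; case: Cf => _ _ /(_ (delta_mx 0 i))/Ck_continuous; exact.
  + by move=> i; exact: Ck_derive (Cg i).
- move=> v; apply: Ck_sum => i; apply: CkM.
    by case: (Cg i) => _ _; exact.
  apply: IH; last by move=> j; exact: CkW.
  by case: Cf => _ _; exact.
Qed.

Lemma Ck_comp1 (V : normedModType R) k (u : R -> R) (g : V -> R) :
  Ck k u -> Ck k g -> Ck k (u \o g).
Proof.
move=> Cu Cg; pose G x : 'rV[R]_1 := \row_(_ < 1) g x.
have -> : u \o g = (fun v : 'rV[R]_1 => u (v 0 0)) \o G.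
  by apply/funext => x; rewrite /= mxE.
apply: Ck_comp.
  apply: (@Ck_affine _ _ (fun v : 'rV[R]_1 => v 0 0) (fun v => v 0 0)) => //.
    by move=> v; exact: coord_continuous.
  by move=> x v h; rewrite !mxE.
by move=> i; rewrite (_ : (fun _ => _) = g)//; apply/funext => x; rewrite mxE.
Qed.

Lemma Ck_R k (f df : R -> R) :
  (forall x : R, is_derive x 1 f (df x)) -> Ck k df -> Ck k.+1 f.
Proof.
move=> Df Cdf; apply: (Ck_succ (df := fun v x : R => v * df x)).
- by move=> x; apply: is_derive_continuous (Df x).
- by move=> x v; exact: is_derive1_dir (Df x).
- by move=> v; apply: CkM => //; exact: Ck_cst.
Qed.

Lemma Ck_expR k : Ck k (@expR R).
Proof.
elim: k => [|k IH]; first exact: continuous_expR.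
exact: Ck_R IH.
Qed.

End Ck.

(** * Flows of vector fields *)

Section Antiderivative.
Context (R : realType).

Lemma is_derive_opp_arg (f : R -> R) (x df : R) :
  is_derive (- x) 1 f df -> is_derive x 1 (fun t => f (- t)) (- df).
Proof.
move=> Df; have := @is_derive_affine _ _ _ _ (fun t : R => - t) f x 1 (- 1) (- df).
apply; first by move=> h; rewrite opprD scalerN.
move: Df.
by move=> Df; rewrite -(scaleN1r df); exact: is_derive1_dir.
Qed.

Lemma mvt_le (f df g dg : R -> R) (a b : R) : a <= b ->
  (forall x, a <= x <= b -> is_derive x 1 f (df x)) ->
  (forall x, a <= x <= b -> is_derive x 1 g (dg x)) ->
  (forall x, a <= x <= b -> df x <= dg x) -> f b - f a <= g b - g a.
Proof.
move=> ab Df Dg le; have D x : a <= x <= b -> is_derive x 1 (g - f) (dg x - df x).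
  by move=> xab; apply: is_deriveB; [exact: Dg|exact: Df].
have [c cab] := mvt_R ab D.
rewrite !fctE => E; rewrite -subr_ge0.
have -> : g b - g a - (f b - f a) = (dg c - df c) * (b - a) by rewrite -E; ring.
by rewrite mulr_ge0// subr_ge0 ?le.
Qed.

Lemma near_norm_lt (V : normedModType R) (x : V) r : `|x| < r -> \forall y \near x, `|y| < r.
Proof.
move=> xr; have : `|y| @[y --> x] --> `|x| by exact: norm_continuous.
by move/cvgr_lt; exact.
Qed.

Lemma antiderivative_near (f : R -> R) (c : R) : 0 < c -> continuous f ->
  exists2 G : R -> R, G 0 = 0 & forall x : R, `|x| < c -> is_derive x 1 G (f x).
Proof.
move=> c0 cf.
(* Starting the integral at [- c] makes every point with [|x| < c] interior, so that the derivatives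
   are two-sided; subtracting [F 0] restores the normalisation at 0. *)
pose F (x : R) := \int[lebesgue_measure]_(t in `[- c, x]) f t.
exists (fun x => F x - F 0); first by rewrite subrr.
move=> x; rewrite ltr_norml => /andP[cx xc].
have fi : (@lebesgue_measure R).-integrable `[- c, c] (EFin \o f).
  apply: continuous_compact_integrable; first exact: segment_compact.
  exact: continuous_subspaceT.
have [d e] := continuous_FTC1_closed xc fi cx (cf x).
rewrite -[f x]subr0; apply: is_deriveB.
apply: DeriveDef; first exact: d.
by rewrite -derive1E; exact: e.
Qed.

Lemma antiderivative (f : R -> R) : continuous f ->
  exists2 G : R -> R, G 0 = 0 & forall x : R, is_derive x 1 G (f x).
Proof.
move=> cf.
have /choice[G hG] : forall n : nat, exists G : R -> R, G 0 = 0 /\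
    forall x : R, `|x| < n.+1%:R -> is_derive x 1 G (f x).
  by move=> n; have [G] := @antiderivative_near f n.+1%:R (ltr0Sn _ _) cf; exists G.
have GE m n x : `|x| < m.+1%:R -> `|x| < n.+1%:R -> G m x = G n x.
  move=> xm xn; have [x0|x0] := leP 0 x.
  - have I k : `|x| < k.+1%:R -> forall y, 0 <= y <= x -> is_derive y 1 (G k) (f y).
      move=> xk y /andP[y0 yx]; apply: (hG k).2; apply: le_lt_trans xk.
      by rewrite !ger0_norm.
    have := mvt_le x0 (I m xm) (I n xn) (fun _ _ => lexx _).
    have := mvt_le x0 (I n xn) (I m xm) (fun _ _ => lexx _).
    by rewrite !(hG _).1 !subr0 => h1 h2; apply/eqP; rewrite eq_le h1 h2.
  - have I k : `|x| < k.+1%:R -> forall y, x <= y <= 0 -> is_derive y 1 (G k) (f y).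
      move=> xk y /andP[y0 yx]; apply: (hG k).2; apply: le_lt_trans xk.
      by rewrite !ler0_norm ?(ltW x0)// lerN2.
    have := mvt_le (ltW x0) (I m xm) (I n xn) (fun _ _ => lexx _).
    have := mvt_le (ltW x0) (I n xn) (I m xm) (fun _ _ => lexx _).
    by rewrite !(hG _).1 !sub0r !lerN2 => h1 h2; apply/eqP; rewrite eq_le h1 h2.
(* The index of the glued function depends on its argument, but by [GE] the function coincides near
   [x] with the fixed [G n], whose derivative is known. *)
have tr (x : R) : `|x| < (Num.truncn `|x|).+1%:R by exact: truncnS_gt.
exists (fun x => G (Num.truncn `|x|) x); first by rewrite (hG _).1.
move=> x; pose n := Num.truncn `|x|.
have xn : `|x| < n.+1%:R by exact: tr.
apply: (near_eq_is_derive (f := G n)); last exact: (hG n).2.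
have : \forall y \near x, `|y| < n.+1%:R.
  exact: near_norm_lt.
move=> H; near=> y; apply: GE; last exact: tr.
by near: y.
Unshelve. all: by end_near.
Qed.

End Antiderivative.

(** * Gronwall estimates in the sup norm *)

Section Gronwall.
Context (R : realType).

(** The product [(e s + d) * expR (- K * s)] has a nonpositive derivative. *)
Lemma gronwall (e de : R -> R) (K d T : R) :
  (forall t : R, 0 <= t <= T -> is_derive t 1 e (de t)) ->
  (forall t, 0 <= t <= T -> de t <= K * (e t + d)) ->
  forall t, 0 <= t <= T -> e t + d <= (e 0 + d) * expR (K * t).
Proof.
move=> De le t /andP[t0 tT].
pose f s := (e s + d) * expR (- K * s).
pose df s := (e s + d) * (- K * expR (- K * s)) + expR (- K * s) * (de s + 0).
have I s : 0 <= s <= t -> 0 <= s <= T.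
  by move=> /andP[-> /le_trans->].
have Df s : 0 <= s <= t -> is_derive s 1 f (df s).
  move=> /I sT; have := De s sT => Des.
  have E : is_derive s 1 (fun s : R => expR (- K * s)) (- K * expR (- K * s)).
    have := @is_derive_affine _ _ _ _ (fun s : R => - K * s) expR s 1 (- K) (- K * expR (- K * s)).
    apply; first by move=> h; rewrite mulrDr [h%:A]mulr1; congr (_ + _); rewrite mulrC.
    exact: is_derive1_dir.
  exact: is_deriveM.
have := mvt_le t0 Df (fun x _ => is_derive_cst 0 x 1).
rewrite /cst/= subrr subr_le0 {2}/f mulr0 expR0 mulr1 => h.
have : f t <= e 0 + d.
  apply: h => s sT; have := le s (I s sT); rewrite /df => h.
  have -> : (e s + d) * (- K * expR (- K * s)) + expR (- K * s) * (de s + 0) =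
     expR (- K * s) * (de s - K * (e s + d)) by ring.
  by rewrite pmulr_rle0 ?expR_gt0// subr_le0.
by rewrite /f mulNr expRN ler_pdivrMr// expR_gt0.
Qed.

Lemma is_derive_sum_fun (V : normedModType R) n (F : 'I_n -> V -> R) x v dF :
  (forall i, is_derive x v (F i) (dF i)) ->
  is_derive x v (fun y => \sum_i F i y) (\sum_i dF i).
Proof.
move=> H; rewrite (_ : (fun _ => _) = \sum_i F i); first exact: is_derive_sum.
by apply/funext => y; rewrite fct_sumE.
Qed.

Lemma norm_rV_sq n (v : 'rV[R]_n) : `|v| ^+ 2 <= \sum_i v 0 i ^+ 2.
Proof.
have S0 : 0 <= \sum_i v 0 i ^+ 2 by apply: sumr_ge0 => i _; rewrite sqr_ge0.
rewrite -(ger0_norm S0) -ler_sqrt ?normr_ge0// sqrtr_sqr normr_id.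
apply: norm_rV_le; first exact: sqrtr_ge0.
move=> i; rewrite -sqrtr_sqr ler_sqrt//.
by rewrite ger0_norm// (bigD1 i)//= lerDl; apply: sumr_ge0 => j _; rewrite sqr_ge0.
Qed.

(** The sup norm is not differentiable, so [gronwall] is applied to the sum of squared coordinates
    and the result converted back, at the price of factors [n]. What matters later is that [C] is
    quantified before [u] and [d]: it gives bounds uniform in initial points and increments. *)
Lemma rV_gronwall_pos n (A T : R) : 0 <= A -> 0 <= T ->
  exists2 C : R, 0 <= C & forall (u du : R -> 'rV[R]_n) (d : R), 0 <= d ->
    (forall t : R, 0 <= t <= T -> forall i, is_derive t 1 (fun s => u s 0 i) (du t 0 i)) ->
    (forall t, 0 <= t <= T -> forall i, `|du t 0 i| <= A * `|u t| + d) ->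
    forall t, 0 <= t <= T -> `|u t| <= C * (`|u 0| + d).
Proof.
(* Each coordinate contributes at most [2 |u| (A |u| + d)], and [2 |u| d <= |u|^2 + d^2] bounds this
   by [(2 A + 1) (|u|^2 + d^2)]. *)
move=> A0 T0; pose K : R := n%:R * (2 * A + 1).
have K0 : 0 <= K by rewrite mulr_ge0// addr_ge0// mulr_ge0.
(* The factor [n + 1] comes from [n |u 0|^2 + d^2 <= (n + 1) (|u 0| + d)^2]. As [C >= 1], a bound of
   [|u t|^2] by [C (|u 0| + d)^2] is also one by the square of [C (|u 0| + d)]. *)
pose C : R := (n%:R + 1) * expR (K * T).
have C1 : 1 <= C.
  have h1 : (1 : R) <= n%:R + 1 by rewrite lerDr.
  have h2 : 1 <= expR (K * T) by rewrite -[leLHS]expR0 ler_expR mulr_ge0.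
  by rewrite /C -[leLHS]mulr1 ler_pM.
exists C; first exact: le_trans C1.
move=> u du d d0 Du le t tT; have /andP[t0 tT'] := tT.
have De s : 0 <= s <= T -> is_derive s 1 (fun s => \sum_i u s 0 i ^+ 2)
    (\sum_i 2 * u s 0 i * du s 0 i).
  move=> sT; apply: is_derive_sum_fun => i; have Dus := Du s sT i.
  rewrite [X in is_derive _ _ X](_ : _ = (fun s => u s 0 i * u s 0 i)); last first.
    by apply/funext => r; rewrite expr2.
  apply: (is_derive_eq (is_deriveM Dus Dus)).
  by rewrite /GRing.scale/=; ring.
have leE s : 0 <= s <= T ->
    \sum_i 2 * u s 0 i * du s 0 i <= K * (\sum_i u s 0 i ^+ 2 + d ^+ 2).
  move=> sT; have N0 := normr_ge0 (u s).
  apply: (@le_trans _ _ (\sum_(i < n) (2 * A + 1) * (`|u s| ^+ 2 + d ^+ 2))).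
    apply: ler_sum => i _; apply: (le_trans (ler_norm _)).
    rewrite !normrM (@ger0_norm _ 2)//.
    apply: (@le_trans _ _ (2 * `|u s| * (A * `|u s| + d))).
      apply: ler_pM; [by rewrite mulr_ge0|by []| |exact: le].
      by rewrite ler_wpM2l// coord_le_norm.
    have h1 := sqr_ge0 (`|u s| - d); have h2 : 0 <= A * d ^+ 2 by rewrite mulr_ge0// sqr_ge0.
    rewrite !expr2 in h1 h2 *; lra.
  rewrite big_const_ord iter_addr addr0 -[_ *+ n]mulr_natl mulrA.
  by rewrite ler_wpM2l// lerD2r norm_rV_sq.
have := gronwall De leE tT => G.
have {}G : `|u t| ^+ 2 <= (C * (`|u 0| + d)) ^+ 2.
  apply: (le_trans (norm_rV_sq _)); apply: (@le_trans _ _ (\sum_i u t 0 i ^+ 2 + d ^+ 2)).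
    by rewrite lerDl sqr_ge0.
  apply: (le_trans G); apply: (@le_trans _ _ (C * (`|u 0| + d) ^+ 2)).
    have N0 := normr_ge0 (u 0).
    rewrite /C [leRHS]mulrAC; apply: ler_pM.
    - by apply: addr_ge0; [apply: sumr_ge0 => i _|]; exact: sqr_ge0.
    - exact: expR_ge0.
    - apply: (@le_trans _ _ (n%:R * `|u 0| ^+ 2 + d ^+ 2)).
        rewrite lerD2r; apply: (@le_trans _ _ (\sum_(i < n) `|u 0| ^+ 2)).
          apply: ler_sum => i _; rewrite -[leLHS]real_normK ?num_real//.
          by rewrite lerXn2r ?nnegrE// coord_le_norm.
        by rewrite big_const_ord iter_addr addr0 -[leLHS]mulr_natl.
      have h1 : 0 <= n%:R * (2 * `|u 0| * d + d ^+ 2).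
        by rewrite mulr_ge0// addr_ge0 ?sqr_ge0// !mulr_ge0.
      have h2 : 0 <= `|u 0| ^+ 2 by rewrite sqr_ge0.
      have h3 : 0 <= `|u 0| * d by rewrite mulr_ge0.
      rewrite -subr_ge0.
      have -> : (n%:R + 1) * (`|u 0| + d) ^+ 2 - (n%:R * `|u 0| ^+ 2 + d ^+ 2) =
        n%:R * (2 * `|u 0| * d + d ^+ 2) + `|u 0| ^+ 2 + 2 * (`|u 0| * d) by ring.
      by rewrite !addr_ge0// mulr_ge0.
    - by rewrite ler_expR ler_wpM2l.
  rewrite exprMn; apply: ler_wpM2r; first exact: sqr_ge0.
  by rewrite expr2 ler_peMr// (le_trans _ C1).
rewrite -(@ler_pXn2r _ 2)// nnegrE//.
by rewrite mulr_ge0 ?addr_ge0// (le_trans _ C1).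
Qed.

Lemma rV_gronwall n (A T : R) : 0 <= A -> 0 <= T ->
  exists2 C : R, 0 <= C & forall (u du : R -> 'rV[R]_n) (d : R), 0 <= d ->
    (forall t : R, `|t| <= T -> forall i, is_derive t 1 (fun s => u s 0 i) (du t 0 i)) ->
    (forall t, `|t| <= T -> forall i, `|du t 0 i| <= A * `|u t| + d) ->
    forall t, `|t| <= T -> `|u t| <= C * (`|u 0| + d).
Proof.
move=> A0 T0; have [C C0 H] := @rV_gronwall_pos n A T A0 T0; exists C => //.
move=> u du d d0 Du le t tT; have [t0|t0] := leP 0 t.
  apply: (H u du d d0) => [s /andP[s0 sT]|s /andP[s0 sT]|].
  - by apply: Du; rewrite ger0_norm.
  - by apply: le; rewrite ger0_norm.
  - by rewrite t0 -(ger0_norm t0).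
have := H (fun s => u (- s)) (fun s => - du (- s)) d d0 _ _ (- t).
rewrite opprK oppr0; apply => [s /andP[s0 sT] i|s /andP[s0 sT] i|].
- rewrite mxE; apply: (@is_derive_opp_arg _ (fun s => u s 0 i)).
  by apply: Du; rewrite normrN ger0_norm.
- by rewrite mxE normrN; apply: le; rewrite normrN ger0_norm.
- by rewrite oppr_ge0 ltW//= -(ltr0_norm t0).
Qed.

End Gronwall.

Section Limits.
Context (R : realType).

(** The intervals of radius [2 * c / 2 ^+ m] around [u m] are nested, that radius being the sum of
    all remaining steps; the limit is the supremum of their left ends. *)
Lemma geometric_limit (u : nat -> R) c : 0 <= c ->
  (forall m, `|u m.+1 - u m| <= c / 2 ^+ m) ->
  exists l, forall m, `|u m - l| <= 2 * c / 2 ^+ m.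
Proof.
move=> c0 H.
pose lo m := u m - 2 * c / 2 ^+ m; pose hi m := u m + 2 * c / 2 ^+ m.
have E m : 2 * c / 2 ^+ m.+1 = c / 2 ^+ m.
  by rewrite exprS; field.
have E' m : 2 * c / 2 ^+ m = c / 2 ^+ m + c / 2 ^+ m by field.
have los : {homo lo : m n / (m <= n)%N >-> m <= n}.
  apply: homo_leq => [x//|y x z|m]; first exact: le_trans.
  by have := H m; rewrite ler_norml => /andP[h _]; rewrite /lo E E'; lra.
have his : {homo hi : m n / (m <= n)%N >-> n <= m}.
  apply: homo_leq => [x//|y x z xy yz|m]; first exact: le_trans yz xy.
  by have := H m; rewrite ler_norml => /andP[_ h]; rewrite /hi E E'; lra.
have lohi m n : lo m <= hi n.
  apply: (@le_trans _ _ (lo (maxn m n))); first by apply: los; exact: leq_maxl.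
  apply: (@le_trans _ _ (hi (maxn m n))); last by apply: his; exact: leq_maxr.
  rewrite /lo /hi; have : 0 <= 2 * c / 2 ^+ maxn m n.
    by rewrite divr_ge0 ?mulr_ge0// exprn_ge0.
  lra.
have ub m : ubound (range lo) (hi m) by move=> _ [k _ <-].
exists (sup (range lo)) => m.
have h1 : lo m <= sup (range lo) by apply: ub_le_sup; [exists (hi 0%N); exact: ub|exists m].
have h2 : sup (range lo) <= hi m by apply: ge_sup; [exists (lo 0%N); exists 0%N|exact: ub].
by rewrite ler_norml; rewrite /lo /hi in h1 h2; apply/andP; split; lra.
Qed.

Lemma geometric_small (c e : R) : 0 < e -> exists m : nat, c / 2 ^+ m <= e.
Proof.
move=> e0; pose m := (Num.truncn (c / e)).+1; exists m.
rewrite ler_pdivrMr ?exprn_gt0//.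
have h1 : c / e < m%:R by rewrite /m truncnS_gt.
have h2 : (m%:R : R) <= 2 ^+ m by rewrite -natrX ler_nat ltnW// ltn_expl.
by have := le_trans (ltW h1) h2; rewrite ler_pdivrMr// mulrC.
Qed.

Lemma eq_of_le_geometric (x y c : R) :
  (forall m : nat, `|x - y| <= c / 2 ^+ m) -> x = y.
Proof.
move=> H; apply/eqP; rewrite -subr_eq0 -normr_le0; apply/ler_addgt0Pr => e e0.
by have [m hm] := geometric_small c e0; rewrite add0r (le_trans (H m)).
Qed.

Lemma lipschitz_of_derive (f df : R -> R) (M a b : R) :
  (forall x : R, is_derive x 1 f (df x)) ->
  (forall x, `|x - a| <= `|b - a| -> `|df x| <= M) ->
  `|f b - f a| <= M * `|b - a|.
Proof.
move=> Df le; have [|c cab] := @mvt_line _ _ f a 1 (b - a).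
  by move=> h; have [] := Df (a + h *: 1).
rewrite ![_%:A]mulr1 (addrC a (b - a)) subrK => ->.
have [_ ->] := Df (a + c).
by rewrite normrM mulrC ler_wpM2r// le// (addrC a) addrK.
Qed.

(* Makes Picard iteration a contraction for the norm sup_t exp (- a |t|) |f t|, hence
   global in time. *)
Lemma weight_bound (f df : R -> R) (a K : R) : 0 < a -> 0 <= K -> f 0 = 0 ->
  (forall t : R, is_derive t 1 f (df t)) ->
  (forall t, `|df t| <= a * K * expR (a * `|t|)) ->
  forall t, `|f t| <= K * expR (a * `|t|).
Proof.
move=> a0 K0.
suff P (g dg : R -> R) : g 0 = 0 -> (forall t : R, is_derive t 1 g (dg t)) ->
    (forall t, `|dg t| <= a * K * expR (a * `|t|)) ->
    forall t, 0 <= t -> `|g t| <= K * expR (a * `|t|).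
  move=> f0 Df le t; have [t0|t0] := leP 0 t; first exact: P f0 Df le _ t0.
  have := P (fun s => f (- s)) (fun s => - df (- s)) _ _ _ (- t).
  rewrite opprK oppr0 normrN; apply => //.
  - by move=> s; apply: is_derive_opp_arg.
  - by move=> s; rewrite normrN -(normrN s).
  - by rewrite oppr_ge0 ltW.
move=> g0 Dg le t t0.
pose w s := K * expR (a * s); pose dw s := a * K * expR (a * s).
have Dw (s : R) : is_derive s 1 w (dw s).
  have E : is_derive s 1 (fun s : R => expR (a * s)) (a * expR (a * s)).
    have := @is_derive_affine _ _ _ _ (fun s : R => a * s) expR s 1 a (a * expR (a * s)).
    apply; first by move=> h; rewrite mulrDr [h%:A]mulr1; congr (_ + _); rewrite mulrC.
    exact: is_derive1_dir.
  by apply: (is_derive_eq (is_deriveZ K E)); rewrite /dw /GRing.scale/=; ring.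
have W0 : 0 <= w 0 by rewrite mulr_ge0// expR_ge0.
rewrite (ger0_norm t0) ler_norml; apply/andP; split.
- have DN (s : R) : is_derive s 1 (fun s => - w s) (- dw s) by exact: is_deriveN.
  have := mvt_le t0 (fun s _ => DN s) (fun s _ => Dg s).
  rewrite g0 subr0 => h; have {}h : - w t - - w 0 <= g t.
    apply: h => s /andP[s0 _]; have := le s.
    by rewrite (ger0_norm s0) ler_norml => /andP[].
  by rewrite /w in h W0 *; lra.
- have := mvt_le t0 (fun s _ => Dg s) (fun s _ => Dw s).
  rewrite g0 subr0 => h; have {}h : g t <= w t - w 0.
    apply: h => s /andP[s0 _]; have := le s.
    by rewrite (ger0_norm s0) ler_norml => /andP[].
  by rewrite /w in h W0 *; lra.
Qed.

End Limits.

(** * Existence of global flows *)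

Section Flow.
Context (R : realType).

(** The last field is the only a priori control in the initial point. It confines trajectories to a
    ball on which the field has uniform Lipschitz and Taylor constants; continuity and smoothness in
    [x] are then derived. *)
Record is_flow n (B : 'rV[R]_n -> 'rV[R]_n) (Phi : R -> 'rV[R]_n -> 'rV[R]_n) :
    Prop := IsFlow {
  flow0 : forall x, Phi 0 x = x ;
  flow_derive : forall (t : R) x i,
    is_derive t 1 (fun s => Phi s x 0 i) (B (Phi t x) 0 i) ;
  flow_bounded : forall T r : R, exists C : R, forall t x,
    `|t| <= T -> `|x| <= r -> `|Phi t x| <= C }.

Lemma lipschitz_continuous (V W : normedModType R) (f : V -> W) (L : R) :
  (forall x y, `|f x - f y| <= L * `|x - y|) -> continuous f.
Proof.
move=> H x; apply/cvgrPdist_le => e e0.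
have L1 : 0 < `|L| + 1 by rewrite ltr_wpDl.
have : \forall y \near x, `|x - y| <= e / (`|L| + 1).
  by apply: (cvgrPdist_le _ _).1; [exact: cvg_id|rewrite divr_gt0].
apply: filterS => y; rewrite ler_pdivlMr// => h; apply: (le_trans (H x y)).
apply: le_trans h; rewrite mulrC ler_wpM2l//.
by rewrite (le_trans (ler_norm L))// lerDl.
Qed.

(** Picard iteration, global in time: with the weight [expR (a * |t|)] of [weight_bound], the rate
    [a = 2 * L] makes each step halve the distance. The bound [M] controls the first step and gives
    [flow_bounded] with constant [r + M * T]. *)
Lemma bounded_lipschitz_flow n (B : 'rV[R]_n -> 'rV[R]_n) (M L : R) :
  (forall x, `|B x| <= M) -> (forall x y, `|B x - B y| <= L * `|x - y|) ->
  exists Phi, is_flow B Phi.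
Proof.
move=> BM BL.
have M0 : 0 <= M by exact: le_trans (BM 0).
wlog L0 : L BL / 0 < L.
  move=> W; apply: (W (`|L| + 1)); last by rewrite ltr_wpDl.
  move=> x y; apply: (le_trans (BL x y)); rewrite ler_wpM2r//.
  by rewrite (le_trans (ler_norm L))// lerDl.
have Bc : continuous B by exact: lipschitz_continuous BL.
(* [prim] has to be total, hence a dummy value at discontinuous [f]; its properties are used only at
   continuous ones. *)
have /choice[prim hprim] : forall f : R -> R, exists G : R -> R, continuous f ->
    G 0 = 0 /\ forall x : R, is_derive x 1 G (f x).
  move=> f; have [cf|ncf] := pselect (continuous f); last by exists f.
  by have [G G0 DG] := antiderivative cf; exists G.
suff : forall x, exists y : R -> 'rV[R]_n, y 0 = x /\
    forall (t : R) i, is_derive t 1 (fun s => y s 0 i) (B (y t) 0 i).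
  move=> /choice[y hy]; exists (fun t x => y x t); split=> [x|t x i|T r].
  - exact: (hy x).1.
  - exact: (hy x).2.
  - exists (r + M * T) => t x tT xr; have T0 : 0 <= T by exact: le_trans tT.
    have -> : y x t = x + (y x t - x) by rewrite addrC subrK.
    apply: (le_trans (ler_normD _ _)); apply: lerD => //.
    apply: norm_rV_le; first by rewrite mulr_ge0.
    move=> i; have := @lipschitz_of_derive R _ _ M 0 t (fun s => (hy x).2 s i).
    rewrite subr0 (hy x).1 !mxE => h; apply: le_trans (h _) _.
      by move=> s _; rewrite (le_trans (coord_le_norm _ _)).
    by rewrite ler_wpM2l.
move=> x.
pose next (y : R -> 'rV[R]_n) (t : R) : 'rV[R]_n :=
  \row_i (x 0 i + prim (fun s => B (y s) 0 i) t).
have cB (y : R -> 'rV[R]_n) i : continuous y -> continuous (fun s => B (y s) 0 i).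
  move=> cy; have cBi : continuous (fun v => B v 0 i).
    move=> v; apply: (cvg_comp B (fun w : 'rV[R]_n => w 0 i)); first exact: Bc.
    exact: coord_continuous.
  by move=> s; apply: (cvg_comp y (fun v => B v 0 i)); [exact: cy|exact: cBi].
have next_derive (y : R -> 'rV[R]_n) i (t : R) : continuous y ->
    is_derive t 1 (fun s => next y s 0 i) (B (y t) 0 i).
  move=> cy; have [_ D] := hprim _ (cB y i cy).
  rewrite (_ : (fun _ => _) = cst (x 0 i) + prim (fun s => B (y s) 0 i)).
    by rewrite -[B _ _ _]add0r; apply: is_deriveD.
  by apply/funext => s; rewrite !mxE.
have next0 (y : R -> 'rV[R]_n) : continuous y -> next y 0 = x.
  by move=> cy; apply/rowP => i; rewrite mxE (hprim _ (cB y i cy)).1 addr0.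
have next_continuous (y : R -> 'rV[R]_n) : continuous y -> continuous (next y).
  move=> cy; apply: continuous_rV => i t.
  exact: is_derive_continuous (next_derive y i t cy).
pose Y m := iter m next (fun _ => x).
have Yc m : continuous (Y m).
  by elim: m => [|m IH]; [exact: cst_continuous|exact: next_continuous].
have Y0 m : Y m 0 = x by case: m => //= m; exact: next0.
pose a := 2 * L; have a0 : 0 < a by rewrite mulr_gt0.
pose K := M / a; have K0 : 0 <= K by rewrite divr_ge0// ltW.
have Kw m : 0 <= K / 2 ^+ m by rewrite (divr_ge0 K0)// exprn_ge0.
have step m t i : `|Y m.+1 t 0 i - Y m t 0 i| <= K / 2 ^+ m * expR (a * `|t|).
  have P k : (forall t, `|Y k.+1 t - Y k t| <= K / 2 ^+ k * expR (a * `|t|)).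
    elim: k => [|k IH] {}t; (apply: norm_rV_le => [|{}i];
        [by rewrite mulr_ge0 ?expR_ge0 ?Kw|rewrite rVB]).
    - rewrite expr0 divr1.
      have := @weight_bound R (fun s => Y 1%N s 0 i - x 0 i) (fun s => B x 0 i) a K a0 K0.
      apply.
      + by rewrite Y0 subrr.
      + move=> s; rewrite -[B _ _ _]subr0; apply: is_deriveB.
        exact: (next_derive _ _ _ (Yc 0%N)).
      + move=> s; rewrite /K mulrCA divff ?gt_eqF// mulr1.
        apply: (le_trans (coord_le_norm _ _)); apply: (le_trans (BM _)).
        by rewrite ler_peMr// -[leLHS]expR0 ler_expR mulr_ge0// ltW.
    - have := @weight_bound R (fun s => Y k.+2 s 0 i - Y k.+1 s 0 i)
        (fun s => B (Y k.+1 s) 0 i - B (Y k s) 0 i) a (K / 2 ^+ k.+1) a0 _.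
      apply.
      + exact: Kw.
      + by rewrite !Y0 subrr.
      + by move=> s; apply: is_deriveB;
          [exact: (next_derive _ i s (Yc k.+1))|exact: (next_derive _ i s (Yc k))].
      + move=> s; have := coord_le_norm (B (Y k.+1 s) - B (Y k s)) i.
        rewrite rVB => h; apply: (le_trans h); apply: (le_trans (BL _ _)).
        have -> : a * (K / 2 ^+ k.+1) = L * (K / 2 ^+ k).
          by rewrite /a exprS; field.
        by rewrite -mulrA ler_pM2l.
  by have := coord_le_norm (Y m.+1 t - Y m t) i; rewrite rVB => /le_trans; apply.
have /choice[y hy] : forall t, exists y : 'rV[R]_n, forall m i,
    `|Y m t 0 i - y 0 i| <= 2 * (K * expR (a * `|t|)) / 2 ^+ m.
  move=> t; have /choice[l hl] : forall i, exists l, forall m,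
      `|Y m t 0 i - l| <= 2 * (K * expR (a * `|t|)) / 2 ^+ m.
    move=> i; apply: geometric_limit; first by rewrite mulr_ge0// expR_ge0.
    by move=> m; rewrite mulrAC; exact: step.
  by exists (\row_i l i) => m i; rewrite mxE.
(* The iterates share the Lipschitz constant [M] in time, so their pointwise limit [y] inherits it
   and is continuous. *)
have YM m s t i : `|Y m s 0 i - Y m t 0 i| <= M * `|s - t|.
  case: m => [|m]; first by rewrite subrr normr0 mulr_ge0.
  apply: (lipschitz_of_derive (fun r => next_derive _ i r (Yc m))) => r _.
  exact: le_trans (coord_le_norm _ _) (BM _).
have yc : continuous y.
  apply: (@lipschitz_continuous _ _ _ M) => s t.
  apply: norm_rV_le; first by rewrite mulr_ge0.
  move=> i; rewrite rVB; apply/ler_addgt0Pr => e e0.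
  have [m hm] := geometric_small (2 * (K * expR (a * `|s|)) + 2 * (K * expR (a * `|t|))) e0.
  have h1 := hy s m i; have h2 := hy t m i; have h3 := YM m s t i.
  have -> : y s 0 i - y t 0 i = (Y m s 0 i - Y m t 0 i) +
     ((Y m t 0 i - y t 0 i) - (Y m s 0 i - y s 0 i)) by ring.
  apply: (le_trans (ler_normD _ _)); apply: lerD => //.
  apply: (le_trans (ler_normB _ _)); apply: le_trans hm.
  by rewrite mulrDl addrC lerD.
(* [next y] rather than [y] is exhibited, because it is differentiable by construction, with
   derivative [B (y t)]. The two coincide as both are limits of the iterates [Y m.+1]. *)
exists (next y); split; first exact: next0.
suff E : next y = y by move=> t i; rewrite {2}E; exact: next_derive.
apply/funext => t; apply/rowP => i; apply/esym.
apply: (@eq_of_le_geometric _ _ _ (2 * (K * expR (a * `|t|)) )) => m.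
have D (s : R) : is_derive s 1 (fun s => next y s 0 i - Y m.+1 s 0 i)
    (B (y s) 0 i - B (Y m s) 0 i).
  by apply: is_deriveB; [exact: (next_derive _ i s yc)|exact: (next_derive _ i s (Yc m))].
have h : `|next y t 0 i - Y m.+1 t 0 i| <= K / 2 ^+ m * expR (a * `|t|).
  apply: (weight_bound a0 (Kw m) _ D).
    by rewrite next0// Y0 subrr.
  move=> s; have := coord_le_norm (B (y s) - B (Y m s)) i; rewrite rVB => h.
  apply: (le_trans h); apply: (le_trans (BL _ _)).
  have -> : a * (K / 2 ^+ m) = L * (2 * K / 2 ^+ m) by rewrite /a; field.
  rewrite -mulrA ler_pM2l//; apply: norm_rV_le.
    by apply: mulr_ge0; [apply: divr_ge0; [exact: mulr_ge0|exact: exprn_ge0]|exact: expR_ge0].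
  by move=> j; rewrite rVB distrC (le_trans (hy s m j))// mulrA mulrAC.
have h2 := hy t m.+1 i.
have -> : y t 0 i - next y t 0 i =
  - ((next y t 0 i - Y m.+1 t 0 i) + (Y m.+1 t 0 i - y t 0 i)) by ring.
rewrite normrN (le_trans (ler_normD _ _))//.
apply: (le_trans (lerD h h2)); rewrite le_eqVlt; apply/orP; left; apply/eqP.
by rewrite exprS; field.
Qed.

End Flow.

Section LocalBounds.
Context (R : realType).

Lemma compact_norm_bound (T : topologicalType) (K : set T) (f : T -> R) :
  compact K -> continuous f -> exists2 M : R, 0 <= M & forall x, K x -> `|f x| <= M.
Proof.
move=> cK cf; have [K0|/set0P/negP/negPn/eqP->] := pselect (K !=set0); last by exists 0.
have cn : {within K, continuous (fun x => `|f x|)}.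
  apply: continuous_subspaceT => x; apply: (cvg_comp f (fun y : R => `|y|)); first exact: cf.
  exact: norm_continuous.
have [c _ hc] := compact_EVT_max K0 cK cn.
by exists `|f c| => // x Kx; apply: hc; rewrite inE.
Qed.

Lemma compact_rV_ball n (r : R) : compact [set x : 'rV[R]_n | `|x| <= r].
Proof.
apply: bounded_closed_compact.
  exists r; split; first exact: num_real.
  by move=> s rs x /= xr; rewrite (le_trans xr)// ltW.
rewrite (_ : [set _ | _] = (fun x : 'rV[R]_n => `|x|) @^-1` [set y | y <= r]) //.
by apply: closed_comp; [move=> x _; exact: norm_continuous|exact: closed_le].
Qed.

Lemma rV_ball_bound n (f : 'rV[R]_n -> R) (r : R) : continuous f ->
  exists2 M : R, 0 <= M & forall x, `|x| <= r -> `|f x| <= M.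
Proof.
move=> cf; have [M M0 hM] := compact_norm_bound (@compact_rV_ball n r) cf.
by exists M.
Qed.

Lemma uniform_constant n (P : 'I_n -> R -> Prop) :
  (forall i C C', C <= C' -> P i C -> P i C') ->
  (forall i, exists2 C : R, 0 <= C & P i C) ->
  exists2 C : R, 0 <= C & forall i, P i C.
Proof.
move=> mono H; have /choice[c hc] : forall i, exists c, 0 <= c /\ P i c.
  by move=> i; have [c] := H i; exists c.
exists (\sum_i c i); first by apply: sumr_ge0 => i _; exact: (hc i).1.
move=> i; apply: mono (hc i).2; rewrite (bigD1 i)//= lerDl.
by apply: sumr_ge0 => j _; exact: (hc j).1.
Qed.

Lemma lipschitz_ball n (f : 'rV[R]_n -> R) (r : R) : Ck 1 f ->
  exists2 L : R, 0 <= L & forall x y, `|x| <= r -> `|y| <= r ->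
    `|f y - f x| <= L * `|y - x|.
Proof.
move=> [cf df ddf].
(* Two points of the ball are at most [2 * r] apart, so the intermediate points of [mvt_rV] lie in
   the ball of radius [3 * r]. *)
have [L L0 hL] : exists2 L : R, 0 <= L & forall i : 'I_n, forall x : 'rV[R]_n,
    `|x| <= 3 * r -> `|partial i f x| <= L.
  apply: uniform_constant => [i C C' CC' H x xr|i]; first exact: le_trans (H x xr) CC'.
  exact: rV_ball_bound (ddf _).
exists (n%:R * L) => [|x y xr yr]; first by rewrite mulr_ge0.
have [|xi hxi ->] := mvt_rV x y (f := f); first by move=> z i; exact: df.
apply: (le_trans (ler_norm_sum _ _ _)).
apply: (@le_trans _ _ (\sum_(i < n) L * `|y - x|)).
  apply: ler_sum => i _; rewrite normrM mulrC; apply: ler_pM => //.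
    apply: hL; rewrite -(subrK x (xi i)) (le_trans (ler_normD _ _))//.
    have := hxi i; have := ler_normB y x; lra.
  by rewrite -rVB coord_le_norm.
by rewrite big_const_ord iter_addr addr0 -[leLHS]mulr_natl mulrA.
Qed.

Lemma taylor_ball n (f : 'rV[R]_n -> R) (r : R) : Ck 2 f ->
  exists2 C : R, 0 <= C & forall x y, `|x| <= r -> `|y| <= r ->
    `|f y - f x - \sum_i (y 0 i - x 0 i) * partial i f x| <= C * `|y - x| ^+ 2.
Proof.
move=> Cf; have [cf df ddf] := CkW Cf.
have [L L0 hL] : exists2 L : R, 0 <= L & forall i : 'I_n, forall x y : 'rV[R]_n,
    `|x| <= 3 * r -> `|y| <= 3 * r -> `|partial i f y - partial i f x| <= L * `|y - x|.
  apply: uniform_constant => [i C C' CC' H x y xr yr|i].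
    by apply: le_trans (H x y xr yr) _; rewrite ler_wpM2r.
  by have [_ _ C1] := Cf; exact: lipschitz_ball (C1 _).
exists (n%:R * L) => [|x y xr yr]; first by rewrite mulr_ge0.
have [|xi hxi ->] := mvt_rV x y (f := f); first by move=> z i; exact: df.
rewrite -sumrB; apply: (le_trans (ler_norm_sum _ _ _)).
apply: (@le_trans _ _ (\sum_(i < n) L * `|y - x| ^+ 2)); last first.
  by rewrite big_const_ord iter_addr addr0 -[leLHS]mulr_natl mulrA.
have r0 : 0 <= r by exact: le_trans xr.
apply: ler_sum => i _; rewrite -mulrBr normrM expr2 mulrCA; apply: ler_pM => //.
  by rewrite -rVB coord_le_norm.
apply: (@le_trans _ _ (L * `|xi i - x|)); last by rewrite ler_wpM2l.
apply: hL; first lra.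
rewrite -(subrK x (xi i)) (le_trans (ler_normD _ _))//.
have := hxi i; have := ler_normB y x; lra.
Qed.

Lemma is_derive_of_rate (V : normedModType R) (f : V -> R) x v (l C : R) :
  (forall h : R, h != 0 -> `|h| <= 1 ->
    `|h^-1 * (f (x + h *: v) - f x) - l| <= C * `|h|) -> is_derive x v f l.
Proof.
move=> H; suff E : h^-1 *: ((f \o shift x) (h *: v) - f x) @[h --> 0^'] --> l.
  by apply: DeriveDef; [apply/cvg_ex; exists l|exact: cvg_lim E].
apply/cvgrPdist_le => e e0.
have C0 : 0 < `|C| + 1 by rewrite ltr_wpDl.
near=> h; rewrite distrC /= addrC.
have h0 : h != 0 by near: h; exact: nbhs_dnbhs_neq.
have h1 : `|h| <= 1 by near: h; exact: dnbhs0_le.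
have h2 : `|h| <= e / (`|C| + 1) by near: h; apply: dnbhs0_le; rewrite divr_gt0.
rewrite addrC [h *: v + x]addrC; apply: (le_trans (H h h0 h1)).
rewrite ler_pdivlMr// in h2; apply: le_trans h2; rewrite mulrC ler_wpM2l//.
by rewrite (le_trans (ler_norm C))// lerDl.
Unshelve. all: by end_near. Qed.

End LocalBounds.

(** * The first variation of a flow in its initial point *)

Section Variation.
Context (R : realType) (n : nat) (B : 'rV[R]_n -> 'rV[R]_n)
  (Phi : R -> 'rV[R]_n -> 'rV[R]_n).
Hypothesis smoothB : forall k i, Ck k (fun x => B x 0 i).
Hypothesis flowPhi : is_flow B Phi.

(** The derivative of [B] at [x] applied to [q], written through partial derivatives so that
    linearity in [q] is immediate; it is the right-hand side of the variational equation. *)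
Definition dfield (x q : 'rV[R]_n) : 'rV[R]_n :=
  \row_i \sum_j q 0 j * partial j (fun y => B y 0 i) x.

Lemma dfieldB x p q i : dfield x p 0 i - dfield x q 0 i = dfield x (p - q) 0 i.
Proof.
by rewrite !mxE -sumrB; apply: eq_bigr => j _; rewrite -mulrBl rVB.
Qed.

Lemma dfield_bound (r : R) : exists2 A : R, 0 <= A &
  forall x q i, `|x| <= r -> `|dfield x q 0 i| <= A * `|q|.
Proof.
suff [A A0 hA] : exists2 A : R, 0 <= A & forall i, (fun i A => forall x q, `|x| <= r ->
    `|dfield x q 0 i| <= A * `|q|) i A by exists A => // x q i; exact: hA.
apply: uniform_constant => [i C C' CC' H x q xr|i].
  by apply: le_trans (H x q xr) _; rewrite ler_wpM2r.
have [A A0 hA] : exists2 A : R, 0 <= A & forall j : 'I_n, forall x : 'rV[R]_n, `|x| <= r ->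
    `|partial j (fun y => B y 0 i) x| <= A.
  apply: uniform_constant => [j C C' CC' H x xr|j]; first exact: le_trans (H x xr) CC'.
  by apply: rV_ball_bound; have [_ _] := smoothB 1 i; exact.
exists (n%:R * A) => [|x q xr]; first by rewrite mulr_ge0.
rewrite mxE (le_trans (ler_norm_sum _ _ _))//.
apply: (@le_trans _ _ (\sum_(j < n) A * `|q|)).
  apply: ler_sum => j _; rewrite normrM mulrC; apply: ler_pM => //; last exact: coord_le_norm.
  exact: hA.
by rewrite big_const_ord iter_addr addr0 -[leLHS]mulr_natl mulrA.
Qed.

Lemma field_bound (r : R) : exists2 M : R, 0 <= M &
  forall x i, `|x| <= r -> `|B x 0 i| <= M.
Proof.
suff [A A0 hA] : exists2 A : R, 0 <= A & forall i, (fun i A => forall x, `|x| <= r ->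
    `|B x 0 i| <= A) i A by exists A => // x i; exact: hA.
apply: uniform_constant => [i C C' CC' H x xr|i]; first exact: le_trans (H x xr) CC'.
by apply: rV_ball_bound; exact: (smoothB 0 i).
Qed.

Lemma field_lipschitz (r : R) : exists2 L : R, 0 <= L &
  forall x y i, `|x| <= r -> `|y| <= r -> `|B x 0 i - B y 0 i| <= L * `|x - y|.
Proof.
suff [A A0 hA] : exists2 A : R, 0 <= A & forall i, (fun i A => forall x y, `|x| <= r ->
    `|y| <= r -> `|B y 0 i - B x 0 i| <= A * `|y - x|) i A.
  by exists A => // x y i xr yr; exact: hA.
apply: uniform_constant => [i C C' CC' H x y xr yr|i].
  by apply: le_trans (H x y xr yr) _; rewrite ler_wpM2r.
exact: lipschitz_ball (smoothB 1 i).
Qed.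

Lemma field_taylor (r : R) : exists2 C : R, 0 <= C &
  forall x y i, `|x| <= r -> `|y| <= r ->
    `|B y 0 i - B x 0 i - dfield x (y - x) 0 i| <= C * `|y - x| ^+ 2.
Proof.
suff [A A0 hA] : exists2 A : R, 0 <= A & forall i, (fun i A => forall x y, `|x| <= r ->
    `|y| <= r -> `|B y 0 i - B x 0 i - dfield x (y - x) 0 i| <= A * `|y - x| ^+ 2) i A.
  by exists A => // x y i xr yr; exact: hA.
apply: uniform_constant => [i C C' CC' H x y xr yr|i].
  by apply: le_trans (H x y xr yr) _; rewrite ler_wpM2r// sqr_ge0.
have [C C0 hC] := taylor_ball r (smoothB 2 i); exists C => // x y xr yr.
rewrite mxE; under [X in _ - X]eq_bigr do rewrite rVB.
exact: hC.
Qed.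

(** [flow_bounded] keeps both trajectories in one ball, where the field is Lipschitz; Gronwall with
    defect [d = 0] applies to their difference. *)
Lemma flow_lipschitz_space (T r : R) : 0 <= T ->
  exists2 C : R, 0 <= C & forall t x y, `|t| <= T -> `|x| <= r -> `|y| <= r ->
    `|Phi t x - Phi t y| <= C * `|x - y|.
Proof.
move=> T0; have [D hD] := flow_bounded flowPhi T r.
have [L L0 hL] := field_lipschitz D.
have [C C0 hC] := @rV_gronwall R n L T L0 T0; exists C => // t x y tT xr yr.
have := hC (fun s => Phi s x - Phi s y) (fun s => B (Phi s x) - B (Phi s y)) 0 (lexx _).
rewrite !(flow0 flowPhi) addr0; apply => //.
- move=> s sT i; rewrite rVB.
  rewrite (_ : (fun _ => _) = (fun s => Phi s x 0 i) - (fun s => Phi s y 0 i)).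
    by apply: is_deriveB; exact: flow_derive.
  by apply/funext => u; rewrite rVB.
- by move=> s sT i; rewrite rVB addr0 hL// hD.
Qed.

Lemma flow_lipschitz_time (T r : R) :
  exists2 C : R, 0 <= C & forall s t x, `|s| <= T -> `|t| <= T -> `|x| <= r ->
    `|Phi s x - Phi t x| <= C * `|s - t|.
Proof.
(* The mean value theorem visits times within [2 * T] of [t], hence of modulus at most [3 * T]. *)
have [D hD] := flow_bounded flowPhi (3 * T) r.
have [M M0 hM] := field_bound D; exists M => // s t x sT tT xr.
apply: norm_rV_le => [|i]; first by rewrite mulr_ge0.
rewrite rVB; apply: (lipschitz_of_derive (fun u => flow_derive flowPhi u x i)) => u ut.
apply: hM; apply: hD => //.
rewrite -(subrK t u) (le_trans (ler_normD _ _))//.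
have := ler_normB s t; lra.
Qed.

Lemma flow_continuous i : continuous (fun p : R * 'rV[R]_n => Phi p.1 p.2 0 i).
Proof.
move=> [t x] /=; pose T := `|t| + 1; pose r := `|x| + 1.
have T0 : 0 <= T by rewrite addr_ge0.
have [C C0 hC] := flow_lipschitz_space r T0.
have [D D0 hD] := flow_lipschitz_time T r.
apply/cvgrPdist_le => e e0.
have E0 : 0 < e / (C + D + 1) by rewrite divr_gt0// ltr_wpDl// addr_ge0.
near=> p.
have p1 : `|t - p.1| <= e / (C + D + 1).
  by near: p; apply: (cvgrPdist_le (fun p : R * 'rV[R]_n => p.1) t).1 => //; exact: cvg_fst.
have p2 : `|x - p.2| <= e / (C + D + 1).
  by near: p; apply: (cvgrPdist_le (fun p : R * 'rV[R]_n => p.2) x).1 => //; exact: cvg_snd.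
have q1 : `|t - p.1| <= 1.
  by near: p; apply: (cvgrPdist_le (fun p : R * 'rV[R]_n => p.1) t).1 => //; exact: cvg_fst.
have q2 : `|x - p.2| <= 1.
  by near: p; apply: (cvgrPdist_le (fun p : R * 'rV[R]_n => p.2) x).1 => //; exact: cvg_snd.
have pT : `|p.1| <= T.
  by rewrite -(subrK t p.1) (le_trans (ler_normD _ _))// addrC lerD// distrC.
have pr : `|p.2| <= r.
  by rewrite -(subrK x p.2) (le_trans (ler_normD _ _))// addrC lerD// distrC.
rewrite -rVB (le_trans (coord_le_norm _ _))//.
rewrite -(subrK (Phi p.1 x) (Phi t x)) -addrA.
apply: (le_trans (ler_normD _ _)).
have h1 : `|Phi t x - Phi p.1 x| <= D * `|t - p.1| by apply: hD => //; rewrite lerDl.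
have h2 : `|Phi p.1 x - Phi p.1 p.2| <= C * `|x - p.2| by apply: hC => //; rewrite lerDl.
apply: (le_trans (lerD h1 h2)).
apply: (@le_trans _ _ (D * (e / (C + D + 1)) + C * (e / (C + D + 1)))).
  by apply: lerD; rewrite ler_wpM2l.
rewrite -mulrDl mulrCA -[leRHS]mulr1 (addrC D) ler_wpM2l ?(ltW e0)//.
have P0 : 0 < C + D + 1 by rewrite ltr_wpDl// addr_ge0.
by rewrite (ler_pdivrMr _ _ P0) mul1r lerDl.
Unshelve. all: by end_near. Qed.

(** Difference quotients of the flow in its initial point; [dQ] is their time derivative. *)
Let Q (h t : R) (x w : 'rV[R]_n) : 'rV[R]_n := h^-1 *: (Phi t (x + h *: w) - Phi t x).
Let dQ (h t : R) (x w : 'rV[R]_n) : 'rV[R]_n :=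
  h^-1 *: (B (Phi t (x + h *: w)) - B (Phi t x)).

Let Q_derive (h t : R) x w i : is_derive t 1 (fun s => Q h s x w 0 i) (dQ h t x w 0 i).
Proof.
rewrite (_ : (fun _ => _) = h^-1 *: ((fun s => Phi s (x + h *: w) 0 i) - (fun s => Phi s x 0 i))).
  rewrite mxE rVB; apply: is_deriveZ; apply: is_deriveB; exact: flow_derive.
by apply/funext => s; rewrite !mxE.
Qed.

Let Q0 (h : R) x w : h != 0 -> Q h 0 x w = w.
Proof.
by move=> h0; rewrite /Q !(flow0 flowPhi) addrC addKr scalerA mulVf// scale1r.
Qed.

Let shift_bound (h r : R) (x w : 'rV[R]_n) : `|h| <= 1 -> `|x| <= r -> `|w| <= r ->
  `|x + h *: w| <= 2 * r.
Proof.
move=> h1 xr wr; apply: (le_trans (ler_normD _ _)); rewrite mulr2n mulrDl mul1r lerD//.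
by rewrite normrZ -[leRHS]mul1r ler_pM.
Qed.

Let Q_bound (T r : R) : 0 <= T -> exists2 C : R, 0 <= C & forall h t x w,
  h != 0 -> `|h| <= 1 -> `|t| <= T -> `|x| <= r -> `|w| <= r -> `|Q h t x w| <= C.
Proof.
move=> T0; have [C C0 hC] := flow_lipschitz_space (2 * r) T0.
exists (C * `|r|) => [|h t x w h0 h1 tT xr wr]; first by rewrite mulr_ge0.
have r0 : 0 <= r by exact: le_trans xr.
rewrite /Q normrZ normfV mulrC ler_pdivrMr ?normr_gt0//.
apply: (le_trans (hC t _ _ tT (shift_bound h1 xr wr) _)); first lra.
rewrite addrC addKr normrZ -mulrA ler_wpM2l// mulrC ler_wpM2r//.
by rewrite (ger0_norm r0).
Qed.

(** [Q] solves the variational equation up to O(h): the increment of the flow is [h *: Q], and the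
    quadratic Taylor remainder of [B] is divided by [h]. *)
Let dQ_taylor (T r : R) : 0 <= T -> exists2 C : R, 0 <= C & forall h t x w i,
  h != 0 -> `|h| <= 1 -> `|t| <= T -> `|x| <= r -> `|w| <= r ->
  `|dQ h t x w 0 i - dfield (Phi t x) (Q h t x w) 0 i| <= C * `|h|.
Proof.
move=> T0; have [q q0 hq] := Q_bound r T0.
have [D hD] := flow_bounded flowPhi T (2 * r).
have [C C0 hC] := field_taylor D.
exists (C * q ^+ 2) => [|h t x w i h0 h1 tT xr wr]; first by rewrite mulr_ge0// sqr_ge0.
have r0 : 0 <= r by exact: le_trans xr.
have dE : Phi t (x + h *: w) - Phi t x = h *: Q h t x w.
  by rewrite /Q scalerA divff// scale1r.
have -> : dQ h t x w 0 i - dfield (Phi t x) (Q h t x w) 0 i =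
   h^-1 * (B (Phi t (x + h *: w)) 0 i - B (Phi t x) 0 i -
     dfield (Phi t x) (Phi t (x + h *: w) - Phi t x) 0 i).
  rewrite dE mulrBr mxE rVB; congr (_ - _).
  move: (Q h t x w) => v; rewrite !mxE mulr_sumr; apply: eq_bigr => j _.
  by rewrite mxE !mulrA mulVf// mul1r.
rewrite normrM normfV mulrC ler_pdivrMr ?normr_gt0//.
apply: (le_trans (hC _ _ _ _ _)).
- by apply: hD => //; lra.
- by apply: hD => //; exact: shift_bound.
rewrite dE normrZ exprMn.
have hq2 : `|Q h t x w| ^+ 2 <= q ^+ 2 by rewrite lerXn2r ?nnegrE// hq.
have -> : C * q ^+ 2 * `|h| * `|h| = C * (`|h| ^+ 2 * q ^+ 2) by ring.
by rewrite ler_wpM2l// ler_wpM2l// sqr_ge0.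
Qed.

(** Both quotients start from [w] and solve the same linear equation up to O(|h| + |k|), so Gronwall
    bounds their difference by this defect. *)
Let Q_cauchy (T r : R) : 0 <= T -> exists2 C : R, 0 <= C & forall h k t x w,
  h != 0 -> `|h| <= 1 -> k != 0 -> `|k| <= 1 -> `|t| <= T -> `|x| <= r -> `|w| <= r ->
  `|Q h t x w - Q k t x w| <= C * (`|h| + `|k|).
Proof.
move=> T0; have [E E0 hE] := dQ_taylor r T0.
have [D hD] := flow_bounded flowPhi T r.
have [A A0 hA] := dfield_bound D.
have [C C0 hC] := @rV_gronwall R n A T A0 T0.
exists (C * E) => [|h k t x w h0 h1 k0 k1 tT xr wr]; first by rewrite mulr_ge0.
have d0 : 0 <= E * (`|h| + `|k|) by rewrite mulr_ge0// addr_ge0.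
have := hC (fun s => Q h s x w - Q k s x w) (fun s => dQ h s x w - dQ k s x w) _ d0.
rewrite !Q0// subrr normr0 add0r mulrA; apply => //.
- move=> s sT i; rewrite rVB.
  rewrite (_ : (fun _ => _) = (fun s => Q h s x w 0 i) - (fun s => Q k s x w 0 i)).
    by apply: is_deriveB; exact: Q_derive.
  by apply/funext => u; rewrite rVB.
- move=> s sT i; rewrite rVB.
  have a1 := hE h s x w i h0 h1 sT xr wr.
  have a2 := hE k s x w i k0 k1 sT xr wr.
  have a3 := hA (Phi s x) (Q h s x w - Q k s x w) i (hD s x sT xr).
  rewrite -dfieldB in a3.
  have -> : dQ h s x w 0 i - dQ k s x w 0 i =
    (dfield (Phi s x) (Q h s x w) 0 i - dfield (Phi s x) (Q k s x w) 0 i) +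
    ((dQ h s x w 0 i - dfield (Phi s x) (Q h s x w) 0 i) -
     (dQ k s x w 0 i - dfield (Phi s x) (Q k s x w) 0 i)) by ring.
  apply: (le_trans (ler_normD _ _)); apply: lerD => //.
  by apply: (le_trans (ler_normB _ _)); rewrite mulrDr lerD.
Qed.

Let halves (m : nat) : (2 ^- m : R) != 0 /\ `|2 ^- m : R| <= 1.
Proof.
split; first by rewrite invr_eq0 expf_neq0.
rewrite ger0_norm ?invr_ge0 ?exprn_ge0// invf_le1 ?exprn_gt0//.
by rewrite exprn_ege1// ler1n.
Qed.

(** [V] is the limit of the quotients along the steps [2 ^- m]. It is chosen once, before [T] and
    [r], and [Q_cauchy] then extends the rate to every [h]. *)
Lemma flow_variation : exists V : R -> 'rV[R]_n -> 'rV[R]_n -> 'rV[R]_n,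
  forall T r : R, 0 <= T -> exists2 C : R, 0 <= C & forall h t x w,
    h != 0 -> `|h| <= 1 -> `|t| <= T -> `|x| <= r -> `|w| <= r ->
    `|Q h t x w - V t x w| <= C * `|h|.
Proof.
have P (z : R * 'rV[R]_n * 'rV[R]_n) : exists v : 'rV[R]_n, exists c : R, forall m i,
    `|Q (2 ^- m) z.1.1 z.1.2 z.2 0 i - v 0 i| <= c / 2 ^+ m.
  case: z => [[t x] w] /=; pose r := `|x| + `|w|.
  have [C C0 hC] := Q_cauchy r (normr_ge0 t).
  have /choice[v hv] : forall i, exists l, forall m,
      `|Q (2 ^- m) t x w 0 i - l| <= 2 * (C * 2) / 2 ^+ m.
    move=> i; apply: geometric_limit => [|m]; first by rewrite mulr_ge0.
    rewrite -rVB (le_trans (coord_le_norm _ _))//.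
    apply: (le_trans (hC _ _ t x w (halves m.+1).1 (halves m.+1).2 (halves m).1
      (halves m).2 _ _ _)); rewrite ?lerDl ?lerDr//.
    rewrite -mulrA ler_wpM2l// !ger0_norm ?invr_ge0 ?exprn_ge0//.
    have : 0 <= (2 ^- m : R) by rewrite invr_ge0 exprn_ge0.
    by rewrite exprS invfM; lra.
  exists (\row_i v i); exists (2 * (C * 2)) => m i.
  have -> : (\row_i v i) 0 i = v i by rewrite mxE.
  exact: hv.
have /choice[V hV] := P; exists (fun t x w => V (t, x, w)) => T r T0.
have [C C0 hC] := Q_cauchy r T0; exists C => // h t x w h0 h1 tT xr wr.
apply: norm_rV_le => [|i]; first by rewrite mulr_ge0.
apply/ler_addgt0Pr => e e0; have [c /= hc] := hV (t, x, w).
have [m hm] := geometric_small (C + c) e0.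
have -> : (Q h t x w - V (t, x, w)) 0 i =
   (Q h t x w - Q (2 ^- m) t x w) 0 i + (Q (2 ^- m) t x w 0 i - V (t, x, w) 0 i).
  by rewrite !rVB; ring.
apply: (le_trans (ler_normD _ _)).
have a1 := hC h _ t x w h0 h1 (halves m).1 (halves m).2 tT xr wr.
have a2 := coord_le_norm (Q h t x w - Q (2 ^- m) t x w) i.
have a3 := hc m i; rewrite mulrDl in hm.
rewrite mulrDr (@ger0_norm _ (2 ^- m)) ?invr_ge0 ?exprn_ge0// in a1.
lra.
Qed.

Variable V : R -> 'rV[R]_n -> 'rV[R]_n -> 'rV[R]_n.
Hypothesis VQ : forall T r : R, 0 <= T -> exists2 C : R, 0 <= C & forall h t x w,
    h != 0 -> `|h| <= 1 -> `|t| <= T -> `|x| <= r -> `|w| <= r ->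
    `|h^-1 *: (Phi t (x + h *: w) - Phi t x) - V t x w| <= C * `|h|.

Let V_approx t x w : exists2 C : R, 0 <= C & forall m, `|Q (2 ^- m) t x w - V t x w| <= C / 2 ^+ m.
Proof.
have [C C0 hC] := VQ (`|x| + `|w|) (normr_ge0 t); exists C => // m.
apply: (le_trans (hC _ t x w (halves m).1 (halves m).2 _ _ _)); rewrite ?lerDl ?lerDr//.
by rewrite ger0_norm// invr_ge0 exprn_ge0.
Qed.

Lemma variation_bounded (T r : R) : exists C : R, forall t x w,
  `|t| <= T -> `|x| <= r -> `|w| <= r -> `|V t x w| <= C.
Proof.
have [T0|T0] := leP 0 T; last first.
  by exists 0 => t x w tT; have := le_lt_trans tT T0; rewrite normr_lt0.
have [q q0 hq] := Q_bound r T0; have [C C0 hC] := VQ r T0.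
exists (q + C) => t x w tT xr wr.
have h0 : (1 : R) != 0 by exact: oner_neq0.
have h1 : `|1 : R| <= 1 by rewrite normr1.
have -> : V t x w = Q 1 t x w - (Q 1 t x w - V t x w) by rewrite opprB addrC subrK.
apply: (le_trans (ler_normB _ _)); apply: lerD; first exact: hq.
by apply: (le_trans (hC 1 t x w _ _ _ _ _)) => //; rewrite normr1 mulr1.
Qed.

Lemma variation0 x w : V 0 x w = w.
Proof.
apply/rowP => i; have [C C0 hC] := V_approx 0 x w.
apply: (@eq_of_le_geometric _ _ _ C) => m.
have a1 := coord_le_norm (w - V 0 x w) i; rewrite rVB distrC in a1.
apply: (le_trans a1); have := hC m.
by rewrite Q0// (halves m).1.
Qed.

Lemma dQ_bound (T r : R) : 0 <= T -> exists2 C : R, 0 <= C & forall h t x w i,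
  h != 0 -> `|h| <= 1 -> `|t| <= T -> `|x| <= r -> `|w| <= r -> `|dQ h t x w 0 i| <= C.
Proof.
move=> T0; have [q q0 hq] := Q_bound r T0.
have [D hD] := flow_bounded flowPhi T r.
have [A A0 hA] := dfield_bound D.
have [E E0 hE] := dQ_taylor r T0.
exists (A * q + E) => [|h t x w i h0 h1 tT xr wr]; first by rewrite addr_ge0// mulr_ge0.
rewrite -(subrK (dfield (Phi t x) (Q h t x w) 0 i) (dQ h t x w 0 i)) addrC.
apply: (le_trans (ler_normD _ _)); apply: lerD.
  apply: (le_trans (hA _ _ _ _)); first exact: hD.
  by rewrite ler_wpM2l// hq.
by apply: (le_trans (hE _ _ _ _ _ h0 h1 tT xr wr)); rewrite -[leRHS]mulr1 ler_wpM2l.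
Qed.

(** The dyadic quotients are Lipschitz in time with a common constant by [dQ_bound], and the bound
    passes to the limit. *)
Lemma variation_continuous x w i : continuous (fun t => V t x w 0 i).
Proof.
move=> t; pose T := `|t| + 1; have T0 : 0 <= 3 * T by rewrite mulr_ge0// addr_ge0.
pose r := `|x| + `|w|.
have [C C0 hC] := dQ_bound r T0.
have lip s : `|s| <= T -> `|V t x w 0 i - V s x w 0 i| <= C * `|t - s|.
  move=> sT; apply/ler_addgt0Pr => e e0.
  have [D D0 hD] := V_approx t x w; have [E E0 hE] := V_approx s x w.
  have [m hm] := geometric_small (D + E) e0; rewrite mulrDl in hm.
  have a1 := le_trans (coord_le_norm _ i) (hD m); rewrite rVB in a1.
  have a2 := le_trans (coord_le_norm _ i) (hE m); rewrite rVB in a2.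
  have a3 : `|Q (2 ^- m) t x w 0 i - Q (2 ^- m) s x w 0 i| <= C * `|t - s|.
    apply: (lipschitz_of_derive (fun u => Q_derive (2 ^- m) u x w i)) => u us.
    apply: hC; rewrite ?(halves m).1 ?(halves m).2 ?lerDl ?lerDr//.
    rewrite -(subrK s u) (le_trans (ler_normD _ _))//.
    have := ler_normB t s; have : `|t| <= T by rewrite lerDl.
    lra.
  have -> : V t x w 0 i - V s x w 0 i =
    (Q (2 ^- m) t x w 0 i - Q (2 ^- m) s x w 0 i) +
    ((Q (2 ^- m) s x w 0 i - V s x w 0 i) - (Q (2 ^- m) t x w 0 i - V t x w 0 i)) by ring.
  apply: (le_trans (ler_normD _ _)); apply: lerD => //.
  apply: (le_trans (ler_normB _ _)); lra.
apply/cvgrPdist_le => e e0; have E0 : 0 < e / (C + 1) by rewrite divr_gt0// ltr_wpDl.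
near=> s.
have s1 : `|t - s| <= 1 by near: s; apply: (cvgrPdist_le id t).1 => //; exact: cvg_id.
have s2 : `|t - s| <= e / (C + 1) by near: s; apply: (cvgrPdist_le id t).1 => //; exact: cvg_id.
apply: (le_trans (lip s _)).
  by rewrite -(subrK t s) (le_trans (ler_normD _ _))// addrC lerD// distrC.
apply: (le_trans (ler_wpM2l C0 s2)); rewrite mulrCA -[leRHS]mulr1 ler_wpM2l ?(ltW e0)//.
have P0 : 0 < C + 1 by rewrite ltr_wpDl.
by rewrite (ler_pdivrMr _ _ P0) mul1r lerDl.
Unshelve. all: by end_near. Qed.

(** The limit [V] is not differentiated directly. With [G] an antiderivative of the expected
    right-hand side, [Q - G] has a derivative of size O(h) and starts from [w], so letting [h] tend
    to 0 gives [V = w + G]. *)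
Lemma variation_derive (t : R) x w i :
  is_derive t 1 (fun s => V s x w 0 i) (dfield (Phi t x) (V t x w) 0 i).
Proof.
have cf : continuous (fun s => dfield (Phi s x) (V s x w) 0 i).
  rewrite (_ : (fun _ => _) = fun s => \sum_j V s x w 0 j *
      partial j (fun y => B y 0 i) (Phi s x)); last by apply/funext => s; rewrite mxE.
  move=> s; apply: cvg_big => [|j _]; first exact: add_continuous.
  apply: cvgM; first exact: variation_continuous.
  apply: (cvg_comp (fun s => Phi s x) (partial j (fun y => B y 0 i))).
    apply: (@continuous_rV _ _ _ (fun s => Phi s x)) => l u.
    exact: is_derive_continuous (flow_derive flowPhi u x l).
  by have [_ _ H] := smoothB 1 i; exact: H.
have [G G0 DG] := antiderivative cf.
suff -> : (fun s => V s x w 0 i) = cst (w 0 i) + G.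
  by rewrite -[dfield _ _ _ _]add0r; apply: is_deriveD.
apply/funext => s; rewrite fctE /cst.
pose r := `|x| + `|w|; have T0 := normr_ge0 s.
have [C C0 hC] := VQ r T0.
have [E E0 hE] := dQ_taylor r T0.
have [D hD] := flow_bounded flowPhi `|s| r.
have [A A0 hA] := dfield_bound D.
apply: (@eq_of_le_geometric _ _ _ ((E + A * C) * `|s| + C)) => m.
have xr : `|x| <= r by rewrite lerDl.
have wr : `|w| <= r by rewrite lerDr.
have [h0 h1] := halves m; set h := 2 ^- m in h0 h1.
have hE' : `|h| = h by rewrite ger0_norm// invr_ge0 exprn_ge0.
have a1 := hC h s x w h0 h1 (lexx _) xr wr.
have a2 := le_trans (coord_le_norm _ i) a1; rewrite rVB -/(Q h s x w) in a2.
have DQ (u : R) : is_derive u 1 ((fun s => Q h s x w 0 i) - G)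
    (dQ h u x w 0 i - dfield (Phi u x) (V u x w) 0 i).
  by apply: is_deriveB; exact: Q_derive.
have := @lipschitz_of_derive _ _ _ ((E + A * C) * h) 0 s DQ.
rewrite !fctE Q0// G0 !subr0 => a3; have {}a3 := a3 _.
have -> : V s x w 0 i - (w 0 i + G s) =
  (Q h s x w 0 i - G s - w 0 i) - (Q h s x w 0 i - V s x w 0 i) by ring.
apply: (le_trans (ler_normB _ _)); rewrite mulrDl mulrAC; apply: lerD.
  apply: a3 => u; rewrite subr0 => us.
  have b1 := hE h u x w i h0 h1 us xr wr.
  have b2 := hA (Phi u x) (Q h u x w - V u x w) i (hD u x us xr).
  have b3 := hC h u x w h0 h1 us xr wr.
  rewrite -(subrK (dfield (Phi u x) (Q h u x w) 0 i) (dQ h u x w 0 i)) -addrA dfieldB.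
  rewrite hE' in b1 b3.
  apply: (le_trans (ler_normD _ _)); rewrite mulrDl; apply: lerD => //.
  by apply: (le_trans b2); rewrite -mulrA ler_wpM2l.
by rewrite hE' in a2.
Qed.

End Variation.

(** * Smoothness, uniqueness and group law of flows *)

Section FlowSmooth.
Context (R : realType).

Lemma continuous_pair (S T U : topologicalType) (f : S -> T) (g : S -> U) :
  continuous f -> continuous g -> continuous (fun x => (f x, g x)).
Proof. by move=> cf cg x; apply: cvg_pair; [exact: cf|exact: cg]. Qed.

Lemma rV_split m n (P : 'I_(m + n) -> Prop) :
  (forall i, P (lshift n i)) -> (forall j, P (rshift m j)) -> forall k, P k.
Proof.
by move=> Pl Pr k; rewrite -(splitK k); case: (fintype.split k) => i; [exact: Pl|exact: Pr].
Qed.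

Lemma norm_lsubmx m n (v : 'rV[R]_(m + n)) : `|lsubmx v| <= `|v|.
Proof. by apply: norm_rV_le => // i; rewrite mxE coord_le_norm. Qed.

Lemma norm_rsubmx m n (v : 'rV[R]_(m + n)) : `|rsubmx v| <= `|v|.
Proof. by apply: norm_rV_le => // i; rewrite mxE coord_le_norm. Qed.

Lemma norm_row_mx m n (u : 'rV[R]_m) (v : 'rV[R]_n) (r : R) :
  `|u| <= r -> `|v| <= r -> `|row_mx u v| <= r.
Proof.
move=> ur vr; apply: norm_rV_le; first exact: le_trans ur.
apply: rV_split => i; rewrite ?row_mxEl ?row_mxEr; exact: le_trans (coord_le_norm _ _) _.
Qed.

Lemma Ck_lsubmx m n k (f : 'rV[R]_m -> R) :
  Ck k f -> Ck k (fun v : 'rV[R]_(m + n) => f (lsubmx v)).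
Proof.
apply: (@Ck_affine _ _ _ (@lsubmx R 1 m n) (@lsubmx R 1 m n)).
  apply: continuous_rV => i; rewrite (_ : (fun _ => _) = fun v : 'rV_(m + n) => v 0 (lshift n i)).
    exact: coord_continuous.
  by apply/funext => v; rewrite mxE.
by move=> x v h; apply/rowP => i; rewrite !mxE.
Qed.

(* Its flow is (Phi, d Phi), so regularity of flows bootstraps from C^1 to C^k. *)
Definition tangent_field n (B : 'rV[R]_n -> 'rV[R]_n) (z : 'rV[R]_(n + n)) :=
  row_mx (B (lsubmx z)) (dfield B (lsubmx z) (rsubmx z)).

Lemma tangent_field_Ck n (B : 'rV[R]_n -> 'rV[R]_n) :
  (forall k i, Ck k (fun x => B x 0 i)) ->
  forall k i, Ck k (fun x => tangent_field B x 0 i).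
Proof.
move=> CB k; apply: rV_split => i.
  under eq_fun do rewrite row_mxEl; exact: (Ck_lsubmx n (CB k i)).
rewrite (_ : (fun _ => _) = fun z : 'rV[R]_(n + n) => \sum_j z 0 (rshift n j) *
    partial j (fun y => B y 0 i) (lsubmx z)); last first.
  by apply/funext => z; rewrite row_mxEr mxE; apply: eq_bigr => j _; rewrite mxE.
apply: Ck_sum => j; apply: CkM; first exact: Ck_coord.
by have [_ _ C1] := CB k.+1 i; exact: (Ck_lsubmx n (C1 _)).
Qed.

Lemma tangent_flow n (B : 'rV[R]_n -> 'rV[R]_n) Phi :
  (forall k i, Ck k (fun x => B x 0 i)) -> is_flow B Phi ->
  exists V : R -> 'rV[R]_n -> 'rV[R]_n -> 'rV[R]_n,
    is_flow (tangent_field B) (fun t z => row_mx (Phi t (lsubmx z))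
      (V t (lsubmx z) (rsubmx z))) /\
    forall T r : R, 0 <= T -> exists2 C : R, 0 <= C & forall h t x w,
    h != 0 -> `|h| <= 1 -> `|t| <= T -> `|x| <= r -> `|w| <= r ->
    `|h^-1 *: (Phi t (x + h *: w) - Phi t x) - V t x w| <= C * `|h|.
Proof.
move=> CB fPhi; have [V hV] := flow_variation CB fPhi.
exists V; split => //; split.
- by move=> z; rewrite (flow0 fPhi) (variation0 fPhi hV) hsubmxK.
- move=> t z; apply: rV_split => i.
    under eq_fun do rewrite row_mxEl; rewrite row_mxEl row_mxKl.
    exact: flow_derive.
  under eq_fun do rewrite row_mxEr; rewrite row_mxEr row_mxKl row_mxKr.
  exact: variation_derive.
- move=> T r; have [C hC] := flow_bounded fPhi T r.
  have [D hD] := variation_bounded CB fPhi hV T r.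
  exists (Num.max C D) => t z tT zr; apply: norm_row_mx; rewrite le_max.
    by rewrite hC// (le_trans (norm_lsubmx _)).
  by rewrite hD ?orbT// ?(le_trans (norm_lsubmx _))// (le_trans (norm_rsubmx _)).
Qed.

(** The increment splits into a time part at the shifted point [x + h *: w], treated by the mean
    value theorem, and a space part at the fixed time [t], treated by [V]. Both leave an error
    O(h). *)
Lemma flow_joint_derive n (B : 'rV[R]_n -> 'rV[R]_n) Phi V :
  (forall k i, Ck k (fun x => B x 0 i)) -> is_flow B Phi ->
  (forall T r : R, 0 <= T -> exists2 C : R, 0 <= C & forall h t x w,
    h != 0 -> `|h| <= 1 -> `|t| <= T -> `|x| <= r -> `|w| <= r ->
    `|h^-1 *: (Phi t (x + h *: w) - Phi t x) - V t x w| <= C * `|h|) ->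
  forall (p v : R * 'rV[R]_n) i,
    is_derive p v (fun p => Phi p.1 p.2 0 i)
      (v.1 * B (Phi p.1 p.2) 0 i + V p.1 p.2 v.2 0 i).
Proof.
move=> CB fPhi hV [t x] [a w] i /=.
pose T := `|t| + `|a|; pose r := `|x| + `|w|.
have T0 : 0 <= T by rewrite addr_ge0.
have [C C0 hC] := hV T r T0.
have [D hD] := flow_bounded fPhi T r.
have [L L0 hL] := field_lipschitz CB D.
have [E E0 hE] := flow_lipschitz_space CB fPhi r T0.
have [G G0 hG] := flow_lipschitz_time CB fPhi T r.
apply: (@is_derive_of_rate _ _ _ _ _ _ (`|a| * (L * (G * `|a| + E * `|w|)) + C)) => h h0 h1 /=.
have tT : `|t| <= T by rewrite lerDl.
have xr : `|x| <= r by rewrite lerDl.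
have wr : `|w| <= r by rewrite lerDr.
have yr : `|x + h *: w| <= r.
  apply: (le_trans (ler_normD _ _)); rewrite lerD2l normrZ -[leRHS]mul1r.
  by rewrite ler_wpM2r.
have [|c ch E1] := @mvt_line _ _ (fun s => Phi s (x + h *: w) 0 i) t 1 (h * a).
  by move=> s; have [] := flow_derive fPhi (t + s *: 1) (x + h *: w) i.
have [_ E2] := flow_derive fPhi (t + c *: 1) (x + h *: w) i.
rewrite {}E2 ![_%:A]mulr1 in E1; rewrite [h *: a]/(h * a).
have cT : `|t + c| <= T.
  apply: (le_trans (ler_normD _ _)); rewrite lerD2l (le_trans ch)// normrM.
  by rewrite -[leRHS]mul1r ler_wpM2r.
have -> : h^-1 * (Phi (t + h * a) (x + h *: w) 0 i - Phi t x 0 i) -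
    (a * B (Phi t x) 0 i + V t x w 0 i) =
  a * (B (Phi (t + c) (x + h *: w)) 0 i - B (Phi t x) 0 i) +
  (h^-1 *: (Phi t (x + h *: w) - Phi t x) - V t x w) 0 i.
  rewrite rVB mxE rVB.
  have -> : Phi (t + h * a) (x + h *: w) 0 i = Phi t (x + h *: w) 0 i +
    h * a * B (Phi (t + c) (x + h *: w)) 0 i by rewrite -E1; ring.
  by field.
apply: (le_trans (ler_normD _ _)); rewrite mulrDl; apply: lerD; last first.
  by apply: (le_trans (coord_le_norm _ _)); exact: hC.
rewrite normrM -!mulrA ler_wpM2l//.
apply: (le_trans (hL _ _ _ (hD _ _ cT yr) (hD _ _ tT xr))); rewrite ler_wpM2l//.
rewrite -(subrK (Phi (t + c) x) (Phi (t + c) (x + h *: w))) -addrA.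
apply: (le_trans (ler_normD _ _)); rewrite (addrC (G * _)) mulrDl; apply: lerD.
  apply: (le_trans (hE _ _ _ cT yr xr)); rewrite (addrC x) addrK -mulrA ler_wpM2l//.
  by rewrite normrZ mulrC.
apply: (le_trans (hG _ _ _ cT tT xr)); rewrite (addrC t) addrK -mulrA ler_wpM2l//.
by rewrite (le_trans ch)// normrM mulrC.
Qed.

(** The derivative contains [V], a component of the flow of [tangent_field B] in dimension [n + n].
    The induction hypothesis is applied to that flow, so the induction on [k] ranges over all
    dimensions and fields; the direction [w] enters as a frozen initial value. *)
Theorem flow_Ck k n (B : 'rV[R]_n -> 'rV[R]_n) Phi :
  (forall k i, Ck k (fun x => B x 0 i)) -> is_flow B Phi ->
  forall i, Ck k (fun p : R * 'rV[R]_n => Phi p.1 p.2 0 i).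
Proof.
elim: k n B Phi => [|k IH] n B Phi CB fPhi i; first exact: flow_continuous CB fPhi i.
have [V [fV hV]] := tangent_flow CB fPhi.
apply: (Ck_succ (df := fun v p : R * 'rV[R]_n => v.1 * B (Phi p.1 p.2) 0 i + V p.1 p.2 v.2 0 i)).
- exact: flow_continuous CB fPhi i.
- by move=> p v; exact: flow_joint_derive.
move=> [a w] /=; apply: CkD.
  apply: CkM; first exact: Ck_cst.
  by apply: (Ck_comp (CB k i)); exact: IH fPhi.
have := IH _ _ _ (tangent_field_Ck CB) fV (rshift n i).
have cA : continuous (fun p : R * 'rV[R]_n => (p.1, row_mx p.2 w)).
  apply: continuous_pair => [p|]; first exact: cvg_fst.
  apply: continuous_rV; apply: rV_split => j p.
    under eq_fun do rewrite row_mxEl.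
    apply: (cvg_comp snd (fun v : 'rV[R]_n => v 0 j)); first exact: cvg_snd.
    exact: coord_continuous.
  by under eq_fun do rewrite row_mxEr; exact: cvg_cst.
move=> /(Ck_affine (L := fun v : R * 'rV[R]_n => (v.1, row_mx v.2 (0 : 'rV[R]_n))) cA) H.
rewrite (_ : (fun _ => _) = (fun p : R * 'rV_(n + n) => row_mx (Phi p.1 (lsubmx p.2))
   (V p.1 (lsubmx p.2) (rsubmx p.2)) 0 (rshift n i)) \o
   (fun p : R * 'rV[R]_n => (p.1, row_mx p.2 w))).
  apply: H => x v h; congr pair; rewrite /= scale_row_mx scaler0 add_row_mx addr0//.
by apply/funext => p; rewrite /= row_mxEr row_mxKl row_mxKr.
Qed.

Lemma flow_unique n (B : 'rV[R]_n -> 'rV[R]_n) Phi (y : R -> 'rV[R]_n) :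
  (forall k i, Ck k (fun x => B x 0 i)) -> is_flow B Phi ->
  (forall (t : R) i, is_derive t 1 (fun s => y s 0 i) (B (y t) 0 i)) ->
  forall t, y t = Phi t (y 0).
Proof.
move=> CB fPhi Dy t; pose T := `|t|; have T0 : 0 <= T by exact: normr_ge0.
have [D hD] := flow_bounded fPhi T `|y 0|.
have cn : continuous y.
  apply: (@continuous_rV _ _ _ y) => i s.
  exact: is_derive_continuous (Dy s i).
have [D' hD'] : exists D' : R, forall s, `|s| <= T -> `|y s| <= D'.
  have cny : continuous (fun s => `|y s|).
    by move=> s; apply: (cvg_comp y (fun v => `|v|)); [exact: cn|exact: norm_continuous].
  have [M M0 hM] := compact_norm_bound (@segment_compact R (- T) T) cny.
  exists M => s sT; have := hM s; rewrite normr_id; apply.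
  by rewrite /= in_itv/= -ler_norml.
have [L L0 hL] := field_lipschitz CB (Num.max D D').
have [C C0 hC] := @rV_gronwall R n L T L0 T0.
have := hC (fun s => y s - Phi s (y 0)) (fun s => B (y s) - B (Phi s (y 0))) 0 (lexx _).
rewrite (flow0 fPhi) subrr normr0 addr0 mulr0 => H.
apply/eqP; rewrite -subr_eq0 -normr_le0; apply: H => //.
- move=> s sT i; rewrite rVB.
  rewrite (_ : (fun _ => _) = (fun s => y s 0 i) - (fun s => Phi s (y 0) 0 i)).
    by apply: is_deriveB => //; exact: flow_derive.
  by apply/funext => u; rewrite rVB.
- move=> s sT i; rewrite rVB addr0; apply: hL; rewrite le_max.
    by rewrite hD' ?orbT.
  by rewrite hD.
Qed.

Lemma flow_add n (B : 'rV[R]_n -> 'rV[R]_n) Phi :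
  (forall k i, Ck k (fun x => B x 0 i)) -> is_flow B Phi ->
  forall s t x, Phi (s + t) x = Phi s (Phi t x).
Proof.
move=> CB fPhi s t x.
have D (r : R) i : is_derive r 1 (fun s => Phi (s + t) x 0 i) (B (Phi (r + t) x) 0 i).
  apply: (@is_derive_affine _ _ _ _ (fun s => s + t) (fun s => Phi s x 0 i) r 1 1).
    by move=> h; rewrite addrAC.
  exact: flow_derive.
by have := flow_unique (y := fun s => Phi (s + t) x) CB fPhi D s; rewrite add0r.
Qed.

(** By the group law, advancing the time [s] amounts to moving the starting point along [B] before
    flowing for time [s]. The spatial derivatives therefore fall on the composite [f (Phi s y)] and
    not on [f], which is the form of a transport equation. *)
Lemma flow_transport n (B : 'rV[R]_n -> 'rV[R]_n) Phi (f : 'rV[R]_n -> R) :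
  (forall k i, Ck k (fun x => B x 0 i)) -> is_flow B Phi -> (forall k, Ck k f) ->
  forall (s : R) y, is_derive s 1 (fun s => f (Phi s y))
    (\sum_i B y 0 i * partial i (fun y => f (Phi s y)) y).
Proof.
move=> CB fPhi Cf s y.
have [cg dg ddg] : Ck 1 (fun y => f (Phi s y)).
  apply: (Ck_comp (Cf 1%N)) => i.
  apply: (@Ck_affine _ _ _ (fun y => (s, y)) (fun v => (0, v)) _ _ _ _ (flow_Ck 1 CB fPhi i)).
    by apply: continuous_pair; [exact: cst_continuous|move=> z; exact: cvg_id].
  by move=> x v h; congr pair; rewrite /= scaler0 addr0.
have H : is_derive (0 : R) 1 ((fun y => f (Phi s y)) \o (fun r => Phi r y))
    (\sum_i B (Phi 0 y) 0 i * partial i (fun y => f (Phi s y)) (Phi 0 y)).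
  apply: (@is_derive_comp_rV _ _ _ _ _ _ _ (fun i => B (Phi 0 y) 0 i)) => [z i|i|i].
  - exact: dg.
  - exact: ddg.
  - exact: flow_derive.
rewrite (flow0 fPhi) in H.
rewrite (_ : (fun s => f (Phi s y)) =
  ((fun y => f (Phi s y)) \o (fun r => Phi r y)) \o (fun r => r - s)); last first.
  by apply/funext => r /=; rewrite -(flow_add CB fPhi) addrC subrK.
apply: (@is_derive_affine _ _ _ _ (fun r => r - s) _ s 1 1).
  by move=> h; rewrite addrAC.
by rewrite subrr.
Qed.

Lemma flow_fixed n (B : 'rV[R]_n -> 'rV[R]_n) Phi :
  (forall k i, Ck k (fun x => B x 0 i)) -> is_flow B Phi ->
  forall x, B x = 0 -> forall t, Phi t x = x.
Proof.
move=> CB fPhi x Bx t.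
have D (r : R) i : is_derive r 1 (fun=> x 0 i) (B x 0 i).
  by rewrite Bx mxE; exact: is_derive_cst.
by rewrite -(flow_unique (y := fun=> x) CB fPhi D t).
Qed.

End FlowSmooth.

(** * Transport along a gradient flow *)

Section Support.
Context (R : realType).

Lemma supp_bounded (V : normedModType R) (U : set V) (f : V -> R) : test_function U f ->
  exists2 r : R, 0 <= r & forall x, r < `|x| -> f x = 0.
Proof.
case=> _ /compact_bounded[M [_ hM]] _; exists (`|M| + 1); first by rewrite addr_ge0.
move=> x Mx; apply/eqP; apply: contraTT Mx => fx; rewrite -leNgt.
apply: (hM (`|M| + 1)); first by rewrite ltr_pwDr// ler_norm.
exact: subset_closure.
Qed.

Lemma near_norm_gt (V : normedModType R) (x : V) (r : R) : r < `|x| -> \forall y \near x, r < `|y|.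
Proof.
move=> xr; have : `|y| @[y --> x] --> `|x| by exact: norm_continuous.
by move/cvgr_gt; exact.
Qed.

Lemma derive_outside (V : normedModType R) (f : V -> R) r v :
  (forall x, r < `|x| -> f x = 0) -> forall x, r < `|x| -> 'D_v f x = 0.
Proof.
move=> H x xr; rewrite -(derive_cst (0 : R) x v); apply: near_eq_derive.
by near=> y; apply: H; near: y; exact: near_norm_gt.
Unshelve. all: by end_near. Qed.

Lemma compact_support_bound n (f : 'rV[R]_n -> R) r : continuous f ->
  (forall x, r < `|x| -> f x = 0) -> exists2 M : R, 0 <= M & forall x, `|f x| <= M.
Proof.
move=> cf H; have [M M0 hM] := rV_ball_bound r cf; exists M => // x.
by have [xr|/H->] := leP `|x| r; [exact: hM|rewrite normr0].
Qed.

Lemma compact_support_lipschitz n (f : 'rV[R]_n -> R) r : Ck 1 f ->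
  (forall x, r < `|x| -> f x = 0) ->
  exists2 L : R, 0 <= L & forall x y, `|f x - f y| <= L * `|x - y|.
Proof.
move=> [cf df ddf] H.
have [L L0 hL] : exists2 L : R, 0 <= L & forall i : 'I_n, forall x, `|partial i f x| <= L.
  apply: uniform_constant => [i C C' CC' hC x|i]; first exact: le_trans (hC x) CC'.
  apply: (@compact_support_bound _ _ r); first exact: ddf.
  exact: derive_outside.
exists (n%:R * L) => [|y x]; first by rewrite mulr_ge0.
have [|xi hxi ->] := mvt_rV x y (f := f); first by move=> z i; exact: df.
apply: (le_trans (ler_norm_sum _ _ _)).
apply: (@le_trans _ _ (\sum_(i < n) L * `|y - x|)).
  apply: ler_sum => i _; rewrite normrM mulrC; apply: ler_pM => //.
  by rewrite -rVB coord_le_norm.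
by rewrite big_const_ord iter_addr addr0 -[leLHS]mulr_natl mulrA.
Qed.

Definition laplacian n (f : 'rV[R]_n -> R) (x : 'rV[R]_n) : R :=
  \sum_i partial i (partial i f) x.

End Support.

(** * The gradient flow, augmented by the integrated Laplacian *)

Section Transport.
Context (R : realType) (d : nat) (phi : 'rV[R]_d -> R) (r : R).
Hypothesis Cphi : forall k, Ck k phi.
Hypothesis phi0 : forall x, r < `|x| -> phi x = 0.

Lemma partial_Ck k i : Ck k (partial i phi).
Proof. by have [_ _ H] := Cphi k.+1; exact: H. Qed.

Lemma partial_outside i x : r < `|x| -> partial i phi x = 0.
Proof. exact: derive_outside. Qed.

Lemma laplacian_Ck k : Ck k (laplacian phi).
Proof. by apply: Ck_sum => i; have [_ _ H] := partial_Ck k.+1 i; exact: H. Qed.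

Lemma laplacian_outside x : r < `|x| -> laplacian phi x = 0.
Proof.
move=> xr; rewrite /laplacian big1// => i _.
by apply: derive_outside xr => y; exact: partial_outside.
Qed.

(* The last coordinate of the flow integrates the Laplacian along trajectories. *)
Let B : 'rV[R]_(d + 1) -> 'rV[R]_(d + 1) := locked (fun y =>
  row_mx (grad phi (lsubmx y)) (const_mx (laplacian phi (lsubmx y)))).

Let BE y : B y = row_mx (grad phi (lsubmx y)) (const_mx (laplacian phi (lsubmx y))).
Proof. by rewrite /B -lock. Qed.

Let Bl y i : B y 0 (lshift 1 i) = partial i phi (lsubmx y).
Proof. by rewrite BE row_mxEl mxE. Qed.

Let Br y i : B y 0 (rshift d i) = laplacian phi (lsubmx y).
Proof. by rewrite BE row_mxEr mxE. Qed.

Let B_Ck k i : Ck k (fun y => B y 0 i).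
Proof.
move: i; apply: rV_split => i.
  by under eq_fun do rewrite Bl; exact: (Ck_lsubmx 1 (partial_Ck k i)).
by under eq_fun do rewrite Br; exact: (Ck_lsubmx 1 (laplacian_Ck k)).
Qed.

Let B_flow : exists Phi, is_flow B Phi.
Proof.
have [M M0 hM] : exists2 M : R, 0 <= M & forall i : 'I_(d + 1), forall y, `|B y 0 i| <= M.
  apply: uniform_constant => [i C C' CC' hC x|]; first exact: le_trans (hC x) CC'.
  apply: rV_split => i.
    have [M M0 hM] := compact_support_bound (Ck_continuous (partial_Ck 0 i)) (@partial_outside i).
    by exists M => // y; rewrite Bl.
  have [M M0 hM] := compact_support_bound (Ck_continuous (laplacian_Ck 0)) laplacian_outside.
  by exists M => // y; rewrite Br.
have [L L0 hL] : exists2 L : R, 0 <= L & forall i : 'I_(d + 1), forall x y,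
    `|B x 0 i - B y 0 i| <= L * `|x - y|.
  have sub (C : R) (x y : 'rV[R]_(d + 1)) : 0 <= C ->
      C * `|lsubmx x - lsubmx y| <= C * `|x - y|.
    move=> C0; rewrite ler_wpM2l//.
    suff -> : lsubmx x - lsubmx y = lsubmx (x - y) by exact: norm_lsubmx.
    by apply/rowP => j; rewrite !mxE.
  apply: uniform_constant => [i C C' CC' hC x y|].
    by apply: le_trans (hC x y) _; rewrite ler_wpM2r.
  apply: rV_split => i.
    have [M' M0' hM'] := compact_support_lipschitz (partial_Ck 1 i) (@partial_outside i).
    exists M' => // x y; rewrite (Bl x) (Bl y); apply: le_trans (sub M' x y M0').
    exact: (hM' (lsubmx x) (lsubmx y)).
  have [M' M0' hM'] := compact_support_lipschitz (laplacian_Ck 1) laplacian_outside.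
  exists M' => // x y; rewrite (Br x) (Br y); apply: le_trans (sub M' x y M0').
  exact: (hM' (lsubmx x) (lsubmx y)).
apply: (@bounded_lipschitz_flow _ _ _ M L).
  by move=> x; exact: norm_rV_le.
move=> x y; apply: norm_rV_le => [|i]; first by rewrite mulr_ge0.
by rewrite rVB.
Qed.

(** [flow_transport] in dimension [d + 1] for the observable [f x * expR (c * z)]. The value [c = 0]
    gives the transport of test functions, [c = 1] the evolution of densities. *)
Lemma transport_exists : exists (X : R -> 'rV[R]_d -> 'rV[R]_d) (Z : R -> 'rV[R]_d -> R),
  [/\ forall k i, Ck k (fun p : R * 'rV[R]_d => X p.1 p.2 0 i),
      forall k, Ck k (fun p : R * 'rV[R]_d => Z p.1 p.2),
      forall x, X 0 x = x /\ Z 0 x = 0,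
      forall t x, r < `|x| -> X t x = x /\ Z t x = 0
    & forall f, (forall k, Ck k f) -> forall (c s : R) x,
        is_derive s 1 (fun s => f (X s x) * expR (c * Z s x))
          (\sum_i partial i phi x *
             partial i (fun x => f (X s x) * expR (c * Z s x)) x +
           c * laplacian phi x * (f (X s x) * expR (c * Z s x)))].
Proof.
have [Phi fPhi] := B_flow.
pose E (x : 'rV[R]_d) (z : R) : 'rV[R]_(d + 1) := row_mx x (const_mx z).
pose X t x := lsubmx (Phi t (E x 0)); pose Z t x := Phi t (E x 0) 0 (rshift d 0).
(* The field ignores the last coordinate, so a solution translated in that coordinate is again a
   solution; uniqueness turns this into an identity. *)
have shift (t : R) x (z : R) : Phi t (E x z) = Phi t (E x 0) + E 0 z.
  have D (s : R) i : is_derive s 1 (fun s => (Phi s (E x 0) + E 0 z) 0 i)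
      (B (Phi s (E x 0) + E 0 z) 0 i).
    have -> : B (Phi s (E x 0) + E 0 z) = B (Phi s (E x 0)).
      rewrite !BE; have -> // : lsubmx (Phi s (E x 0) + E 0 z) = lsubmx (Phi s (E x 0)).
      by apply/rowP => j; rewrite !mxE (unsplitK (inl _ j)) mxE addr0.
    rewrite (_ : (fun _ => _) = (fun s => Phi s (E x 0) 0 i) + cst (E 0 z 0 i)).
      by rewrite -[B _ _ _]addr0; apply: is_deriveD; exact: flow_derive.
    by apply/funext => u; rewrite mxE.
  have := flow_unique B_Ck fPhi D t; rewrite (flow0 fPhi) => ->; congr (Phi t _).
  by apply/rowP; apply: rV_split => i;
    rewrite /E [RHS]mxE !(row_mxEl, row_mxEr) !mxE ?addr0 ?add0r.
have PhiE t x : Phi t (E x 0) = E (X t x) (Z t x).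
  rewrite -[LHS]hsubmxK; congr row_mx; apply/rowP => i; rewrite !mxE.
  by rewrite /Z ord1.
have cE : continuous (fun x => E x 0).
  apply: continuous_rV; apply: rV_split => i.
    rewrite (_ : (fun _ => _) = fun x : 'rV[R]_d => x 0 i); first exact: coord_continuous.
    by apply/funext => x; rewrite row_mxEl.
  rewrite (_ : (fun _ => _) = fun _ => 0); first exact: cst_continuous.
  by apply/funext => x; rewrite row_mxEr mxE.
have PhiE_Ck k j : Ck k (fun p : R * 'rV[R]_d => Phi p.1 (E p.2 0) 0 j).
  have cA : continuous (fun p : R * 'rV[R]_d => (p.1, E p.2 0)).
    apply: continuous_pair => p; first exact: cvg_fst.
    by apply: (cvg_comp snd (fun x => E x 0)); [exact: cvg_snd|exact: cE].
  have := Ck_affine (L := fun v : R * 'rV[R]_d => (v.1, E v.2 0)) cA _ (flow_Ck k B_Ck fPhi j).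
  apply => x v h; congr pair; rewrite /= /E scale_row_mx add_row_mx; congr row_mx.
  by apply/rowP => i; rewrite !mxE mulr0 addr0.
exists X, Z; split.
- by move=> k i; under eq_fun do rewrite mxE; exact: PhiE_Ck.
- by move=> k; exact: PhiE_Ck.
- move=> x; rewrite /X /Z (flow0 fPhi) row_mxKl row_mxEr mxE//.
- move=> t x xr; have E0 : Phi t (E x 0) = E x 0.
    apply: (flow_fixed B_Ck fPhi); apply/rowP; apply: rV_split => i.
      by rewrite Bl row_mxKl partial_outside// mxE.
    by rewrite Br row_mxKl laplacian_outside// mxE.
  by rewrite /X /Z E0 row_mxKl row_mxEr mxE.
move=> f Cf c s x.
pose F (y : 'rV[R]_(d + 1)) := f (lsubmx y) * expR (c * y 0 (rshift d 0)).
have CF k : Ck k F.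
  apply: CkM; first exact: Ck_lsubmx.
  apply: (Ck_comp1 (g := fun y : 'rV[R]_(d + 1) => c * y 0 (rshift d 0)) (@Ck_expR R k)).
  by apply: CkM; [exact: Ck_cst|exact: Ck_coord].
have FE t z y : F (Phi t (E y z)) = f (X t y) * expR (c * Z t y) * expR (c * z).
  rewrite shift /F mxE mulrDr expRD mulrA row_mxEr mxE; congr (f _ * _ * _).
  by apply/rowP => i; rewrite !mxE (unsplitK (inl _ i)) mxE addr0.
have := flow_transport B_Ck fPhi CF s (E x 0).
under eq_fun do rewrite FE mulr0 expR0 mulr1.
have [_ dG _] : Ck 1 (fun y => F (Phi s y)).
  apply: (Ck_comp (CF 1%N)) => i.
  apply: (@Ck_affine _ _ _ (fun y => (s, y)) (fun v => (0, v)) _ _ _ _ (flow_Ck 1 B_Ck fPhi i)).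
    by apply: continuous_pair; [exact: cst_continuous|move=> z; exact: cvg_id].
  by move=> y v h; congr pair; rewrite /= scaler0 addr0.
move=> D; apply: (is_derive_eq D).
rewrite big_split_ord.
rewrite [X in _ + X = _]big_ord1.
apply: (f_equal2 +%R).
- apply: eq_bigr => i _; rewrite Bl row_mxKl; congr (_ * _).
  have := @is_derive_affine _ _ _ _ (fun y => E y 0) (fun y => F (Phi s y)) x (delta_mx 0 i)
    (delta_mx 0 (lshift 1 i)) _ _ (derivableP (dG (E x 0) _)).
  rewrite -/(partial (lshift 1 i) (fun y => F (Phi s y)) (E x 0)).
  case=> [h|_ <-].
    apply/rowP; apply: rV_split => j; rewrite /E !mxE; last first.
      by rewrite !(unsplitK (inr _ j)) !mxE eq_shift andbF mulr0 addr0.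
    by rewrite !(unsplitK (inl _ j)) !mxE eq_shift.
  rewrite /partial; congr ('D_ _ _ x); by apply/funext => y.
(* By [shift] the last coordinate of the starting point enters only through the factor
   [expR (c * z)], whose derivative at [z = 0] is [c]; this produces the Laplacian term. *)
- pose K := f (X s x) * expR (c * Z s x).
  suff P : 'D_(delta_mx 0 (rshift d 0)) (fun y => F (Phi s y)) (E x 0) = c * K.
    by rewrite Br row_mxKl [partial _ _ _]P mulrCA mulrA.
  have D1 : is_derive (0 : R) 1 (fun h => F (Phi s (E x 0 + h *: delta_mx 0 (rshift d 0))))
     ('D_(delta_mx 0 (rshift d 0)) (fun y => F (Phi s y)) (E x 0)).
    apply: (@is_derive_line _ _ _ (fun y => F (Phi s y)) (E x 0) (delta_mx 0 (rshift d 0)) 0).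
    rewrite scale0r addr0; exact: derivableP (dG _ _).
  have D2 : is_derive (0 : R) 1 (fun h => K * expR (c * h)) (c * K).
    have e : is_derive (0 : R) 1 (fun h => expR (c * h)) (c * expR (c * 0)).
      have := @is_derive_affine _ _ _ _ (fun h => c * h) expR (0 : R) 1 c (c * expR (c * 0)).
      apply; first by move=> h; rewrite mulrDr [h%:A]mulr1; congr (_ + _); rewrite mulrC.
      exact: is_derive1_dir.
    by apply: (is_derive_eq (is_deriveZ K e)); rewrite mulr0 expR0 mulr1 mulrC.
  have EF : (fun h => F (Phi s (E x 0 + h *: delta_mx 0 (rshift d 0)))) =
      (fun h => K * expR (c * h)).
    apply/funext => h; rewrite -FE.
    have -> // : E x 0 + h *: delta_mx 0 (rshift d 0) = E x h.
    apply/rowP; apply: rV_split => j; rewrite /E !mxE.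
      by rewrite !(unsplitK (inl _ j)) eq_shift mulr0 addr0.
    by rewrite !(unsplitK (inr _ j)) !mxE ord1 !eqxx mulr1 add0r.
  rewrite EF in D1.
  have e1 := @derive_val _ _ _ _ _ _ _ D1.
  have e2 := @derive_val _ _ _ _ _ _ _ D2.
  exact: etrans (esym e1) e2.
Qed.

End Transport.

(** * Lebesgue measure and densities *)

Section Integration.
Context (R : realType).

Lemma continuous_measurable_rV d (f : 'rV[R]_d -> R) :
  continuous f -> measurable_fun setT f.
Proof.
move=> cf; apply: (measurability _ (RGenOpens.measurableE R)) => _ [_ [a [b ->]] <-].
rewrite setTI; apply: open_measurable_rv.
by apply: open_comp; [move=> x _; exact: cf|exact: interval_open].
Qed.

Lemma measurable_rV_ball d (r : R) : measurable [set x : 'rV[R]_d | `|x| <= r].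
Proof.
have -> : [set x : 'rV[R]_d | `|x| <= r] = ~` [set x | r < `|x|].
  by apply/seteqP; split=> x /=; rewrite leNgt => /negP.
apply: measurableC; apply: open_measurable_rv.
rewrite (_ : [set _ | _] = (fun x : 'rV[R]_d => `|x|) @^-1` [set y | r < y])//.
by apply: open_comp; [move=> x _; exact: norm_continuous|exact: open_gt].
Qed.

Lemma lebesgue_rV_ball d (r : R) :
  (lebesgue_rv R d [set x : 'rV[R]_d | (`|x| <= r)%R] < +oo)%E.
Proof.
have mB : measurable [set v : 'rV[R]_d | forall i, `[- r, r]%classic (v 0 i)].
  rewrite [X in measurable X](_ : _ =
      \bigcap_i ((fun v : 'rV[R]_d => v 0 i) @^-1` `[- r, r]%classic)).
    apply: fin_bigcap_measurable => // i _; rewrite -[X in measurable X]setTI.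
    exact: measurable_coord.
  by apply/seteqP; split=> [x h i _|x h i]; exact: h.
apply: (@le_lt_trans _ _
    (lebesgue_rv R d [set v : 'rV[R]_d | forall i, `[- r, r]%classic (v 0 i)])).
  apply: le_measure; rewrite ?inE//; first exact: measurable_rV_ball.
  move=> x /= xr i; rewrite in_itv/= -ler_norml.
  exact: le_trans (coord_le_norm _ _) xr.
rewrite (lebesgue_rv_box (A := fun=> `[- r, r]%classic))//.
rewrite (_ : (\prod_(i < d) _)%E = (\prod_(i < d) fine (lebesgue_measure `[- r, r]%classic))%:E).
  exact: ltry.
rewrite -prodEFin; apply: eq_bigr => i _; rewrite fineK//.
by rewrite lebesgue_measure_itv/=; case: ifPn.
Qed.

Lemma integrable_compact_support d (mu : {measure set 'rV[R]_d -> \bar R})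
    (f : 'rV[R]_d -> R) r :
  (mu [set x : 'rV[R]_d | (`|x| <= r)%R] < +oo)%E -> continuous f ->
  (forall x, r < `|x| -> f x = 0) -> mu.-integrable setT (EFin \o f).
Proof.
move=> fin cf f0; have mb := @measurable_rV_ball d r.
have -> : EFin \o f = (EFin \o f) \_ [set x : 'rV[R]_d | `|x| <= r].
  apply/funext => x; rewrite patchE; case: ifPn => //.
  by rewrite notin_setE /= => /negP; rewrite -ltNge => /f0 ->.
apply/(integrable_mkcond _ mb); apply: measurable_bounded_integrable => //.
  apply: measurable_funTS; exact: continuous_measurable_rV.
have [M M0 hM] := rV_ball_bound r cf.
exists M; split; first exact: num_real.
by move=> N MN x /= xr; rewrite (le_trans (hM _ xr))// ltW.
Qed.

Lemma integral_derive1_0 (f g : R -> R) (r : R) : continuous g ->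
  (forall x : R, is_derive x 1 f (g x)) -> (forall x, r < `|x| -> f x = 0) ->
  (\int[lebesgue_measure]_x (g x)%:E = 0)%E.
Proof.
(* [r] may be negative; [s] gives a nondegenerate interval at whose endpoints [f] vanishes. *)
move=> cg Df f0; pose s : R := `|r| + 1.
have s0 : 0 < s by rewrite ltr_wpDl.
have fs x : s <= `|x| -> f x = 0.
  by move=> sx; apply: f0; apply: lt_le_trans sx; rewrite ltr_pwDr// ler_norm.
have g0 x : s < `|x| -> g x = 0.
  move=> sx; have [_ <-] := Df x; apply: derive_outside sx => y ys.
  by apply: fs; exact: ltW.
have cf : continuous f by move=> x; exact: is_derive_continuous (Df x).
have -> : (\int[lebesgue_measure]_x (g x)%:E =
    \int[lebesgue_measure]_(x in `[(- s)%R, s]) (g x)%:E)%E.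
  rewrite [RHS]integral_mkcond; apply: eq_integral => x _; rewrite patchE.
  case: ifPn => //; rewrite notin_setE /= in_itv/= -ler_norml => /negP.
  by rewrite -ltNge => /g0->.
have NS : - s < s by rewrite gtrN.
rewrite (@continuous_FTC2 R g f (- s) s NS).
- by rewrite (fs s) ?ler_norm// (fs (- s)) ?normrN ?ler_norm// sube0.
- exact: continuous_subspaceT.
- split; first by move=> x _; have [] := Df x.
    exact: (cvg_at_right_filter (cf _)).
  exact: (cvg_at_left_filter (cf _)).
- by move=> x _; rewrite derive1E; have [_ ->] := Df x.
Qed.

Lemma cons_rv_continuous d : continuous (fun p : R * 'rV[R]_d => cons_rv p).
Proof.
apply: continuous_rV => i.
rewrite (_ : (fun p => _) = fun p : R * 'rV[R]_d =>
    if unlift ord0 i is Some j then p.2 0 j else p.1); last first.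
  by apply/funext => p; rewrite mxE.
case: (unlift ord0 i) => [j|] p; last exact: cvg_fst.
apply: (cvg_comp snd (fun v : 'rV[R]_d => v 0 j)); first exact: cvg_snd.
exact: coord_continuous.
Qed.

(** Fubini on R * R^d, integrating first over the factor that contains the direction [i]: the inner
    integral vanishes by the fundamental theorem for the head coordinate, and by induction on the
    dimension for the others. *)
Lemma integral_partial_0 d (f g : 'rV[R]_d -> R) (i : 'I_d) (r : R) : continuous g ->
  (forall x, is_derive x (delta_mx 0 i) f (g x)) -> (forall x, r < `|x| -> f x = 0) ->
  (\int[lebesgue_rv R d]_x (g x)%:E = 0)%E.
Proof.
elim: d f g i => [|d IH] f g i; first by case: i.
move=> cg Df f0.
have g0 x : r < `|x| -> g x = 0.
  by move=> rx; have [_ <-] := Df x; exact: derive_outside rx.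
have ig := integrable_compact_support (lebesgue_rV_ball d.+1 r) cg g0.
have mg : measurable_fun (setT : set 'rV[R]_d.+1) (EFin \o g).
  apply/measurable_EFinP; exact: continuous_measurable_rV.
have mc := @measurable_cons_rv R d.
pose prodm : {measure set (measurableTypeR R * 'rV[R]_d)%type -> \bar R} :=
  (@lebesgue_measure R \x lebesgue_rv R d)%E.
have igc : prodm.-integrable setT
    ((EFin \o g) \o @cons_rv R d).
  apply/integrableP; split; first exact: measurableT_comp.
  have /integrableP[_] := ig; apply: le_lt_trans.
  have mag : measurable_fun (setT : set 'rV[R]_d.+1) (abse \o (EFin \o g)).
    exact: measurableT_comp.
  have E := @ge0_integral_pushforward _ _ (measurableTypeR R * 'rV[R]_d)%type _ _ _ mc prodm
    setT (abse \o (EFin \o g)) measurableT mag (fun y _ => abse_ge0 _).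
  by rewrite preimage_setT in E; rewrite -[leLHS]E.
have E := @integral_pushforward _ _ (measurableTypeR R * 'rV[R]_d)%type _ _ _ mc prodm
    setT (EFin \o g) mg igc measurableT.
rewrite preimage_setT in E; apply: (etrans E) => {E}.
have norm_tail x (v : 'rV[R]_d) : `|v| <= `|cons_rv (x, v)|.
  apply: norm_rV_le => // j; have := coord_le_norm (cons_rv (x, v)) (lift ord0 j).
  by rewrite mxE liftK.
have norm_head x (v : 'rV[R]_d) : `|x| <= `|cons_rv (x, v)|.
  by have := coord_le_norm (cons_rv (x, v)) ord0; rewrite mxE unlift_none.
have cc1 x : continuous (fun v : 'rV[R]_d => g (cons_rv (x, v))).
  move=> v; apply: (cvg_comp (fun v => cons_rv (x, v)) g); last exact: cg.
  apply: (cvg_comp (fun v => (x, v)) (@cons_rv R d)); last exact: cons_rv_continuous.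
  by apply: (@continuous_pair _ _ _ (fun=> x) id);
    [exact: cst_continuous|move=> y; exact: cvg_id].
have cc2 v : continuous (fun x => g (cons_rv (x, v))).
  move=> x; apply: (cvg_comp (fun x => cons_rv (x, v)) g); last exact: cg.
  apply: (cvg_comp (fun x => (x, v)) (@cons_rv R d)); last exact: cons_rv_continuous.
  by apply: (@continuous_pair _ _ _ id (fun=> v));
    [move=> y; exact: cvg_id|exact: cst_continuous].
case: (unliftP ord0 i) => [j|] iE.
- rewrite -(integral12_prod_meas1 igc); apply: integral0_eq => x _ /=.
  apply: (IH (fun v => f (cons_rv (x, v))) (fun v => g (cons_rv (x, v))) j); first exact: cc1.
    move=> v; apply: (@is_derive_affine _ _ _ _ (fun v => cons_rv (x, v)) f v _ (delta_mx 0 i)).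
      move=> h; apply/rowP => k; rewrite !mxE eqxx/=.
      case: unliftP => [k'|] ->; first by rewrite !mxE eqxx iE (inj_eq lift_inj).
      by rewrite iE (negbTE (neq_lift _ _)) mulr0 addr0.
  by move=> v rv; apply: f0; exact: lt_le_trans (norm_tail x v).
- rewrite -(integral21_prod_meas1 igc); apply: integral0_eq => v _ /=.
  apply: (@integral_derive1_0 (fun x => f (cons_rv (x, v))) _ r); first exact: cc2.
    move=> x; apply: (@is_derive_affine _ _ _ _ (fun x => cons_rv (x, v)) f x _ (delta_mx 0 i)).
      move=> h; apply/rowP => k; rewrite !mxE eqxx/=.
      case: unliftP => [k'|] ->; last by rewrite iE eqxx.
      by rewrite iE eq_sym (negbTE (neq_lift _ _)) mulr0 addr0.
  by move=> x rx; apply: f0; exact: lt_le_trans (norm_head x v).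
Qed.

End Integration.

Section AlmostEverywhere.
Context (R : realType) (d : nat).

Lemma measurable_rV_box (A : 'I_d -> set R) : (forall i, measurable (A i)) ->
  measurable [set v : 'rV[R]_d | forall i, A i (v 0 i)].
Proof.
move=> mA; rewrite [X in measurable X](_ : _ =
    \bigcap_i ((fun v : 'rV[R]_d => v 0 i) @^-1` (A i))).
  apply: fin_bigcap_measurable => // i _; rewrite -[X in measurable X]setTI.
  exact: measurable_coord.
by apply/seteqP; split=> [x h i _|x h i]; exact: h.
Qed.

(** A negative value persists on a box around the point; by [lebesgue_rv_box] the box has positive
    measure, so no null set contains it. *)
Lemma continuous_ae_ge0 (f : 'rV[R]_d -> R) : continuous f ->
  {ae lebesgue_rv R d, forall x, 0 <= f x} -> forall x, 0 <= f x.
Proof.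
move=> cf [A [mA A0 fA]] x; rewrite leNgt; apply/negP => fx.
have /nbhs_normP[e /= e0 he] : \forall y \near x, f y < 0.
  by move: (cf x) => /cvgr_lt; exact.
pose I i := `](x 0 i - e / 2), (x 0 i + e / 2)[%classic.
have mI i : measurable (I i) by exact: measurable_itv.
pose box : set 'rV[R]_d := [set v | forall i, I i (v 0 i)].
have BA : box `<=` A.
  move=> v /= vI; apply: fA => /=; apply/negP; rewrite -ltNge; apply: he => /=.
  apply: (@le_lt_trans _ _ (e / 2)); last by rewrite ltr_pdivrMr// mulr_natr mulr2n ltrDl.
  apply: norm_rV_le => [|i]; first by rewrite divr_ge0// ltW.
  have := vI i; rewrite /I /= in_itv/= rVB => /andP[h1 h2].
  by rewrite ler_norml; apply/andP; split; lra.
have : (lebesgue_rv R d box <= lebesgue_rv R d A)%E.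
  by apply: le_measure; rewrite ?inE//; exact: measurable_rV_box.
rewrite A0 lebesgue_rv_box// leNgt => /negP; apply.
rewrite (_ : (\prod_(i < d) _)%E = (\prod_(i < d) e)%:E).
  by rewrite lte_fin; apply: prodr_gt0.
rewrite -prodEFin; apply: eq_bigr => i _.
rewrite /I lebesgue_measure_itv/= lte_fin ifT; last by lra.
by congr EFin; lra.
Qed.

Lemma continuous_ae_eq (f g : 'rV[R]_d -> R) : continuous f -> continuous g ->
  f = g %[ae lebesgue_rv R d] -> f = g.
Proof.
move=> cf cg fg; apply/funext => x.
have cd (u v : 'rV[R]_d -> R) : continuous u -> continuous v -> continuous (u - v).
  by move=> cu cv y; apply: continuousB; [exact: cu|exact: cv].
apply/eqP; rewrite eq_le; apply/andP; split; rewrite -subr_ge0.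
  apply: (continuous_ae_ge0 (cd _ _ cg cf)).
  by apply: filterS fg => y; rewrite !fctE => /(_ I) ->; rewrite subrr.
apply: (continuous_ae_ge0 (cd _ _ cf cg)).
by apply: filterS fg => y; rewrite !fctE => /(_ I) ->; rewrite subrr.
Qed.

End AlmostEverywhere.

Section Density.
Context {dT} {T : measurableType dT} {R : realType}.
Import HBNNSimple.

(** Makes a density into a measure, so that the candidate density can be compared with [mu t] by
    [measure_eq_of_test]. *)
Lemma density_measure (mu : {measure set T -> \bar R}) (r : T -> R) :
  measurable_fun setT r -> (forall x, 0 <= r x) ->
  exists m : {measure set T -> \bar R},
    forall A, m A = (\int[mu]_(x in A) (r x)%:E)%E.
Proof.
move=> mr r0; pose m (A : set T) := (\int[mu]_(x in A) (r x)%:E)%E.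
have m0 : m set0 = 0%E by rewrite /m integral_set0.
have mge A : (0 <= m A)%E by apply: integral_ge0 => x _; rewrite lee_fin.
have ms : semi_sigma_additive m.
  move=> /= F mF tF mUF; rewrite /m ge0_integral_bigcup//.
  - apply: is_cvg_ereal_nneg_natsum_cond => n _ _.
    by apply: integral_ge0 => x _; rewrite lee_fin.
  - by apply/measurable_EFinP; exact: measurable_funTS.
  - by move=> x _; rewrite lee_fin.
pose M := isMeasure.Build _ _ _ m m0 mge ms.
pose mm : {measure set T -> \bar R} := HB.pack m M.
by exists mm.
Qed.

Lemma density_integral (mu m : {measure set T -> \bar R}) (r : T -> R) :
  measurable_fun setT r -> (forall x, 0 <= r x) ->
  (forall A, measurable A -> m A = \int[mu]_(x in A) (r x)%:E)%E ->
  forall f : T -> \bar R, measurable_fun setT f -> (forall x, 0 <= f x)%E ->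
    (\int[m]_x f x = \int[mu]_x (f x * (r x)%:E))%E.
Proof.
move=> mr r0 hm.
have indic (E : set T) : measurable E ->
    (\int[m]_x (\1_E x)%:E = \int[mu]_x ((\1_E x)%:E * (r x)%:E))%E.
  move=> mE; rewrite integral_indic// setIT hm// integral_mkcond.
  apply: eq_integral => x _; rewrite patchE indicE.
  by case: ifPn => xE; rewrite ?mul1e ?mul0e.
have nns (f : {nnsfun T >-> R}) :
    (\int[m]_x (f x)%:E = \int[mu]_x ((f x)%:E * (r x)%:E))%E.
  under [LHS]eq_integral do rewrite fimfunE -fsumEFin//.
  rewrite [LHS]ge0_integral_fsum//; last 2 first.
    - by move=> y; apply/measurable_EFinP; exact: measurable_funM.
    - by move=> n x _; rewrite EFinM nnfun_muleindic_ge0.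
  under [RHS]eq_integral.
    move=> x xD; rewrite fimfunE -fsumEFin// muleC ge0_mule_fsumr; last first.
      by move=> y; rewrite EFinM nnfun_muleindic_ge0.
    over.
  rewrite [RHS]ge0_integral_fsum//; last 2 first.
    - move=> y; apply/measurable_EFinP; apply: measurable_funM => //.
      exact: measurable_funM.
    - move=> n x _; apply: mule_ge0; first by rewrite lee_fin.
      by rewrite EFinM nnfun_muleindic_ge0.
  apply: eq_fsbigr => y yf; rewrite inE in yf.
  have y0 : 0 <= y by case: yf => x _ <-.
  under [LHS]eq_integral do rewrite EFinM.
  rewrite ge0_integralZl//; last by apply/measurable_EFinP.
  rewrite indic// -ge0_integralZl//.
  - by apply: eq_integral => x _; rewrite EFinM [RHS]muleC muleA.
  - by apply/measurable_EFinP; exact: measurable_funM.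
  - by move=> x _; rewrite mule_ge0// lee_fin.
move=> f mf f0; pose f_ := nnsfun_approx measurableT mf.
transitivity (limn (fun n => \int[m]_x (f_ n x)%:E)%E).
  rewrite -monotone_convergence//=.
  - apply: eq_integral => ? /[!inE] xD; apply/esym/cvg_lim => //=.
    exact: cvg_nnsfun_approx.
  - by move=> n; exact/measurable_EFinP/measurable_funTS.
  - by move=> n ? _; rewrite lee_fin.
  - by move=> ? _ ? ? mn; rewrite lee_fin; exact/lefP/nd_nnsfun_approx.
under eq_fun do rewrite nns.
rewrite -monotone_convergence//=.
- apply: eq_integral => x _; apply/cvg_lim => //.
  rewrite muleC; under eq_fun do rewrite muleC.
  apply: cvgeZl => //; exact: cvg_nnsfun_approx.
- by move=> n; apply/measurable_EFinP; apply: measurable_funM.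
- by move=> n x _; rewrite mule_ge0// lee_fin.
- move=> x _ a b ab; apply: lee_wpmul2r; first by rewrite lee_fin.
  by rewrite lee_fin; exact/lefP/nd_nnsfun_approx.
Qed.

End Density.

(** * Measures determined by smooth test functions *)

Section Bump.
Context (R : realType).

(* The powers make the family stable under differentiation. *)
Definition flat (k : nat) (x : R) : R := if 0 < x then x ^- k * expR (- x^-1) else 0.

(** Raises [y / (n + 1) <= expR (y / (n + 1))] to the power [n + 1]. With [y = 1 / x] it makes
    [flat] smaller than any power of [x] near 0. *)
Lemma exprn_le_expR (y : R) n : 0 <= y -> y ^+ n.+1 <= n.+1%:R ^+ n.+1 * expR y.
Proof.
move=> y0; have n0 : 0 < n.+1%:R :> R by rewrite ltr0Sn.
have -> : expR y = expR (y / n.+1%:R) ^+ n.+1.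
  by rewrite -expRM_natl mulrC divfK// gt_eqF.
rewrite -exprMn lerXn2r ?nnegrE// ?mulr_ge0 ?expR_ge0 ?(ltW n0)//.
rewrite mulrC -ler_pdivrMr// (le_trans _ (expR_ge1Dx _))// lerDr//.
Qed.

Lemma flat_derive k (x : R) :
  is_derive x 1 (flat k) (flat k.+2 x - k%:R * flat k.+1 x).
Proof.
have [x0|x0|->] := ltgtP x 0.
- rewrite /flat ltNge ltW//= mulr0 subrr.
  apply: (near_eq_is_derive (f := cst 0)).
  near=> y; rewrite /flat ltNge ifN// negbK.
  by rewrite ltW//; near: y; exact: (lt_nbhsl x0).
- apply: (near_eq_is_derive (f := fun y : R => y ^- k * expR (- y^-1))).
    by near=> y; rewrite /flat ifT//; near: y; exact: (lt_nbhsr x0).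
  have xn : x != 0 by rewrite gt_eqF.
  have D1 : is_derive x 1 (fun y : R => y^-1) (- x ^- 2).
    split; first exact: derivableV.
    by rewrite deriveV// derive_id scaleNr /GRing.scale/= mulr1.
  have D2 : is_derive x 1 (fun y : R => y ^- k) (- (k%:R * x ^- k.+1)).
    have := is_deriveX k D1; rewrite (_ : (fun y : R => y^-1) ^+ k = (fun y => y ^- k)).
      move=> /is_derive_eq; apply; rewrite /GRing.scale/= mulrN; congr (- _).
      case: k => [|k]; first by rewrite !mul0r.
      by rewrite -mulrA; congr (_ * _); rewrite -!exprVn /= -exprD addn2.
    by apply/funext => y; rewrite fctE exprVn.
  have D3 : is_derive x 1 (fun y : R => expR (- y^-1)) (x ^- 2 * expR (- x^-1)).
    have DN : is_derive x 1 (fun y : R => - y^-1) (x ^- 2).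
      by rewrite -[x ^- 2]opprK; exact: is_deriveN.
    split.
      apply/derivable1_diffP; apply: (@differentiable_comp _ _ _ _ (fun y : R => - y^-1) expR).
        by apply/derivable1_diffP; case: DN.
      exact/derivable1_diffP.
    rewrite -derive1E (@derive1_comp _ (fun y : R => - y^-1) expR).
    + by rewrite !derive1E (@derive_val _ _ _ _ _ _ _ DN) derive_val mulrC.
    + by case: DN.
    + by [].
  apply: (is_derive_eq (is_deriveM D2 D3)).
  rewrite /flat x0 /GRing.scale/= -!exprVn !exprS; ring.
- rewrite /flat ltxx mulr0 subrr.
  (* At 0 the rate requires [h ^- (k + 1) * expR (- h^-1) <= C * h] for [h > 0], that is
     [y ^ (k + 2) <= C * expR y] with [y = h^-1]; this fixes the constant. *)
  apply: (@is_derive_of_rate _ _ _ _ _ _ (k.+2%:R ^+ k.+2)) => h h0 _.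
  rewrite [h%:A]mulr1 add0r /flat ltxx !subr0; case: ifPn => [hp|_]; last first.
    by rewrite mulr0 normr0 mulr_ge0// exprn_ge0.
  have hi : 0 <= h^-1 by rewrite invr_ge0 ltW.
  rewrite ger0_norm; last by rewrite !mulr_ge0 ?expR_ge0 ?invr_ge0 ?exprn_ge0 ?(ltW hp).
  rewrite (gtr0_norm hp) expRN mulrA ler_pdivrMr ?expR_gt0// mulrAC.
  rewrite -ler_pdivrMr// mulrC -exprVn -!exprS.
  exact: exprn_le_expR.
Unshelve. all: by end_near. Qed.

Lemma flat_Ck n k : Ck n (flat k).
Proof.
elim: n k => [|n IH] k.
  by move=> x; apply: is_derive_continuous (flat_derive k x).
apply: (Ck_R (fun x => flat_derive k x)).
by apply: CkB => //; apply: CkM => //; exact: Ck_cst.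
Qed.

Lemma flat0_gt0 (x : R) : (0 < flat 0 x) = (0 < x).
Proof.
by rewrite /flat; case: ifPn => // h; rewrite ?ltxx// expr0 invr1 mul1r expR_gt0.
Qed.

Lemma flat0_ge0 (x : R) : 0 <= flat 0 x.
Proof. by rewrite /flat; case: ifPn => // h; rewrite expr0 invr1 mul1r expR_ge0. Qed.

Definition bump (a b x : R) : R := flat 0 (x - a) * flat 0 (b - x).

Lemma bump_ge0 a b x : 0 <= bump a b x.
Proof. by rewrite mulr_ge0// flat0_ge0. Qed.

Lemma bump_gt0 a b x : (0 < bump a b x) = (a < x < b).
Proof.
rewrite /bump -(subr_gt0 a) -(subr_gt0 x b).
rewrite -(flat0_gt0 (x - a)) -(flat0_gt0 (b - x)).
have := flat0_ge0 (x - a); rewrite le_eqVlt => /predU1P[<-|h1].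
  by rewrite mul0r ltxx.
by rewrite pmulr_rgt0// h1.
Qed.

Lemma bump_Ck n a b : Ck n (bump a b).
Proof.
apply: CkM.
  apply: (Ck_comp1 (g := fun x => x - a) (flat_Ck n 0)).
  by apply: CkB; [exact: Ck_id|exact: Ck_cst].
apply: (Ck_comp1 (g := fun x => b - x) (flat_Ck n 0)).
by apply: CkB; [exact: Ck_cst|exact: Ck_id].
Qed.

(** [S] is the antiderivative of a bump on []0, e[]. Its final value [c] is left unnormalised: being
    positive, by the mean value theorem on [[e / 3, e / 2]], it can be divided out. *)
Lemma smooth_step (e : R) : 0 < e -> exists S s : R -> R,
  [/\ forall k, Ck k S /\ Ck k s, forall x : R, is_derive x 1 S (s x),
      forall x, 0 <= s x /\ (~~ (0 < x < e) -> s x = 0), forall x, x <= 0 -> S x = 0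
    & exists2 c, 0 < c & forall x, e <= x -> S x = c].
Proof.
move=> e0; pose s := bump 0 e.
have [S S0 DS] := antiderivative (Ck_continuous (bump_Ck 0 0 e)).
have s0 x : ~~ (0 < x < e) -> s x = 0.
  by rewrite -bump_gt0 -leNgt => h; apply/eqP; rewrite eq_le h bump_ge0.
have const a b : a <= b -> (forall x, a <= x <= b -> s x = 0) -> S b = S a.
  move=> ab z; have [c cab] := mvt_R ab (fun x _ => DS x).
  by rewrite -/s z// mul0r => /eqP; rewrite subr_eq0 => /eqP.
exists S, s; split => // [k|x|x x0|].
- split; last exact: bump_Ck.
  by apply: CkW; exact: (Ck_R DS (bump_Ck k 0 e)).
- by split; [exact: bump_ge0|exact: s0].
- rewrite -S0; apply/esym; apply: const => // y /andP[_ y0].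
  by apply: s0; rewrite ltNge y0.
- exists (S e) => [|x ex]; last first.
    by apply: const => // y /andP[ey _]; apply: s0; rewrite [y < e]ltNge ey andbF.
  have mono a b : a <= b -> S a <= S b.
    move=> ab; have [c cab] := mvt_R ab (fun x _ => DS x).
    by move=> E; rewrite -subr_ge0 E mulr_ge0 ?bump_ge0// subr_ge0.
  have h1 : 0 < e / 3 by rewrite divr_gt0.
  have h2 : e / 3 <= e / 2 by lra.
  have [c /andP[c1 c2]] := mvt_R h2 (fun x _ => DS x).
  move=> E; have : 0 < S (e / 2) - S (e / 3).
    by rewrite E mulr_gt0// ?bump_gt0; lra.
  have := mono 0 (e / 3) (ltW h1); have := mono (e / 2) e.
  rewrite S0; lra.
Qed.

End Bump.

Section TestFunctions.
Context (R : realType) (d : nat).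

Definition bounded_box (a b : 'I_d -> R) : set 'rV[R]_d :=
  [set v | forall i, a i < v 0 i < b i].

Lemma measurable_bounded_box a b : measurable (bounded_box a b).
Proof.
have -> : bounded_box a b = [set v : 'rV[R]_d | forall i, `](a i), (b i)[%classic (v 0 i)].
  by apply/seteqP; split => v h i; have := h i; rewrite /= in_itv.
by apply: (measurable_rV_box (A := fun i => `](a i), (b i)[%classic)) => i.
Qed.

Definition boxes : set (set 'rV[R]_d) := [set A | exists a b, A = bounded_box a b].

Lemma boxesI : setI_closed boxes.
Proof.
move=> _ _ [a [b ->]] [a' [b' ->]].
exists (fun i => Num.max (a i) (a' i)), (fun i => Num.min (b i) (b' i)).
apply/seteqP; split => v /=.
  by move=> [h h'] i; rewrite gt_max lt_min; move: (h i) (h' i) => /andP[-> ->] /andP[-> ->].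
move=> h; split => i; have := h i; rewrite gt_max lt_min.
  by move=> /andP[/andP[-> _] /andP[-> _]].
by move=> /andP[/andP[_ ->] /andP[_ ->]].
Qed.

Lemma boxes_cover : \bigcup_(n : nat) bounded_box (fun=> - n%:R) (fun=> n%:R) = setT.
Proof.
apply/seteqP; split => // v _; exists (Num.truncn `|v|).+1 => // i.
by rewrite -ltr_norml (le_lt_trans (coord_le_norm _ _))// truncnS_gt.
Qed.

(** For the nontrivial inclusion, the identity from the sigma-algebra of boxes to the Borel one is
    measurable because its coordinates are: the preimage of an interval is a countable union of
    boxes. *)
Lemma boxes_generate : @measurable _ 'rV[R]_d = <<s boxes >>.
Proof.
apply/seteqP; split => [A mA|]; last first.
  apply: smallest_sub; first exact: sigma_algebra_measurable.
  by move=> _ [a [b ->]]; exact: measurable_bounded_box.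
pose U := g_sigma_algebraType boxes.
have mid : measurable_fun setT (id : U -> 'rV[R]_d).
  apply: measurable_fun_rv => i.
  apply: (measurability _ (RGenOpens.measurableE R)) => _ [_ [p [q ->]] <-].
  rewrite setTI (_ : _ @^-1` _ = \bigcup_(n : nat)
    bounded_box (fun j => if j == i then p else - n%:R)
                (fun j => if j == i then q else n%:R)).
    apply: bigcupT_measurable => n; apply: sub_sigma_algebra.
    by eexists; eexists.
  apply/seteqP; split => v /=.
    rewrite in_itv/= => pq.
    have : (\bigcup_(n : nat) bounded_box (fun=> - n%:R) (fun=> n%:R)) v by rewrite boxes_cover.
    by move=> [n _ hn]; exists n => // j; case: eqP => [->//|_]; exact: hn.
  by move=> [n _ /(_ i)]; rewrite eqxx in_itv.
by have := mid measurableT A mA; rewrite setTI preimage_id.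
Qed.

(** Smooth approximations from below of the indicator of a box: the product of bumps is positive
    exactly in the box, so these functions increase to 1 there and vanish elsewhere. *)
Definition box_test (a b : 'I_d -> R) (n : nat) (v : 'rV[R]_d) : R :=
  1 - expR (- n%:R * \prod_i bump (a i) (b i) (v 0 i)).

Lemma box_test_Ck k a b n : Ck k (box_test a b n).
Proof.
apply: CkB; first exact: Ck_cst.
apply: (Ck_comp1 (g := fun v : 'rV[R]_d => - n%:R * \prod_i bump (a i) (b i) (v 0 i))).
  exact: Ck_expR.
apply: CkM; first exact: Ck_cst.
apply: Ck_prod => i.
by apply: (Ck_comp1 (g := fun v : 'rV[R]_d => v 0 i)); [exact: bump_Ck|exact: Ck_coord].
Qed.

Let prod_ge0 a b (v : 'rV[R]_d) : 0 <= \prod_i bump (a i) (b i) (v 0 i).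
Proof. by apply: prodr_ge0 => i _; exact: bump_ge0. Qed.

Let box_prod_gt0 a b v : bounded_box a b v -> 0 < \prod_i bump (a i) (b i) (v 0 i).
Proof. by move=> h; apply: prodr_gt0 => i _; rewrite bump_gt0; exact: h. Qed.

Let box_prod0 a b v : ~ bounded_box a b v -> \prod_i bump (a i) (b i) (v 0 i) = 0.
Proof.
move=> /existsNP[i hi]; apply/eqP; rewrite prodf_seq_eq0; apply/hasP; exists i.
  by rewrite mem_index_enum.
by rewrite /= eq_le bump_ge0 andbT leNgt bump_gt0; apply/negP.
Qed.

Lemma box_test_ge0 a b n v : 0 <= box_test a b n v.
Proof.
by rewrite subr_ge0 -[leRHS]expR0 ler_expR mulNr oppr_le0 mulr_ge0// prod_ge0.
Qed.

Lemma box_test_outside a b n v : ~ bounded_box a b v -> box_test a b n v = 0.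
Proof. by move=> /box_prod0 h; rewrite /box_test h mulr0 expR0 subrr. Qed.

Lemma box_test_support a b n : exists r : R, forall v, r < `|v| -> box_test a b n v = 0.
Proof.
exists (\sum_i (`|a i| + `|b i|)) => v rv; apply: box_test_outside => vab.
move: rv; rewrite ltNge => /negP; apply; apply: norm_rV_le.
  by apply: sumr_ge0 => i _; rewrite addr_ge0.
move=> i; rewrite (bigD1 i)//= -[leLHS]addr0; apply: lerD; last first.
  by apply: sumr_ge0 => j _; rewrite addr_ge0.
have /andP[h1 h2] := vab i; rewrite ler_norml.
have := ler_norm (- a i); have := ler_norm (b i); rewrite normrN.
have := normr_ge0 (a i); have := normr_ge0 (b i).
by move=> *; apply/andP; split; lra.
Qed.

Lemma box_test_mono a b v m n : (m <= n)%N -> box_test a b m v <= box_test a b n v.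
Proof.
by move=> mn; rewrite lerD2l lerN2 ler_expR ler_wpM2r ?prod_ge0// lerN2 ler_nat.
Qed.

Lemma box_test_cvg a b v :
  box_test a b n v @[n --> \oo] --> (\1_(bounded_box a b) v : R).
Proof.
rewrite indicE; have [vab|vab] := pselect (bounded_box a b v); last first.
  rewrite memNset//; under eq_fun do rewrite box_test_outside//; exact: cvg_cst.
rewrite mem_set//= -[X in _ --> X]subr0; apply: cvgB; first exact: cvg_cst.
have p0 := box_prod_gt0 vab; set p := \prod_i _ in p0 *.
apply/cvgrPdist_le => e e0.
have e1 : 0 < e * p by rewrite mulr_gt0.
near=> n; rewrite sub0r normrN ger0_norm ?expR_ge0// mulNr expRN.
have n0 : (0 < n)%N by near: n; exact: nbhs_infty_gt.
have np0 : 0 < n%:R * p by rewrite mulr_gt0 ?ltr0n.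
apply: (@le_trans _ _ (n%:R * p)^-1).
  rewrite lef_pV2 ?posrE ?expR_gt0//.
  by rewrite (le_trans _ (expR_ge1Dx _))// lerDr.
rewrite -[leLHS]mul1r ler_pdivrMr// mulrCA -ler_pdivrMr//.
by near: n; exact: nbhs_infty_ger.
Unshelve. all: by end_near. Qed.

(** The measures agree on boxes by monotone convergence along [box_test]; boxes are stable under
    intersection, generate the Borel sets, and exhaust the space by sets of finite [m1] measure. *)
Lemma measure_eq_of_test (m1 m2 : {measure set 'rV[R]_d -> \bar R}) :
  (m1 setT < +oo)%E ->
  (forall g : 'rV[R]_d -> R, (forall k, Ck k g) -> (forall x, 0 <= g x) ->
    (exists r : R, forall x, r < `|x| -> g x = 0) ->
    (\int[m1]_x (g x)%:E = \int[m2]_x (g x)%:E)%E) ->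
  forall A, measurable A -> m1 A = m2 A.
Proof.
move=> fin test A mA.
have lim (m : {measure set 'rV[R]_d -> \bar R}) a b :
    m (bounded_box a b) = limn (fun n => \int[m]_x (box_test a b n x)%:E)%E.
  rewrite -monotone_convergence//=.
  - have mb := measurable_bounded_box a b.
    rewrite -[RHS]/(\int[m]_x limn (fun n => (box_test a b n x)%:E))%E.
    rewrite -[bounded_box a b]setIT -integral_indic//.
    apply: eq_integral => x _; apply/esym/cvg_lim => //.
    by apply: cvg_EFin; [exact: nearW|exact: box_test_cvg].
  - move=> n; apply/measurable_EFinP; apply: continuous_measurable_rV.
    exact: Ck_continuous (box_test_Ck 0 a b n).
  - by move=> n x _; rewrite lee_fin box_test_ge0.
  - by move=> x _ m' n' mn; rewrite lee_fin box_test_mono.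
apply: (measure_unique boxes (fun n => bounded_box (fun=> - n%:R) (fun=> n%:R))) => //.
- exact: boxes_generate.
- exact: boxesI.
- by move=> n; eexists; eexists.
- exact: boxes_cover.
- move=> _ [a [b ->]]; rewrite !lim; congr (limn _); apply/funext => n.
  apply: test; [by move=> k; exact: box_test_Ck|exact: box_test_ge0|].
  exact: box_test_support.
- move=> n; apply: le_lt_trans fin; apply: le_measure; rewrite ?inE//.
  exact: measurable_bounded_box.
Qed.

End TestFunctions.

Lemma integrable_sub {dT} {T : measurableType dT} {R : realType}
    (mu : {measure set T -> \bar R}) (D : set T) (f g : T -> R) : measurable D ->
  mu.-integrable D (EFin \o f) -> mu.-integrable D (EFin \o g) ->
  mu.-integrable D (EFin \o (fun x => f x - g x)).
Proof.
move=> mD fi gi; rewrite (_ : _ \o _ = (fun x => (f x)%:E - (g x)%:E)%E).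
  exact: integrableB.
by apply/funext => x.
Qed.

(** * Curves in the Wasserstein space *)

Section WassersteinContinuity.
Context (R : realType) (d : nat).
Local Notation proba := (probability 'rV[R]_d R).
Implicit Types (mu nu : proba).

Lemma probability_integrable d' (T : measurableType d') (P : probability T R) (f : T -> R) M :
  measurable_fun setT f -> (forall x, `|f x| <= M) -> P.-integrable setT (EFin \o f).
Proof.
move=> mf fM; apply: measurable_bounded_integrable => //.
  by apply: le_lt_trans (probability_le1 P measurableT) _; exact: ltry.
exists M; split; first exact: num_real.
by move=> N MN x _; apply: le_trans (fM x) _; exact: ltW.
Qed.

Lemma norm_sq_dotp (v : 'rV[R]_d) : `|v| ^+ 2 <= dotp v v.
Proof. exact: norm_rV_sq. Qed.

Lemma measurable_dotp_sub :
  measurable_fun setT (fun z : 'rV[R]_d * 'rV[R]_d => dotp (z.1 - z.2) (z.1 - z.2)).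
Proof.
rewrite /dotp; apply: measurable_sum => i.
have mc : measurable_fun setT (fun z : 'rV[R]_d * 'rV[R]_d => (z.1 - z.2) 0 i).
  under eq_fun do rewrite rVB; apply: measurable_funB.
    exact: (measurableT_comp (measurable_coord i) measurable_fst).
  exact: (measurableT_comp (measurable_coord i) measurable_snd).
exact: measurable_funM.
Qed.

Lemma dotp_ge0 (v : 'rV[R]_d) : 0 <= dotp v v.
Proof. by apply: sumr_ge0 => i _; rewrite -expr2 sqr_ge0. Qed.

(* L |x - y| <= eta + (L^2 / eta) |x - y|^2 / 2 by the AM-GM inequality. *)
Lemma coupling_lipschitz mu nu (pi : probability ('rV[R]_d * 'rV[R]_d)%type R)
    (f : 'rV[R]_d -> R) (M L eta : R) :
  coupling mu nu pi -> continuous f -> (forall x, `|f x| <= M) ->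
  (forall x y, `|f x - f y| <= L * `|x - y|) -> 0 <= L -> 0 < eta ->
  (`|\int[mu]_x f x - \int[nu]_x f x|%:E <= eta%:E + (L ^+ 2 / eta)%:E *
    \int[pi]_z (dotp (z.1 - z.2) (z.1 - z.2) / 2)%:E)%E.
Proof.
move=> cpl cf fM fL L0 eta0.
have mf : measurable_fun setT f by exact: continuous_measurable_rV.
have mEf : measurable_fun setT (EFin \o f) by apply/measurable_EFinP.
have i1 : pi.-integrable setT (EFin \o (fun z : 'rV[R]_d * 'rV[R]_d => f z.1)).
  by apply: (@probability_integrable _ _ _ _ M) => //; exact: measurableT_comp.
have i2 : pi.-integrable setT (EFin \o (fun z : 'rV[R]_d * 'rV[R]_d => f z.2)).
  by apply: (@probability_integrable _ _ _ _ M) => //; exact: measurableT_comp.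
have E1 : \int[mu]_x f x = \int[pi]_z f z.1.
  rewrite /Rintegral; congr fine.
  have := @integral_pushforward _ _ _ _ _ _ (@measurable_fst _ _ 'rV[R]_d 'rV[R]_d) pi setT
    (EFin \o f) mEf i1 measurableT.
  rewrite preimage_setT => <-; apply: eq_measure_integral => A mA _.
  apply: esym; apply: etrans (cpl A mA).1; rewrite /pushforward; congr (pi _).
  by apply/seteqP; split => -[x y] /=; tauto.
have E2 : \int[nu]_x f x = \int[pi]_z f z.2.
  rewrite /Rintegral; congr fine.
  have := @integral_pushforward _ _ _ _ _ _ (@measurable_snd _ _ 'rV[R]_d 'rV[R]_d) pi setT
    (EFin \o f) mEf i2 measurableT.
  rewrite preimage_setT => <-; apply: eq_measure_integral => A mA _.
  apply: esym; apply: etrans (cpl A mA).2; rewrite /pushforward; congr (pi _).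
  by apply/seteqP; split => -[x y] /=; tauto.
rewrite E1 E2 -RintegralB// EFin_normr_Rintegral//; last first.
  exact: integrable_sub.
have mdiff : measurable_fun setT (fun z : 'rV[R]_d * 'rV[R]_d => f z.1 - f z.2).
  by apply: measurable_funB; exact: measurableT_comp.
have md := measurable_dotp_sub.
have md2 : measurable_fun setT
   (fun z : 'rV[R]_d * 'rV[R]_d => dotp (z.1 - z.2) (z.1 - z.2) / 2).
  exact: measurable_funM.
have c0 : 0 <= L ^+ 2 / eta by rewrite divr_ge0 ?sqr_ge0// ltW.
have d20 (z : 'rV[R]_d) : 0 <= dotp z z / 2 by rewrite divr_ge0 ?dotp_ge0.
apply: (le_trans (le_abse_integral _ _ _)) => //; first by apply/measurable_EFinP.
apply: (@le_trans _ _ (\int[pi]_z (eta%:E + (L ^+ 2 / eta)%:E *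
   (dotp (z.1 - z.2) (z.1 - z.2) / 2)%:E))%E).
  apply: ge0_le_integral => //.
  - by apply: measurableT_comp => //; apply/measurable_EFinP.
  - apply/measurable_EFinP; apply: measurable_funD => //; exact: measurable_funM.
  move=> z _; rewrite /= lee_fin; apply: (le_trans (fL _ _)).
  set v := z.1 - z.2.
  have h1 : L ^+ 2 / eta * (`|v| ^+ 2 / 2) <= L ^+ 2 / eta * (dotp v v / 2).
    by rewrite ler_wpM2l// ler_wpM2r// norm_sq_dotp.
  apply: le_trans (lerD (lexx eta) h1).
  have -> : eta + L ^+ 2 / eta * (`|v| ^+ 2 / 2) = (2 * eta ^+ 2 + (L * `|v|) ^+ 2) / (2 * eta).
    by field; rewrite gt_eqF.
  rewrite ler_pdivlMr ?mulr_gt0//.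
  have := sqr_ge0 (eta - L * `|v|); have := sqr_ge0 eta; rewrite !expr2; nra.
rewrite ge0_integralD//; last 3 first.
- by move=> z _; rewrite lee_fin ltW.
- by move=> z _; rewrite mule_ge0// lee_fin.
- by apply/measurable_EFinP; exact: measurable_funM.
have -> : (\int[pi]_z eta%:E = eta%:E)%E.
  rewrite integral_cst//; apply: etrans (mule1 _); congr (_ * _)%E.
  exact: probability_setT.
rewrite ge0_integralZl//.
- by apply/measurable_EFinP.
- by move=> z _; rewrite lee_fin.
Qed.

Lemma W2_close (f : 'rV[R]_d -> R) (M L e : R) :
  continuous f -> (forall x, `|f x| <= M) ->
  (forall x y, `|f x - f y| <= L * `|x - y|) -> 0 <= L -> 0 < e ->
  exists2 del : R, 0 < del & forall mu nu, (W2 mu nu <= del%:E)%E ->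
    `|\int[mu]_x f x - \int[nu]_x f x| <= e.
Proof.
move=> cf fM fL L0 e0; pose eta := e / 2.
have eta0 : 0 < eta by rewrite divr_gt0.
(* The coupling term is at most [L ^+ 2 / eta * (2 * del)], and [del <= e * eta / D] makes it at
   most [e / 2]. The 1 in [D] covers [L = 0]; [del <= 1] gives [del ^+ 2 <= del]. *)
pose D := 4 * (L ^+ 2 + 1); have L20 : 0 <= L ^+ 2 by exact: sqr_ge0.
have D0 : 0 < D by rewrite mulr_gt0// ltr_wpDl.
pose del := Num.min 1 (e * eta / D).
have del0 : 0 < del by rewrite lt_min ltr01 !mulr_gt0 ?invr_gt0.
exists del => // mu nu W.
move: W; rewrite /W2; set S := (X in ereal_inf X) => W.
(* The infimum in [W2] is not known to be attained; the strict bound [2 * del] leaves room for an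
   almost optimal coupling. *)
have [I [pi cpl IE] Idel] : exists2 I, S I & (I < (2 * del)%:E)%E.
  suff : (ereal_inf S < (2 * del)%:E)%E by move=> /ereal_inf_lt.
  have S0 : (0 <= ereal_inf S)%E.
    apply: le_ereal_inf_tmp => _ [pi _ <-]; apply: integral_ge0 => z _.
    by rewrite lee_fin divr_ge0// dotp_ge0.
  move: W; case: (ereal_inf S) S0 => [s||]//; last first.
    by rewrite poweRyr ?invr_eq0.
  rewrite !lee_fin lte_fin => s0; rewrite powR12_sqrt// => sd.
  have : s <= del ^+ 2.
    by rewrite -(sqr_sqrtr s0) lerXn2r ?nnegrE ?sqrtr_ge0// ltW.
  have : del ^+ 2 <= del by rewrite expr2 ler_piMr ?(ltW del0)// ge_min lexx.
  lra.
have := coupling_lipschitz cpl cf fM fL L0 eta0; rewrite IE.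
have I0 : (0 <= I)%E.
  rewrite -IE; apply: integral_ge0 => z _.
  by rewrite lee_fin divr_ge0// dotp_ge0.
case: I I0 IE Idel => [s||] // _ IE.
rewrite lte_fin -EFinM -EFinD lee_fin => sd h; apply: (le_trans h).
have c0 : 0 <= L ^+ 2 / eta by rewrite divr_ge0// ltW.
have h1 : 2 * del <= 2 * (e * eta / D).
  by apply: ler_wpM2l => //; rewrite ge_min lexx orbT.
have h2 : s <= 2 * (e * eta / D) by exact: le_trans (ltW sd) h1.
have := ler_wpM2l c0 h2.
have -> : L ^+ 2 / eta * (2 * (e * eta / D)) = e / 2 * (L ^+ 2 / (L ^+ 2 + 1)).
  by rewrite /D; field; rewrite !gt_eqF// ltr_wpDl.
have : e / 2 * (L ^+ 2 / (L ^+ 2 + 1)) <= e / 2 * 1.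
  by rewrite ler_wpM2l ?(ltW eta0)// ler_pdivrMr ?mul1r ?lerDl// ltr_wpDl.
rewrite /eta; lra.
Qed.

(** The distance is dominated by increments of the primitive [V] of the integrable function [v];
    since [V] is continuous, [W2_close] applies. *)
Lemma curve_continuous (T : R) (mu : R -> proba) (f : 'rV[R]_d -> R) (M L : R) :
  0 < T -> abs_continuous_curve T mu ->
  continuous f -> (forall x, `|f x| <= M) ->
  (forall x y, `|f x - f y| <= L * `|x - y|) -> 0 <= L ->
  {within `[0, T], continuous (fun t => \int[mu t]_x f x)}.
Proof.
move=> T0 [_ [v iv hv]] cf fM fL L0.
pose V := parameterized_integral lebesgue_measure 0 ^~ v.
have cV : {within `[0, T], continuous V} by exact: parameterized_integral_continuous (ltW T0) iv.
have VE s t : 0 <= s -> s <= t -> t <= T ->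
    (\int[lebesgue_measure]_(r in `[s, t]) (v r)%:E = (V t - V s)%:E)%E.
  move=> s0 st tT.
  have ivt : (@lebesgue_measure R).-integrable `[0, t] (EFin \o v).
    by apply: integrableS iv => //; apply: subset_itvl; rewrite bnd_simp.
  have ist : (@lebesgue_measure R).-integrable `[s, t] (EFin \o v).
    by apply: integrableS ivt => //; apply: subset_itvr; rewrite bnd_simp.
  have := @Rintegral_itvB R v (BLeft 0) (BRight t) s ivt.
  rewrite !bnd_simp => /(_ s0 st) e; rewrite /V /parameterized_integral e.
  rewrite Rintegral_itv_obnd_cbnd; last first.
    by apply: integrableS ist => //; apply: subset_itvr; rewrite bnd_simp.
  by rewrite /Rintegral fineK// integrable_fin_num.
apply/subspace_continuousP => t /=; rewrite in_itv/= => /andP[t0 tT].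
apply/cvgrPdist_le => e e0.
have [del del0 hdel] := W2_close cf fM fL L0 e0.
have tI : `[0, T]%classic t by rewrite /= in_itv/= t0 tT.
have := (subspace_continuousP _ _).1 cV t tI => /cvgrPdist_le/(_ _ del0).
apply: filter_app; apply: filter_app (withinT `[0, T]%classic _).
near=> s => sI Vst.
move: sI; rewrite /= in_itv/= => /andP[s0 sT].
have [st|ts] := leP t s.
  apply: hdel; apply: (le_trans (hv _ _ t0 st sT)); rewrite VE// lee_fin.
  by move: Vst; rewrite distrC; apply: le_trans; exact: ler_norm.
rewrite distrC; apply: hdel; apply: (le_trans (hv _ _ s0 (ltW ts) tT)); rewrite (VE _ _ s0 (ltW ts) tT) lee_fin.
by move: Vst; apply: le_trans; exact: ler_norm.
Unshelve. all: by end_near. Qed.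

End WassersteinContinuity.

(** * Differentiation under the integral and the divergence theorem *)

Section ParametricIntegral.
Context (R : realType) (d : nat).
Local Notation leb := (lebesgue_rv R d).

Lemma Ck_slice k (K : R * 'rV[R]_d -> R) s : Ck k K -> Ck k (fun x => K (s, x)).
Proof.
apply: (@Ck_affine _ _ _ (fun y => (s, y)) (fun v => (0, v))).
  by apply: continuous_pair; [exact: cst_continuous|move=> z; exact: cvg_id].
by move=> x v h; congr pair; rewrite /= scaler0 addr0.
Qed.

Lemma Ck_snd k (f : 'rV[R]_d -> R) : Ck k f -> Ck k (fun q : R * 'rV[R]_d => f q.2).
Proof.
apply: (@Ck_affine _ _ _ (fun q : R * 'rV[R]_d => q.2) (fun v : R * 'rV[R]_d => v.2)) => //.
by move=> q; exact: cvg_snd.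
Qed.

Lemma derive_time (K : R * 'rV[R]_d -> R) (s : R) x : Ck 1 K ->
  is_derive s 1 (fun s => K (s, x)) ('D_(1, 0) K (s, x)).
Proof.
move=> CK; apply: (@is_derive_affine _ _ _ _ (fun s : R => (s, x)) K s 1 (1, 0)).
  by move=> h; congr pair; rewrite /= scaler0 addr0.
exact: Ck_derive CK.
Qed.

Lemma compact_time_ball (T r : R) :
  compact [set p : R * 'rV[R]_d | `|p.1| <= T /\ `|p.2| <= r].
Proof.
rewrite (_ : [set _ | _] = `[- T, T]%classic `*` [set x : 'rV[R]_d | `|x| <= r]).
  by apply: compact_setX; [exact: segment_compact|exact: compact_rV_ball].
by apply/seteqP; split => -[t x] /=; rewrite in_itv/= -ler_norml.
Qed.

Lemma time_ball_bound (K : R * 'rV[R]_d -> R) (T r : R) : continuous K ->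
  (forall s x, r < `|x| -> K (s, x) = 0) ->
  exists2 M : R, 0 <= M & forall s x, `|s| <= T -> `|K (s, x)| <= M.
Proof.
move=> cK K0; have [M M0 hM] := compact_norm_bound (@compact_time_ball T r) cK.
exists M => // s x sT; have [xr|/K0->] := leP `|x| r; last by rewrite normr0.
exact: hM.
Qed.

Lemma integrable_lebesgue_compact (f : 'rV[R]_d -> R) r : continuous f ->
  (forall x, r < `|x| -> f x = 0) -> leb.-integrable setT (EFin \o f).
Proof. exact: integrable_compact_support (lebesgue_rV_ball d r). Qed.

Lemma derive_time_outside (K : R * 'rV[R]_d -> R) r : Ck 1 K ->
  (forall s x, r < `|x| -> K (s, x) = 0) ->
  forall s x, r < `|x| -> 'D_(1, 0) K (s, x) = 0.
Proof.
move=> CK K0 s x xr; have [_ <-] := derive_time s x CK.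
rewrite (_ : (fun _ => _) = cst 0) ?derive_cst//.
by apply/funext => t; exact: K0.
Qed.

Lemma integral_derive_time (K : R * 'rV[R]_d -> R) (r s : R) : Ck 1 K ->
  (forall s x, r < `|x| -> K (s, x) = 0) ->
  is_derive s 1 (fun s => \int[leb]_x K (s, x)) (\int[leb]_x 'D_(1, 0) K (s, x)).
Proof.
move=> CK K0; have cK := Ck_continuous CK.
have [_ _ /(_ (1, 0)) cD] := CK.
have D0 := derive_time_outside CK K0.
have [M M0 hM] := @time_ball_bound _ (`|s| + 1) r cD D0.
pose G (x : 'rV[R]_d) : R := M * \1_[set x : 'rV[R]_d | `|x| <= r] x.
have mb := @measurable_rV_ball R d r.
have iG : leb.-integrable setT (EFin \o G).
  rewrite (_ : EFin \o G = fun x => (M%:E * (\1_[set x : 'rV[R]_d | (`|x| <= r)%R] x)%:E)%E)//.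
  apply: integrableZl => //; apply/integrableP; split.
    by apply/measurable_EFinP.
  under eq_integral do rewrite gee0_abs ?lee_fin//.
  by rewrite integral_indic// setIT; exact: lebesgue_rV_ball.
have G0 x : 0 <= G x by rewrite mulr_ge0.
have I0 : `](s - 1), (s + 1)[%classic s by rewrite /= in_itv/= ltrBlDr ltrDl ltr01.
have intf t : `](s - 1), (s + 1)[%classic t -> leb.-integrable setT (EFin \o (fun x => K (t, x))).
  move=> _; apply: (integrable_lebesgue_compact (r := r)) => [|x xr]; last exact: K0.
  exact: Ck_continuous (Ck_slice t CK).
have df t x : `](s - 1), (s + 1)[%classic t -> setT x -> derivable (fun t => K (t, x)) t 1.
  by move=> _ _; have [] := derive_time t x CK.
have d1 t x : partial1of2 (fun t x => K (t, x)) t x = 'D_(1, 0) K (t, x).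
  by rewrite partial1of2E; have [_ ->] := derive_time t x CK.
have ub t x : `](s - 1), (s + 1)[%classic t -> setT x ->
    `|partial1of2 (fun t x => K (t, x)) t x| <= G x.
  rewrite /= in_itv/= => /andP[t1 t2] _; rewrite d1 /G indicE.
  have [xr|xr] := leP `|x| r.
    rewrite mem_set// mulr1 hM// -(subrK s t) (le_trans (ler_normD _ _))// addrC lerD2l.
    by rewrite ler_norml; apply/andP; split; lra.
  by rewrite D0// normr0 mulr_ge0.
have D1 := derivable_under_integral measurableT I0 intf df G0 iG ub.
have D2 := differentiation_under_integral measurableT I0 intf df G0 iG ub.
apply: DeriveDef; first exact: D1.
rewrite -derive1E D2; apply: eq_Rintegral => x _; exact: d1.
Qed.

Lemma integral_divergence_0 (h : 'I_d -> 'rV[R]_d -> R) (r : R) :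
  (forall i, Ck 1 (h i)) -> (forall i x, r < `|x| -> h i x = 0) ->
  \int[leb]_x (\sum_i partial i (h i) x) = 0.
Proof.
move=> Ch h0; rewrite /Rintegral.
have int i : leb.-integrable setT (fun x => (partial i (h i) x)%:E).
  have [_ _ /(_ (delta_mx 0 i)) c1] := Ch i.
  apply: (integrable_lebesgue_compact (r := r) c1) => x.
  by apply: derive_outside => y; exact: h0.
under eq_integral do rewrite -sumEFin.
rewrite integral_sum//= big1// => i _.
have [_ _ /(_ (delta_mx 0 i)) c1] := Ch i.
apply: (integral_partial_0 (f := h i) (i := i) (r := r) c1) => x; last exact: h0.
exact: Ck_derive (Ch i).
Qed.

End ParametricIntegral.

(** * Transported test functions and densities *)

Section Conservation.
Context (R : realType) (d : nat) (phi : 'rV[R]_d -> R) (r : R).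
Local Notation leb := (lebesgue_rv R d).
Hypothesis Cphi : forall k, Ck k phi.
Variables (X : R -> 'rV[R]_d -> 'rV[R]_d) (Z : R -> 'rV[R]_d -> R).
Hypothesis X_Ck : forall k i, Ck k (fun p : R * 'rV[R]_d => X p.1 p.2 0 i).
Hypothesis Z_Ck : forall k, Ck k (fun p : R * 'rV[R]_d => Z p.1 p.2).
Hypothesis XZ0 : forall x, X 0 x = x /\ Z 0 x = 0.
Hypothesis XZ_outside : forall t x, r < `|x| -> X t x = x /\ Z t x = 0.
Hypothesis transport : forall f, (forall k, Ck k f) -> forall (c s : R) x,
  is_derive s 1 (fun s => f (X s x) * expR (c * Z s x))
    (\sum_i partial i phi x * partial i (fun x => f (X s x) * expR (c * Z s x)) x +
     c * laplacian phi x * (f (X s x) * expR (c * Z s x))).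

(** [expR (Z s x)] is the Jacobian determinant of [X s], so [pushed f (- t)] is the density of the
    image of [f dx] under [X t]. *)
Definition pushed (f : 'rV[R]_d -> R) (s : R) (x : 'rV[R]_d) : R :=
  f (X s x) * expR (Z s x).

Lemma pulled_Ck k f : Ck k f -> Ck k (fun p : R * 'rV[R]_d => f (X p.1 p.2)).
Proof. by move=> Cf; exact: (Ck_comp (g := fun p : R * 'rV[R]_d => X p.1 p.2) Cf). Qed.

Lemma pushed_Ck k f : Ck k f -> Ck k (fun p : R * 'rV[R]_d => pushed f p.1 p.2).
Proof.
move=> Cf; apply: CkM; first exact: pulled_Ck.
by apply: (Ck_comp1 (g := fun p : R * 'rV[R]_d => Z p.1 p.2)); [exact: Ck_expR|].
Qed.

Lemma Ck_time_affine k (t a : R) (K : R * 'rV[R]_d -> R) : Ck k K ->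
  Ck k (fun p : R * 'rV[R]_d => K (t + a * p.1, p.2)).
Proof.
apply: (@Ck_affine _ _ _ (fun p : R * 'rV[R]_d => (t + a * p.1, p.2))
  (fun v : R * 'rV[R]_d => (a * v.1, v.2))).
  apply: continuous_pair => p; last exact: cvg_snd.
  by apply: cvgD; [exact: cvg_cst|apply: cvgMr; exact: cvg_fst].
by move=> x v h; congr pair; rewrite /= mulrDr addrA [h *: v.1]/(h * v.1) [h *: (a * v.1)]/(h * (a * v.1)) mulrCA.
Qed.

Lemma is_derive_time_affine (f : R -> R) (t s df : R) :
  is_derive (t - s) 1 f df -> is_derive s 1 (fun s => f (t - s)) (- df).
Proof.
move=> Df; have := @is_derive_affine _ _ _ _ (fun s : R => t - s) f s 1 (- 1) (- df).
apply; first by move=> h; rewrite opprD addrA scalerN.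
by rewrite -(scaleN1r df); exact: is_derive1_dir.
Qed.

Lemma pulled_derive f (t s : R) x : (forall k, Ck k f) ->
  is_derive s 1 (fun s => f (X (t - s) x))
    (- \sum_i partial i phi x * partial i (fun x => f (X (t - s) x)) x).
Proof.
move=> Cf; apply: (is_derive_time_affine (f := fun s => f (X s x))).
have E u : (fun x => f (X u x) * expR (0 * Z u x)) = (fun x => f (X u x)).
  by apply/funext => y; rewrite mul0r expR0 mulr1.
have := transport Cf 0 (t - s) x; rewrite E 2!mul0r addr0.
by under eq_fun do rewrite mul0r expR0 mulr1.
Qed.

(** The case [c = 1] of [transport] at time [- s]: the product rule merges the gradient and
    Laplacian terms into a divergence. *)
Lemma pushed_derive f (s : R) x : (forall k, Ck k f) ->
  is_derive s 1 (fun s => pushed f (- s) x)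
    (- \sum_i partial i (fun x => pushed f (- s) x * partial i phi x) x).
Proof.
move=> Cf.
have E u : (fun x => f (X u x) * expR (1 * Z u x)) = pushed f u.
  by apply/funext => y; rewrite mul1r.
have Et : (fun s => f (X s x) * expR (1 * Z s x)) = (fun s => pushed f s x).
  by apply/funext => y; rewrite mul1r.
have H := transport Cf 1 (- s) x; rewrite E Et !mul1r -/(pushed f (- s) x) in H.
have Cp : Ck 1 (pushed f (- s)).
  exact: (Ck_slice (K := fun p => pushed f p.1 p.2) (- s) (pushed_Ck (Cf 1%N))).
have divE : \sum_i partial i phi x * partial i (pushed f (- s)) x +
    laplacian phi x * pushed f (- s) x =
    \sum_i partial i (fun x => pushed f (- s) x * partial i phi x) x.
  rewrite /laplacian mulr_suml -big_split; apply: eq_bigr => i _ /=.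
  have D1 := Ck_derive x (delta_mx 0 i) Cp.
  have D2 := Ck_derive x (delta_mx 0 i) (partial_Ck Cphi 1 i).
  have [_ D3] := is_deriveM D1 D2.
  rewrite /partial in D3 *; rewrite [RHS]D3 /GRing.scale/= addrC; congr (_ + _).
  by rewrite mulrC.
rewrite divE in H.
exact: (@is_derive_opp_arg R (fun s => pushed f s x) s _ H).
Qed.

Lemma pulled_outside (g : 'rV[R]_d -> R) rg : (forall x, rg < `|x| -> g x = 0) ->
  forall t x, Num.max r rg < `|x| -> g (X t x) = 0.
Proof. by move=> g0 t x; rewrite gt_max => /andP[/XZ_outside-/(_ t)[-> _] /g0]. Qed.

(** Plays the role of the change of variables [y = X t x]. The integral of
    [g (X (t - s) x) * pushed f (- s) x] is the left side at [s = 0] and the right side at [s = t];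
    its derivative in [s] is minus the integral of the divergence of this product times the gradient
    of [phi], hence 0. *)
Lemma pushed_conservation (f g : 'rV[R]_d -> R) rg t :
  (forall k, Ck k f) -> (forall k, Ck k g) -> (forall x, rg < `|x| -> g x = 0) ->
  \int[leb]_x (g (X t x) * f x) = \int[leb]_x (g x * pushed f (- t) x).
Proof.
move=> Cf Cg g0; pose rr := Num.max r rg.
pose K (p : R * 'rV[R]_d) := g (X (t - p.1) p.2) * pushed f (- p.1) p.2.
have CK : Ck 1 K.
  apply: CkM.
    have := Ck_time_affine t (- 1) (pulled_Ck (Cg 1%N)).
    by under eq_fun do rewrite mulN1r.
  have := Ck_time_affine 0 (- 1) (pushed_Ck (Cf 1%N)).
  by under eq_fun do rewrite mulN1r add0r.
have K0 s x : rr < `|x| -> K (s, x) = 0.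
  by move=> xr; rewrite /K/= (pulled_outside g0)// mul0r.
have Cpf s : Ck 1 (pushed f s).
  exact: (Ck_slice (K := fun p => pushed f p.1 p.2) s (pushed_Ck (Cf 1%N))).
have Cpg s : Ck 1 (fun x => g (X s x)).
  exact: (Ck_slice (K := fun p => g (X p.1 p.2)) s (pulled_Ck (Cg 1%N))).
have DK (s : R) : is_derive s 1 (fun s => \int[leb]_x K (s, x)) 0.
  apply: (is_derive_eq (integral_derive_time s CK K0)).
  pose h i x := - (g (X (t - s) x) * (pushed f (- s) x * partial i phi x)).
  have Cpp i : Ck 1 (fun x => pushed f (- s) x * partial i phi x).
    by apply: CkM => //; exact: partial_Ck Cphi 1 i.
  rewrite -(@integral_divergence_0 R d h rr).
  - apply: eq_Rintegral => x _.
    have [_ <-] := derive_time s x CK.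
    have [_ ->] := is_deriveM (pulled_derive t s x Cg) (pushed_derive s x Cf).
    rewrite /GRing.scale/= mulrN mulrN -opprD mulr_sumr mulr_sumr -big_split -sumrN.
    apply: eq_bigr => i _ /=.
    have [_ E] := is_deriveN (is_deriveM (Ck_derive x (delta_mx 0 i) (Cpg (t - s)))
      (Ck_derive x (delta_mx 0 i) (Cpp i))).
    rewrite /partial /h in E *; rewrite [RHS]E /GRing.scale/=; congr (- (_ + _)).
    by rewrite mulrA.
  - by move=> i; apply: CkN; apply: CkM.
  - by move=> i x xr; rewrite /h (pulled_outside g0)// mul0r oppr0.
have := @is_derive_0_is_cst R _ 0 t DK; rewrite /K/= => E.
transitivity (\int[leb]_x (g (X (t - 0) x) * pushed f (- 0) x)).
  apply: eq_Rintegral => x _; rewrite subr0 oppr0 /pushed (XZ0 x).1 (XZ0 x).2.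
  by rewrite expR0 mulr1.
rewrite E; apply: eq_Rintegral => x _.
by rewrite subrr (XZ0 x).1.
Qed.

End Conservation.

(** * Continuous functions with vanishing weak derivative *)

Section DuBoisReymond.
Context (R : realType) (T : R).
Hypothesis T0 : 0 < T.

Lemma within_continuous_eps (q : R -> R) : {within `[0, T], continuous q} ->
  forall x, 0 <= x <= T -> forall e : R, 0 < e -> exists2 del : R, 0 < del &
    forall u, 0 <= u <= T -> `|u - x| < del -> `|q x - q u| <= e.
Proof.
move=> cq x xT e e0.
have xI : `[0, T]%classic x by rewrite /= in_itv.
have := (subspace_continuousP _ _).1 cq x xI => /cvgrPdist_le/(_ _ e0).
rewrite near_withinE => /nbhs_normP[del /= del0 hdel]; exists del => // u uT ux.
by apply: hdel; rewrite /= ?in_itv//= distrC.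
Qed.

Lemma integrable_within_continuous (q : R -> R) : {within `[0, T], continuous q} ->
  (@lebesgue_measure R).-integrable `[0, T] (EFin \o q).
Proof. by apply: continuous_compact_integrable; exact: segment_compact. Qed.

Lemma within_continuousM (p q : R -> R) : continuous p -> {within `[0, T], continuous q} ->
  {within `[0, T], continuous (fun u => p u * q u)}.
Proof.
move=> cp cq x; apply: cvgM; last exact: cq.
exact: (continuous_subspaceT cp).
Qed.

(** [s] is a bump of mass [c] on []0, e[], so the integral is [c] times an average of [q] over
    [[a, a + e]]. *)
Lemma step_average (q S s : R -> R) (e c a kappa : R) :
  {within `[0, T], continuous q} -> continuous s ->
  (forall x : R, is_derive x 1 S (s x)) ->
  (forall x, 0 <= s x /\ (~~ (0 < x < e) -> s x = 0)) ->
  (forall x, x <= 0 -> S x = 0) -> (forall x, e <= x -> S x = c) ->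
  0 < a -> a + e <= T ->
  (forall u, a <= u <= a + e -> `|q a - q u| <= kappa) ->
  `|\int[lebesgue_measure]_(u in `[0, T]) (s (u - a) * q u) - c * q a| <= c * kappa.
Proof.
move=> cq cs DS s0 S0 Sc a0 aT qk.
have csa : continuous (fun u => s (u - a)).
  move=> u; apply: (cvg_comp (fun u => u - a) s); last exact: cs.
  by apply: cvgB; [exact: cvg_id|exact: cvg_cst].
have is1 : (@lebesgue_measure R).-integrable `[0, T] (EFin \o (fun u => s (u - a))).
  by apply: integrable_within_continuous; exact: continuous_subspaceT.
have is2 := integrable_within_continuous (within_continuousM csa cq).
have mI : measurable (`[0, T]%classic : set R) by exact: measurable_itv.
have Ec : \int[lebesgue_measure]_(u in `[0, T]) s (u - a) = c.
  have DSa (u : R) : is_derive u 1 (fun u => S (u - a)) (s (u - a)).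
    have := @is_derive_affine _ _ _ _ (fun u : R => u - a) S u 1 1 (s (u - a)).
    by apply=> h; rewrite addrAC.
  have cSa : continuous (fun u => S (u - a)) by move=> u; exact: is_derive_continuous (DSa u).
  rewrite /Rintegral (@continuous_FTC2 R (fun u => s (u - a)) (fun u => S (u - a)) 0 T T0).
  - by rewrite Sc ?lerBrDl// S0 ?sube0// sub0r oppr_le0 ltW.
  - exact: continuous_subspaceT.
  - split; first by move=> x _; have [] := DSa x.
      exact: (cvg_at_right_filter (cSa _)).
    exact: (cvg_at_left_filter (cSa _)).
  - by move=> x _; rewrite derive1E; have [_ ->] := DSa x.
have -> : c * q a = \int[lebesgue_measure]_(u in `[0, T]) (s (u - a) * q a).
  by rewrite RintegralZr// Ec.
have is3 : (@lebesgue_measure R).-integrable `[0, T] (EFin \o (fun u => s (u - a) * q a)).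
  apply: integrable_within_continuous; apply: within_continuousM => //.
  by apply: continuous_subspaceT; exact: cst_continuous.
have is4 : (@lebesgue_measure R).-integrable `[0, T]
    (EFin \o (fun u => s (u - a) * q u - s (u - a) * q a)).
  exact: integrable_sub.
rewrite -RintegralB//; apply: (le_trans (le_normr_Rintegral _ _)) => //.
have -> : c * kappa = \int[lebesgue_measure]_(u in `[0, T]) (s (u - a) * kappa).
  by rewrite RintegralZr// Ec.
apply: le_Rintegral => //.
- by apply: integrable_norm.
- apply: integrable_within_continuous; apply: within_continuousM => //.
  by apply: continuous_subspaceT; exact: cst_continuous.
move=> u _; rewrite -mulrBr normrM (ger0_norm (s0 _).1).
have [ua|ua] := boolP (0 < u - a < e); last by rewrite (s0 _).2// !mul0r.
rewrite ler_wpM2l ?(s0 _).1// distrC; apply: qk.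
by move: ua => /andP[h1 h2]; apply/andP; split; lra.
Qed.

(* S (. - a) - S (. - b) is a test function in time which approximates the indicator
   function of [a, b]. *)
Lemma constant_of_steps (q : R -> R) : {within `[0, T], continuous q} ->
  (forall a b e (S s : R -> R), 0 < a -> a < b -> 0 < e -> b + e < T ->
     (forall k, Ck k S) -> (forall x : R, is_derive x 1 S (s x)) ->
     (forall x, x <= 0 -> S x = 0) -> (exists c, forall x, e <= x -> S x = c) ->
     \int[lebesgue_measure]_(u in `[0, T]) ((s (u - a) - s (u - b)) * q u) = 0) ->
  forall x y, 0 <= x <= T -> 0 <= y <= T -> q x = q y.
Proof.
move=> cq H.
have interior a b : 0 < a -> a < b -> b < T -> q a = q b.
  move=> a0 ab bT; apply/eqP; rewrite -subr_eq0 -normr_le0; apply/ler_addgt0Pr => k k0.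
  rewrite add0r; have k20 : 0 < k / 2 by rewrite divr_gt0.
  have [|da da0 ha] := within_continuous_eps cq (x := a) _ k20; first by apply/andP; split; lra.
  have [|db db0 hb] := within_continuous_eps cq (x := b) _ k20; first by apply/andP; split; lra.
  pose e := Num.min (Num.min (da / 2) (db / 2)) ((T - b) / 2).
  have e0 : 0 < e by rewrite !lt_min !divr_gt0// subr_gt0.
  have eda : e <= da / 2 by rewrite !ge_min lexx.
  have edb : e <= db / 2 by rewrite !ge_min lexx orbT.
  have eT : e <= (T - b) / 2 by rewrite !ge_min lexx !orbT.
  have [S [s [CS DS s0 S0 [c c0 Sc]]]] := smooth_step e0.
  have cs : continuous s := Ck_continuous (CS 0%N).2.
  have beT : b + e < T by lra.
  have E := H a b e S s a0 ab e0 beT (fun k => (CS k).1) DS S0 (ex_intro _ c Sc).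
  have b0 : 0 < b by lra.
  have Aa := @step_average q S s e c a (k / 2) cq cs DS s0 S0 Sc a0 _ _.
  have Ab := @step_average q S s e c b (k / 2) cq cs DS s0 S0 Sc b0 _ _.
  have {}Aa := Aa _ _; have {}Ab := Ab _ _.
  have csa v : continuous (fun u => s (u - v)).
    move=> u; apply: (cvg_comp (fun u => u - v) s); last exact: cs.
    by apply: cvgB; [exact: cvg_id|exact: cvg_cst].
  have i1 v := integrable_within_continuous (within_continuousM (csa v) cq).
  have {}E : \int[lebesgue_measure]_(u in `[0, T]) (s (u - a) * q u) =
      \int[lebesgue_measure]_(u in `[0, T]) (s (u - b) * q u).
    apply/eqP; rewrite -subr_eq0 -RintegralB//; apply/eqP; rewrite -[RHS]E.
    by apply: eq_Rintegral => u _; rewrite mulrBl.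
  rewrite -E in Ab.
  set I := \int[_]_(u in _) _ in Aa Ab.
  have {}Aa : `|I - c * q a| <= c * (k / 2).
    apply: Aa; first lra.
    move=> u /andP[u1 u2]; apply: ha; first by apply/andP; split; lra.
    by rewrite ger0_norm; lra.
  have {}Ab : `|I - c * q b| <= c * (k / 2).
    apply: Ab; first lra.
    move=> u /andP[u1 u2]; apply: hb; first by apply/andP; split; lra.
    by rewrite ger0_norm; lra.
  have : c * `|q a - q b| <= c * k.
    rewrite -[c in leLHS]gtr0_norm// -normrM.
    have -> : c * (q a - q b) = (I - c * q b) - (I - c * q a) by ring.
    by apply: (le_trans (ler_normB _ _)); lra.
  by rewrite ler_pM2l.
have Th : 0 < T / 2 by rewrite divr_gt0.
have mid a : 0 < a -> a < T -> q a = q (T / 2).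
  move=> a0 aT; have [h|h|->] := ltgtP a (T / 2) => //; first by apply: interior => //; lra.
  by apply/esym/interior.
suff P x : 0 <= x <= T -> q x = q (T / 2) by move=> x y /P-> /P->.
move=> /andP[x0 xT]; apply/eqP; rewrite -subr_eq0 -normr_le0; apply/ler_addgt0Pr => k k0.
rewrite add0r; have [|del del0 hdel] := within_continuous_eps cq (x := x) _ k0.
  by rewrite x0 xT.
(* [x], possibly an endpoint, is moved by the fraction [lam] towards the midpoint [T / 2]: the
   result [u] is interior, where [q] is already known to be constant, and within [del] of [x]. *)
pose lam := Num.min (1 / 2) (del / (2 * T)).
have l0 : 0 < lam by rewrite lt_min !divr_gt0// mulr_gt0.
have l1 : lam <= 1 / 2 by rewrite ge_min lexx.
have l2 : lam * T < del.
  have : lam <= del / (2 * T) by rewrite ge_min lexx orbT.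
  rewrite ler_pdivlMr ?mulr_gt0//; nra.
pose u := x + lam * (T / 2 - x).
have u0 : 0 < u by rewrite /u; nra.
have uT : u < T by rewrite /u; nra.
rewrite -(mid u u0 uT); apply: hdel; first by rewrite !ltW.
rewrite /u addrC addKr; apply: le_lt_trans l2; rewrite normrM (gtr0_norm l0) ler_pM2l//.
by rewrite ler_norml; apply/andP; split; lra.
Qed.

End DuBoisReymond.

(** * The curve tested against transported functions *)

Section WeakConservation.
Context (R : realType) (d : nat) (T : R) (mu : R -> probability 'rV[R]_d R).
Hypothesis T0 : 0 < T.
Hypothesis acmu : abs_continuous_curve T mu.

Lemma Rintegral_prob_bound (P : probability 'rV[R]_d R) (f : 'rV[R]_d -> R) M :
  continuous f -> (forall x, `|f x| <= M) -> `|\int[P]_x f x| <= M.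
Proof.
move=> cf fM; have mf := continuous_measurable_rV cf.
have i1 := probability_integrable P mf fM.
apply: (le_trans (le_normr_Rintegral _ _)) => //.
have h : \int[P]_x `|f x| <= \int[P]_x M.
  apply: le_Rintegral => //; first exact: integrable_norm.
  by apply: (@probability_integrable _ _ _ _ _ `|M|).
apply: (le_trans h); rewrite Rintegral_cst//.
have -> : fine (P setT) = 1 by rewrite [P _]probability_setT.
by rewrite mulr1.
Qed.

(** Integrand and measure both move. With the integrand frozen at time [t], [curve_continuous]
    applies; the change of integrand is at most [M * |t - s|] uniformly in [x], and is integrated
    against probability measures. *)
Lemma curve_integral_continuous (K : R * 'rV[R]_d -> R) (r : R) : Ck 1 K ->
  (forall s x, r < `|x| -> K (s, x) = 0) ->
  {within `[0, T], continuous (fun s => \int[mu s]_x K (s, x))}.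
Proof.
move=> CK K0; have [_ _ /(_ (1, 0)) cD] := CK.
have [M M0 hM] := @time_ball_bound _ _ _ (3 * T) r cD (derive_time_outside CK K0).
have [N N0 hN] := @time_ball_bound _ _ _ T r (Ck_continuous CK) K0.
have CS s := Ck_slice s CK.
apply/subspace_continuousP => t /=; rewrite in_itv/= => /andP[t0 tT].
have [L L0 hL] := compact_support_lipschitz (CS t) (K0 t).
have tI : `[0, T]%classic t by rewrite /= in_itv/= t0 tT.
have tn : `|t| <= T by rewrite ger0_norm.
have ct := Ck_continuous (CS t).
have := (subspace_continuousP _ _).1 (curve_continuous T0 acmu ct (hN t ^~ tn) hL L0) t tI.
move=> /cvgrPdist_le cv; apply/cvgrPdist_le => e e0.
have e20 : 0 < e / 2 by rewrite divr_gt0.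
have := cv _ e20; apply: filter_app.
have : \forall s \near within `[0, T]%classic (nbhs t), `|t - s| <= (e / 2) / (M + 1).
  have Q0 : 0 < (e / 2) / (M + 1) by rewrite divr_gt0// ltr_wpDl.
  have H : \forall s \near t, `|t - s| <= (e / 2) / (M + 1).
    by near=> s; near: s; apply: (cvgrPdist_le id t).1 => //; exact: cvg_id.
  by rewrite near_withinE; apply: filterS H.
apply: filter_app; apply: filter_app (withinT `[0, T]%classic _).
near=> s => sI ts h.
move: sI; rewrite /= in_itv/= => /andP[s0 sT]; have sn : `|s| <= T by rewrite ger0_norm.
have -> : \int[mu t]_x K (t, x) - \int[mu s]_x K (s, x) =
  (\int[mu t]_x K (t, x) - \int[mu s]_x K (t, x)) + \int[mu s]_x (K (t, x) - K (s, x)).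
  rewrite RintegralB//; first ring.
  - apply: (@probability_integrable _ _ _ _ _ N) => [|x]; last exact: hN.
    exact: continuous_measurable_rV.
  - apply: (@probability_integrable _ _ _ _ _ N) => [|x]; last exact: hN.
    exact: continuous_measurable_rV (Ck_continuous (CS s)).
rewrite (splitr e) (le_trans (ler_normD _ _))// lerD//.
apply: (@le_trans _ _ (M * `|t - s|)).
  apply: Rintegral_prob_bound => [|x].
    exact: Ck_continuous (CkB (CS t) (CS s)).
  apply: (lipschitz_of_derive (fun u => derive_time u x CK)) => u us.
  apply: hM; rewrite -(subrK s u) (le_trans (ler_normD _ _))//.
  by have := ler_normB t s; lra.
apply: (le_trans (ler_wpM2l M0 ts)); rewrite mulrCA -[leRHS]mulr1.
have P0 : 0 < M + 1 by rewrite ltr_wpDl.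
by rewrite ler_wpM2l ?(ltW e20)// (ler_pdivrMr _ _ P0) mul1r lerDl.
Unshelve. all: by end_near. Qed.

End WeakConservation.

Section Advection.
Context (R : realType) (d : nat) (phi : 'rV[R]_d -> R) (r : R).
Variables (X : R -> 'rV[R]_d -> 'rV[R]_d) (Z : R -> 'rV[R]_d -> R).
Hypothesis X_Ck : forall k i, Ck k (fun p : R * 'rV[R]_d => X p.1 p.2 0 i).
Hypothesis XZ0 : forall x, X 0 x = x /\ Z 0 x = 0.
Hypothesis XZ_outside : forall t x, r < `|x| -> X t x = x /\ Z t x = 0.
Hypothesis transport : forall f, (forall k, Ck k f) -> forall (c s : R) x,
  is_derive s 1 (fun s => f (X s x) * expR (c * Z s x))
    (\sum_i partial i phi x * partial i (fun x => f (X s x) * expR (c * Z s x)) x +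
     c * laplacian phi x * (f (X s x) * expR (c * Z s x))).
Variables (T : R) (mu : R -> probability 'rV[R]_d R).
Hypothesis T0 : 0 < T.
Hypothesis acmu : abs_continuous_curve T mu.
Hypothesis cemu : continuity_equation T mu (grad phi).

(** The difference of steps vanishes before [a], where both are 0, and after [b + e], where both
    have reached [c]; its time support is thus compact in []0, T[]. *)
Lemma advected_test_function (a b e : R) (S : R -> R) (K : R * 'rV[R]_d -> R) rr :
  0 < a -> a < b -> 0 < e -> b + e < T -> (forall k, Ck k S) ->
  (forall x, x <= 0 -> S x = 0) -> (exists c, forall x, e <= x -> S x = c) ->
  (forall k, Ck k K) -> (forall s x, rr < `|x| -> K (s, x) = 0) ->
  test_function [set p : R * 'rV[R]_d | 0 < p.1 < T]
    (fun p => (S (p.1 - a) - S (p.1 - b)) * K p).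
Proof.
move=> a0 ab e0 beT CS S0 [c Sc] CK K0.
pose C := `[a, b + e]%classic `*` [set x : 'rV[R]_d | `|x| <= rr].
have cC : compact C by apply: compact_setX; [exact: segment_compact|exact: compact_rV_ball].
have clC : closed C.
  by apply: compact_closed => //; exact: norm_hausdorff.
have suppC : supp (fun p : R * 'rV[R]_d => (S (p.1 - a) - S (p.1 - b)) * K p) `<=` C.
  rewrite [X in _ `<=` X]((closure_id C).1 clC); apply: closure_subset => -[u x] /= h.
  split => /=; last first.
    by rewrite leNgt; apply: contra h => /K0 ->; rewrite mulr0.
  rewrite in_itv/=; apply/andP; split; rewrite leNgt; apply: contra h => h.
    by rewrite !S0 ?subrr ?mul0r// subr_le0; lra.
  by rewrite !Sc ?subrr ?mul0r//; lra.
split.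
- apply/smoothP => k; apply: CkM => //.
  have sh v : Ck k (fun p : R * 'rV[R]_d => S (p.1 - v)).
    apply: (Ck_affine (A := fun p : R * 'rV[R]_d => p.1 - v)
      (L := fun v : R * 'rV[R]_d => v.1) _ _ (CS k)).
      by move=> p; apply: cvgB; [exact: cvg_fst|exact: cvg_cst].
    by move=> x w h; rewrite /= addrAC.
  by apply: CkB.
- by apply: subclosed_compact cC suppC; exact: closed_closure.
- move=> p /suppC[] /=; rewrite in_itv/= => /andP[h1 h2] _.
  by apply/andP; split; lra.
Qed.

(** [K (s, x)] is constant along trajectories, so its integral [q s] against [mu s] should be
    constant, and [q 0], [q t] are the two sides. The continuity equation for [K] times a difference
    of steps is exactly what [constant_of_steps] asks for. *)
Lemma advected_conservation (g : 'rV[R]_d -> R) rg t :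
  (forall k, Ck k g) -> (forall x, rg < `|x| -> g x = 0) -> 0 <= t <= T ->
  \int[mu 0]_x g (X t x) = \int[mu t]_x g x.
Proof.
move=> Cg g0 /andP[t0 tT]; pose rr := Num.max r rg.
pose K (p : R * 'rV[R]_d) := g (X (t - p.1) p.2).
have CK k : Ck k K.
  have := Ck_time_affine t (- 1) (pulled_Ck X_Ck (Cg k)).
  by under eq_fun do rewrite mulN1r.
have K0 s x : rr < `|x| -> K (s, x) = 0.
  by move=> xr; rewrite /K/= (pulled_outside XZ_outside g0).
have DK s x := pulled_derive transport t s x Cg.
pose q s := \int[mu s]_x K (s, x).
have cq := curve_integral_continuous T0 acmu (CK 1%N) K0.
suff E : q 0 = q t.
  have -> : \int[mu t]_x g x = q t.
    by apply: eq_Rintegral => x _; rewrite /K/= subrr (XZ0 x).1.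
  by rewrite -E; apply: eq_Rintegral => x _; rewrite /K/= subr0.
apply: (constant_of_steps T0 cq); rewrite ?lexx ?t0 ?(ltW T0)//.
move=> a b e S s a0 ab e0 beT CS DS S0 Sc.
have tf := advected_test_function a0 ab e0 beT CS S0 Sc CK K0.
rewrite -[RHS](cemu tf); apply: eq_Rintegral => u _.
rewrite /q -RintegralZl//; last first.
  have [M M0 hM] := @time_ball_bound _ _ _ `|u| rr (Ck_continuous (CK 0%N)) K0.
  apply: (@probability_integrable _ _ _ _ _ M) => [|x]; last exact: hM.
  exact: continuous_measurable_rV (Ck_continuous (Ck_slice u (CK 0%N))).
apply: eq_Rintegral => x _.
have Cpsi := (smoothP _).1 (let: And3 h _ _ := tf in h) 1%N.
have DSv (v w : R) : is_derive w 1 (fun w => S (w - v)) (s (w - v)).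
  have := @is_derive_affine _ _ _ _ (fun w : R => w - v) S w 1 1 (s (w - v)).
  by apply=> h; rewrite addrAC.
have [_ <-] := derive_time u x Cpsi.
have [_ ->] := is_deriveM (is_deriveB (DSv a u) (DSv b u)) (DK u x).
rewrite /GRing.scale/= !fctE /dotp.
have gradE i : grad (fun y => (S (u - a) - S (u - b)) * K (u, y)) x 0 i =
    (S (u - a) - S (u - b)) * partial i (fun x => g (X (t - u) x)) x.
  rewrite mxE /partial.
  have Ds := Ck_derive x (delta_mx 0 i) (Ck_slice u (CK 1%N)).
  by have [_ ->] := is_deriveZ (S (u - a) - S (u - b)) Ds.
have -> : \sum_i grad (fun y => (S (u - a) - S (u - b)) * K (u, y)) x 0 i * grad phi x 0 i =
  (S (u - a) - S (u - b)) * (\sum_i partial i phi x * partial i (fun x => g (X (t - u) x)) x).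
  rewrite mulr_sumr; apply: eq_bigr => i _.
  by rewrite gradE mxE -mulrA; congr (_ * _); rewrite mulrC.
(* The time derivative of [K] cancels its derivative along the gradient of [phi]; only the
   derivative of the time factor survives. *)
rewrite /K/=; ring.
Qed.

End Advection.

(** * The functional along the curve *)

Section LinftyContinuous.
Context (R : realType) (d : nat).
Local Notation leb := (lebesgue_rv R d).

(** The norm ['N[leb]_+oo] is the essential supremum only on a space of positive mass. Were the
    whole space null, the constant -1 would be nonnegative almost everywhere, hence everywhere. *)
Lemma lebesgue_rv_setT_gt0 : (0 < leb setT)%E.
Proof.
rewrite lt0e measure_ge0 andbT; apply/negP => /eqP leb0.
have : 0 <= (- 1 : R).
  apply: (@continuous_ae_ge0 R d (fun=> - 1) (@cst_continuous _ _ _) _ 0).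
  by exists setT; split => //; exact: subsetT.
by rewrite oppr_ge0 ler10.
Qed.

Lemma Lnorm_infty (f : 'rV[R]_d -> R) :
  'N[leb]_+oo[EFin \o f]%E = ess_sup leb (abse \o (EFin \o f))%E.
Proof. by rewrite unlock /= lebesgue_rv_setT_gt0. Qed.

Lemma Lnorm_infty_ge0 (f : 'rV[R]_d -> R) : (0 <= 'N[leb]_+oo[EFin \o f])%E.
Proof.
by rewrite Lnorm_infty; apply: ess_sup_gee; [exact: lebesgue_rv_setT_gt0|apply: aeW => x; exact: abse_ge0].
Qed.

Lemma Lnorm_infty_le (f : 'rV[R]_d -> R) M : (forall x, `|f x| <= M) ->
  ('N[leb]_+oo[EFin \o f] <= M%:E)%E.
Proof.
by move=> fM; rewrite Lnorm_infty; apply/ess_supP; apply: aeW => x; rewrite /= lee_fin.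
Qed.

Lemma bounded_Lfun_infty (f : 'rV[R]_d -> R) M : continuous f ->
  (forall x, `|f x| <= M) -> f \in Lfun leb +oo%E.
Proof.
move=> cf fM; apply/andP; split.
  by rewrite inE; exact: continuous_measurable_rV.
by rewrite inE /=; apply: le_lt_trans (Lnorm_infty_le fM) _; exact: ltry.
Qed.

Lemma Linfty_norm_le (f : 'rV[R]_d -> R) M : (forall x, `|f x| <= M) ->
  Linfty_norm f <= M.
Proof.
move=> fM; have h := Lnorm_infty_le fM; rewrite /Linfty_norm.
have M0 : 0 <= M by exact: le_trans (fM 0).
by move: h (Lnorm_infty_ge0 f); case: ('N[leb]_+oo[EFin \o f])%E => //= s; rewrite lee_fin.
Qed.

Lemma Linfty_norm_ge0 (f : 'rV[R]_d -> R) : 0 <= Linfty_norm f.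
Proof. by rewrite fine_ge0// Lnorm_infty_ge0. Qed.

Lemma le_Linfty_norm (f : 'rV[R]_d -> R) : continuous f -> f \in Lfun leb +oo%E ->
  forall x, `|f x| <= Linfty_norm f.
Proof.
move=> cf /andP[_]; rewrite inE /= /finite_norm => fin x.
have c : continuous (fun x => Linfty_norm f - `|f x|).
  by move=> y; exact: (cvgB (cvg_cst (Linfty_norm f)) (cvg_norm (cf y))).
rewrite -subr_ge0; suff H : {ae leb, forall y, 0 <= Linfty_norm f - `|f y|}.
  exact: (continuous_ae_ge0 c H x).
have := ess_sup_ge leb (abse \o (EFin \o f))%E; rewrite -Lnorm_infty.
apply: filterS => y; rewrite -[X in (_ <= X)%E]fineK ?ge0_fin_numE ?Lnorm_infty_ge0//.
by rewrite /= lee_fin subr_ge0.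
Qed.

End LinftyContinuous.

Section Densities.
Context (R : realType) (d : nat).
Local Notation leb := (lebesgue_rv R d).

Lemma has_density_ae_eq (m : probability 'rV[R]_d R) (f g : 'rV[R]_d -> R) :
  has_density m f -> has_density m g -> f = g %[ae leb].
Proof.
move=> [mf f0 fE] [mg g0 gE].
have fi : leb.-integrable setT (EFin \o f).
  apply/integrableP; split; first exact/measurable_EFinP.
  rewrite (ae_eq_integral (EFin \o f))//.
  - by rewrite -fE//; apply: le_lt_trans (probability_le1 m measurableT) _; exact: ltry.
  - by apply: measurableT_comp => //; exact/measurable_EFinP.
  - exact/measurable_EFinP.
  - by apply: filterS f0 => x fx _; rewrite /= ger0_norm.
have := @integral_ae_eq _ _ _ leb setT measurableT (EFin \o g) (EFin \o f) fi.
move=> H; have {}H := H _ _.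
have : ae_eq leb setT (EFin \o f) (EFin \o g).
  apply: H; first exact/measurable_EFinP.
  by move=> E _ mE; rewrite -fE// -gE.
by apply: filterS => x /(_ I) [].
Qed.

(** Evaluates [lift_Pac] at a measure whose smooth density is known: continuous densities that agree
    almost everywhere agree everywhere. *)
Lemma Pac_density_unique (m : probability 'rV[R]_d R) (f : 'rV[R]_d -> R) :
  Pac_density m f -> get (Pac_density m) = f.
Proof.
move=> mf; have [_ D1 S1 _] := mf.
have [_ D2 S2 _] : Pac_density m (get (Pac_density m)) by apply: getPex; exists f.
apply: continuous_ae_eq; last exact: has_density_ae_eq D2 D1.
  exact: Ck_continuous ((smoothP _).1 S2 0%N).
exact: Ck_continuous ((smoothP _).1 S1 0%N).
Qed.

End Densities.

(** * First-order expansion along a family of perturbations *)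

Section Differential.
Context (R : realType) (d : nat).
Local Notation leb := (lebesgue_rv R d).

Lemma vanishing_at_0_bound (K : R * 'rV[R]_d -> R) (T r : R) : Ck 1 K ->
  (forall s x, r < `|x| -> K (s, x) = 0) -> (forall x, K (0, x) = 0) ->
  exists2 C : R, 0 <= C & forall s x, `|s| <= T -> `|K (s, x)| <= C * `|s|.
Proof.
move=> CK Kr K0; have [_ _ /(_ (1, 0)) cD] := CK.
have [C C0 hC] := @time_ball_bound _ _ _ T r cD (derive_time_outside CK Kr).
exists C => // s x sT.
have := @lipschitz_of_derive R (fun s => K (s, x)) _ C 0 s (fun s => derive_time s x CK).
rewrite /= K0 !subr0; apply=> y; rewrite subr0 => ys.
by apply: hC; exact: le_trans sT.
Qed.

(** As [b t] is O(t) in L^oo, the remainder divided by [t] is at most [C] times its quotient by the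
    norm of [b t], which tends to 0; the linear term supplies the limit. *)
Lemma differential_along (JJ : ('rV[R]_d -> R) -> R) (rho F : 'rV[R]_d -> R)
    (b : R -> 'rV[R]_d -> R) (T C I : R) :
  represents_differential JJ rho F -> 0 < T -> 0 <= C ->
  (forall t, 0 <= t <= T -> continuous (b t)) ->
  (forall t x, 0 <= t <= T -> `|b t x| <= C * t) ->
  (forall t, 0 <= t <= T -> Linfty_ge0 (rho \+ b t)) ->
  t^-1 * (\int[leb]_x (F x * b t x)) @[t --> 0^'+] --> I ->
  t^-1 * (JJ (rho \+ b t) - JJ rho) @[t --> 0^'+] --> I.
Proof.
move=> [h hE hs] T0 C0 cb bC bL cvI.
have b0 : b 0 = cst 0.
  apply/funext => x; apply/eqP; rewrite -normr_le0.
  by have := bC 0 x; rewrite mulr0; apply; rewrite lexx ltW.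
have bLf t : 0 <= t <= T -> b t \in Lfun leb +oo%E.
  by move=> tT; apply: (bounded_Lfun_infty (cb t tT)) => x; exact: bC.
(* The smallness of [h] concerns a quotient by a positive norm and says nothing at 0; the value
   there is read off the expansion at the zero perturbation. *)
have h0 : h (cst 0) = 0.
  have t0 : 0 <= (0 : R) <= T by rewrite lexx ltW.
  have [_] := hE _ (bLf 0 t0) (bL 0 t0); rewrite b0.
  rewrite (_ : rho \+ cst 0 = rho); last by apply/funext => x; rewrite /= addr0.
  under eq_Rintegral do rewrite mulr0.
  rewrite Rintegral_cst// mul0r addr0 => /esym/eqP.
  by rewrite -subr_eq0 addrAC subrr add0r => /eqP.
have hcv : t^-1 * h (b t) @[t --> 0^'+] --> 0.
  apply/cvgrPdist_le => e e0.
  have e1 : 0 < e / (C + 1) by rewrite divr_gt0// ltr_wpDl.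
  have [del del0 hdel] := hs _ e1.
  near=> t.
  have t0 : 0 < t by near: t; exact: nbhs_right_gt.
  have tT : t <= T by near: t; exact: nbhs_right_le.
  have td : t < del / (C + 1).
    by near: t; apply: nbhs_right_lt; rewrite divr_gt0// ltr_wpDl.
  have tI : 0 <= t <= T by rewrite ltW.
  have ti : 0 <= t^-1 by rewrite invr_ge0 ltW.
  rewrite sub0r normrN normrM (ger0_norm ti).
  (* A zero norm is not covered by [hs]; by continuity [b t] then vanishes identically. *)
  have [N0|N0] := eqVneq (Linfty_norm (b t)) 0.
    rewrite (_ : b t = cst 0) ?h0 ?normr0 ?mulr0 ?ltW//.
    apply/funext => x; apply/eqP; rewrite -normr_le0 -N0.
    exact: le_Linfty_norm (cb t tI) (bLf t tI) x.
  have Np : 0 < Linfty_norm (b t) by rewrite lt0r N0 Linfty_norm_ge0.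
  have NC : Linfty_norm (b t) <= C * t by apply: Linfty_norm_le => x; exact: bC.
  have Nd : Linfty_norm (b t) < del.
    apply: (le_lt_trans NC); apply: (@le_lt_trans _ _ (t * (C + 1))).
      by rewrite mulrC ler_pM2l// lerDl.
    by rewrite -ltr_pdivlMr// ltr_wpDl.
  have := hdel _ (bLf t tI); rewrite Np Nd => /(_ isT).
  rewrite normrM normfV (gtr0_norm Np) ltr_pdivrMr// => /ltW hb.
  rewrite [leLHS]mulrC ler_pdivrMr//; apply: (le_trans hb).
  apply: (@le_trans _ _ (e / (C + 1) * (C * t))).
    by apply: ler_wpM2l => //; exact: ltW.
  by rewrite mulrA ler_pM2r// mulrAC ler_pdivrMr ?ltr_wpDl// ler_pM2l// lerDl.
rewrite -[I]addr0.
apply: cvg_trans (cvgD cvI hcv); apply: near_eq_cvg; near=> t.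
have t0 : 0 < t by near: t; exact: nbhs_right_gt.
have tT : t <= T by near: t; exact: nbhs_right_le.
have tI : 0 <= t <= T by rewrite ltW.
have [_ ->] := hE _ (bLf t tI) (bL t tI).
by rewrite !fctE; ring.
Unshelve. all: by end_near.
Qed.

End Differential.

Section PushedDensity.
Context (R : realType) (d : nat).
Local Notation leb := (lebesgue_rv R d).

Lemma EFin_Rintegral {dT} {T : measurableType dT} (m : {measure set T -> \bar R})
    (f : T -> R) : m.-integrable setT (EFin \o f) ->
  (\int[m]_x (f x)%:E)%E = (\int[m]_x f x)%:E.
Proof. by move=> i; rewrite fineK//; exact: integrable_fin_num. Qed.

(** The integral of [g] against [m1] equals that of [g (Y x)] against [m0], hence against [f dx],
    hence that of [g] against [p dx]; [measure_eq_of_test] concludes. [Y] stands for the flow map at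
    a fixed time. *)
Lemma has_density_of_test (m0 m1 : probability 'rV[R]_d R) (f p : 'rV[R]_d -> R)
    (Y : 'rV[R]_d -> 'rV[R]_d) :
  has_density m0 f -> continuous f -> continuous p -> (forall x, 0 <= p x) ->
  (forall g : 'rV[R]_d -> R, (forall k, Ck k g) -> (exists r, forall x, r < `|x| -> g x = 0) ->
    [/\ continuous (g \o Y), exists r, forall x, r < `|x| -> g (Y x) = 0,
      \int[m0]_x g (Y x) = \int[m1]_x g x
    & \int[leb]_x (g (Y x) * f x) = \int[leb]_x (g x * p x)]) ->
  has_density m1 p.
Proof.
move=> [mf f0 m0E] cf cp p0 H; have mp := continuous_measurable_rV cp.
have f0' := continuous_ae_ge0 cf f0.
have [m2 hm2] := density_measure leb mp p0.
split => //; first by apply: aeW.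
move=> A mA; rewrite -hm2; apply: measure_eq_of_test => // [|g Cg g0 gr].
  by apply: le_lt_trans (probability_le1 m1 measurableT) _; exact: ltry.
have [cgY [rY gY0] E1 E2] := H g Cg gr; have [r gr0] := gr.
have cg := Ck_continuous (Cg 0%N).
have [M _ gM] := compact_support_bound cg gr0.
have [N _ gN] := compact_support_bound cgY gY0.
have i1 := probability_integrable m1 (continuous_measurable_rV cg) gM.
have i0 := probability_integrable m0 (continuous_measurable_rV cgY) gN.
rewrite EFin_Rintegral// -E1 -(EFin_Rintegral i0).
rewrite (density_integral mf f0' m0E (f := fun x => (g (Y x))%:E)); last 2 first.
- by apply/measurable_EFinP; exact: continuous_measurable_rV.
- by move=> x; rewrite lee_fin.
rewrite (density_integral mp p0 (fun A _ => hm2 A) (f := fun x => (g x)%:E)) //; last first.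
  by apply/measurable_EFinP; exact: continuous_measurable_rV.
transitivity (\int[leb]_x (g (Y x) * f x))%:E.
  rewrite -EFin_Rintegral//; apply: (integrable_lebesgue_compact (r := rY)).
    by move=> x; exact: (cvgM (cgY x) (cf x)).
  by move=> x xr; rewrite gY0// mul0r.
rewrite E2 -EFin_Rintegral//; apply: (integrable_lebesgue_compact (r := r)).
  by move=> x; exact: (cvgM (cg x) (cp x)).
by move=> x xr; rewrite gr0// mul0r.
Qed.

End PushedDensity.

Theorem proposition4 (R : realType) (d n : nat)
    (a : ('rV[R]_d -> R) -> ('rV[R]_d -> 'rV[R]_n) -> ('rV[R]_d -> 'rV[R]_n) -> R)
    (l : ('rV[R]_d -> R) -> ('rV[R]_d -> 'rV[R]_n) -> R)
    (u : ('rV[R]_d -> R) -> ('rV[R]_d -> 'rV[R]_n))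
    (J : ('rV[R]_d -> R) -> ('rV[R]_d -> 'rV[R]_n) -> R)
    (HJ : density_method a l u J)
    (rho : 'rV[R]_d -> R) (nu : probability 'rV[R]_d R)
    (Hrho : Pac_density nu rho)
    (F : 'rV[R]_d -> R) (HF : smooth F)
    (HFJ : represents_differential (objective u J) rho F)
    (phi : 'rV[R]_d -> R) (Hphi : test_function setT phi)
    (T : R) (T_gt0 : 0 < T)
    (mu : R -> probability 'rV[R]_d R) (rhot : R -> 'rV[R]_d -> R)
    (Hrhot : forall t, 0 <= t <= T -> has_density (mu t) (rhot t))
    (Hrho0 : rhot 0 = rho %[ae lebesgue_rv R d])
    (Hac : abs_continuous_curve T mu)
    (Hce : continuity_equation T mu (grad phi)) :
  (forall t, 0 <= t <= T -> Pac (mu t)) /\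
  t^-1 * (lift_Pac (objective u J) (mu t) - lift_Pac (objective u J) (mu 0))
    @[t --> 0^'+] -->
  \int[lebesgue_rv R d]_x (dotp (grad F x) (grad phi x) * rho x).
Proof.
have [r _ phi0] := supp_bounded Hphi.
have [/smoothP Cphi _ _] := Hphi.
have [X [Z [X_Ck Z_Ck XZ0 XZout transport]]] := transport_exists Cphi phi0.
have [_ [mrho rhoge _] /smoothP Crho rhoLf] := Hrho.
have crho := Ck_continuous (Crho 0%N).
have rho0 := continuous_ae_ge0 crho rhoge.
have rhoN := le_Linfty_norm crho rhoLf.
move/smoothP : HF => CF.
have zT : 0 <= (0 : R) <= T by rewrite lexx ltW.
(* The initial density of the curve is given only up to a null set; [rho] is its smooth
   representative. *)
have m0rho : has_density (mu 0) rho.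
  have [m0 _ mE] := Hrhot 0 zT; split => // A mA; rewrite mE//.
  apply: ae_eq_integral => //.
  - by apply/measurable_EFinP; exact: measurable_funTS.
  - by apply/measurable_EFinP; exact: measurable_funTS.
  - by apply: filterS Hrho0 => x /(_ I) xE _; rewrite /= xE.
(* Candidate density, defined for every real [t], so that time derivatives at 0 are two-sided; the
   limit is restricted to positive [t] only at the very end. *)
pose p t := pushed X Z rho (- t).
have p_0 : p 0 = rho.
  by apply/funext => x; rewrite /p oppr0 /pushed (XZ0 x).1 (XZ0 x).2 expR0 mulr1.
have pout t x : r < `|x| -> p t x = rho x.
  by move=> xr; rewrite /p /pushed (XZout _ _ xr).1 (XZout _ _ xr).2 expR0 mulr1.
have CPp k : Ck k (fun q : R * 'rV[R]_d => p q.1 q.2).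
  have := Ck_time_affine 0 (- 1) (pushed_Ck X_Ck Z_Ck (Crho k)).
  by under eq_fun do rewrite /= mulN1r add0r.
have Cp k t : Ck k (p t) by exact: (Ck_slice (K := fun q => p q.1 q.2) t (CPp k)).
have cp t : continuous (p t) := Ck_continuous (Cp 0%N t).
have pge0 t x : 0 <= p t x by rewrite mulr_ge0 ?expR_ge0 ?rho0.
(* The increment, unlike [p] itself, is supported in a fixed ball; as it vanishes at time 0, this
   gives the uniform O(t) bound [hC]. *)
pose B (q : R * 'rV[R]_d) := p q.1 q.2 - rho q.2.
have CB k : Ck k B.
  by apply: CkB => //; exact: Ck_snd.
have B0 s x : r < `|x| -> B (s, x) = 0 by move=> xr; rewrite /B /= pout// subrr.
have B00 x : B (0, x) = 0 by rewrite /B /= p_0 subrr.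
have [C C0 hC] := @vanishing_at_0_bound R d B T r (CB 1%N) B0 B00.
have tabs t : 0 <= t <= T -> `|t| = t by move=> /andP[t0 _]; rewrite ger0_norm.
have bC t x : 0 <= t <= T -> `|B (t, x)| <= C * t.
  by move=> tT; have := hC t x; rewrite (tabs t tT); apply; case/andP: tT.
have cb t : continuous (fun x => B (t, x)).
  exact: Ck_continuous (Ck_slice t (CB 0%N)).
have pE t : p t = rho \+ (fun x => B (t, x)).
  by apply/funext => x; rewrite /B /= addrC subrK.
have pN t x : 0 <= t <= T -> `|p t x| <= Linfty_norm rho + C * t.
  by move=> tT; rewrite pE; apply: le_trans (ler_normD _ _) _; rewrite lerD// bC.
have pLf t : 0 <= t <= T -> p t \in Lfun (lebesgue_rv R d) +oo%E.
  by move=> tT; apply: (bounded_Lfun_infty (cp t)) => x; exact: pN.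
have mp t : 0 <= t <= T -> Pac_density (mu t) (p t).
  move=> tT; split; [exact: Hac.1| |by apply/smoothP => k|exact: pLf].
  apply: (has_density_of_test (Y := X t) m0rho crho) => // g Cg [rg g0].
  split.
  - exact: (Ck_continuous (Ck_slice (K := fun q => g (X q.1 q.2)) t (pulled_Ck X_Ck (Cg 0%N)))).
  - by exists (Num.max r rg); exact: (pulled_outside XZout g0 t).
  - exact: (advected_conservation X_Ck XZ0 XZout transport T_gt0 Hac Hce Cg g0 tT).
  - exact: (pushed_conservation Cphi X_Ck Z_Ck XZ0 XZout transport t (Crho) Cg g0).
split; first by move=> t tT; exists (p t); exact: mp.
have liftE t : 0 <= t <= T -> lift_Pac (objective u J) (mu t) = objective u J (p t).
  by move=> tT; rewrite /lift_Pac (Pac_density_unique (mp t tT)).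
suff cv : t^-1 * (objective u J (rho \+ (fun x => B (t, x))) - objective u J rho)
    @[t --> 0^'+] --> \int[lebesgue_rv R d]_x (dotp (grad F x) (grad phi x) * rho x).
  apply: cvg_trans cv; apply: near_eq_cvg; near=> t.
  have tT : 0 <= t <= T.
    apply/andP; split; first by apply: ltW; near: t; exact: nbhs_right_gt.
    by near: t; exact: nbhs_right_le.
  by rewrite (liftE t tT) (liftE 0 zT) p_0 pE.
apply: (@differential_along _ _ _ _ _ (fun t x => B (t, x)) T C _ HFJ) => //.
  move=> t tT; split; first by rewrite -pE; exact: pLf.
  by apply: aeW => x; have := pge0 t x; rewrite pE.
(* [F] comes without a growth bound, but the product with [B] is supported in a fixed ball, so the
   linear term can be differentiated under the integral. *)
pose K (q : R * 'rV[R]_d) := F q.2 * B q.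
have CK : Ck 1 K.
  by apply: CkM; [exact: Ck_snd|exact: CB].
have K0 s x : r < `|x| -> K (s, x) = 0 by move=> xr; rewrite /K B0// mulr0.
have [D DE] := integral_derive_time 0 CK K0.
have -> : \int[lebesgue_rv R d]_x (dotp (grad F x) (grad phi x) * rho x) =
    \int[lebesgue_rv R d]_x 'D_(1, 0) K (0, x).
  pose q i x := rho x * partial i phi x.
  have Cq i : Ck 1 (q i) by apply: CkM; [exact: Crho|exact: partial_Ck Cphi 1 i].
  have q0 i x : r < `|x| -> q i x = 0.
    by move=> xr; rewrite /q (partial_outside phi0)// mulr0.
  have dK x : 'D_(1, 0) K (0, x) = - (F x * \sum_i partial i (q i) x).
    have [_ <-] := derive_time 0 x CK.
    have H := pushed_derive Cphi X_Ck Z_Ck transport 0 x Crho.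
    have [_ ->] := is_deriveZ (F x) (is_deriveB H (is_derive_cst (rho x) (0 : R) 1)).
    by rewrite -/(p 0) p_0 subr0 scalerN.
  pose A x := \sum_i partial i F x * q i x.
  pose h i x := F x * q i x.
  have Ch i : Ck 1 (h i) by apply: CkM; [exact: CF|exact: Cq].
  have h0 i x : r < `|x| -> h i x = 0 by move=> xr; rewrite /h q0// mulr0.
  have cA : continuous A.
    apply: (Ck_continuous (k := 0%N)); apply: Ck_sum => i.
    by apply: CkM; [exact: partial_Ck CF 0%N i|exact: CkW (Cq i)].
  have cdiv : continuous (fun x => \sum_i partial i (h i) x).
    apply: (Ck_continuous (k := 0%N)); apply: Ck_sum => i.
    by have [_ _ /(_ (delta_mx 0 i))] := Ch i.
  have A0 x : r < `|x| -> A x = 0.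
    by move=> xr; rewrite /A big1// => i _; rewrite q0// mulr0.
  have div0 x : r < `|x| -> \sum_i partial i (h i) x = 0.
    by move=> xr; rewrite big1// => i _; apply: derive_outside xr => y; exact: h0.
  transitivity (\int[lebesgue_rv R d]_x A x).
    apply: eq_Rintegral => x _; rewrite /dotp mulr_suml; apply: eq_bigr => i _.
    by rewrite !mxE -mulrA /q [rho x * _]mulrC.
  (* Integration by parts: the subtracted divergence has integral 0, and since [h i] is [F] times
     the flux [q i], the product rule leaves [- F div (rho grad phi)]. *)
  transitivity (\int[lebesgue_rv R d]_x (A x - \sum_i partial i (h i) x)).
    rewrite RintegralB//; last 2 first.
    - exact: integrable_lebesgue_compact cA A0.
    - exact: integrable_lebesgue_compact cdiv div0.
    by rewrite (integral_divergence_0 Ch h0) subr0.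
  apply: eq_Rintegral => x _; rewrite dK -sumrB mulr_sumr -sumrN.
  apply: eq_bigr => i _.
  have [_ E] := is_deriveM (Ck_derive x (delta_mx 0 i) (CF 1%N))
    (Ck_derive x (delta_mx 0 i) (Cq i)).
  rewrite /partial /h in E *; rewrite E /GRing.scale/=; ring.
have K00 : \int[lebesgue_rv R d]_x K (0, x) = 0.
  under eq_Rintegral do rewrite /K B00 mulr0.
  by rewrite Rintegral_cst// mul0r.
have D' : t^-1 * (\int[lebesgue_rv R d]_x K (t, x)) @[t --> 0^'] -->
    \int[lebesgue_rv R d]_x 'D_(1, 0) K (0, x).
  rewrite -DE; move: D; rewrite /derivable /derive => D.
  apply: cvg_trans D; apply: near_eq_cvg; apply: nearW => t /=.
  by rewrite addr0 [t *: 1]mulr1 K00 subr0.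
exact: cvg_dnbhs_at_right D'.
Unshelve. all: by end_near.
Qed.
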